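(* Let $k\in\mathbb{Z}_{\ge1}$ be odd, $m\in\{1,3\}$, $b\in\{1,4\}$, $p\ge3$ a prime and $r\in\mathbb{Z}_{\ge1}$. Let $\bar p$ denote the multiplicative inverse of $p$ modulo $4$. If $p^r\equiv1\pmod4$, then \begin{multline*} \mathscr{H}_{k,m,4,b}(p^r)=\sum_{\mu=0}^{(k-1)/2}2^{-2\mu}T(k,\mu)\left(\alpha_{k-2\mu,m,4,b}(p^r)-p^{k-2\mu+1}\alpha_{k-2\mu,m\bar p,4,b}(p^{r-2})\right)p^{r\mu}\\ -b^{-\frac12}\left(\frac{-1}{m}\right)\left(\frac{2}{p^r}\right)2^{-k-1}\sum_{\mu=0}^{(k-1)/2}T(k,\mu)p^{r\mu}-\delta_{2\mid r}\frac1{12}p^{\frac{rk}2}(p-1)\left(\frac{-1}{m}\right)\varepsilon(p^r), \end{multline*} where $\varepsilon(p^r)=\left(\frac{-1}{p^{r/2}}\right)$ for $r$ even, and $\alpha_{\ell,m\bar p,4,b}(p^{-1})$ is taken to be $0$ in the case $r=1$. If $p^r\equiv3\pmod4$, then $\mathscr{H}_{k,m,4,b}(p^r)=0$.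
   Context: $\delta_{\mathcal S}=1$ if the statement $\mathcal S$ is true and $0$ otherwise. $T(k,\mu)=\frac{k-2\mu+1}{k-\mu+1}\binom{k}{\mu}$. $\left(\frac{\cdot}{\cdot}\right)$ is the Jacobi symbol. Hurwitz class numbers: for a negative integer $D\equiv0,1\pmod4$, $H(|D|)=\sum_Q 1/\omega_Q$, the sum over $\mathrm{SL}_2(\mathbb{Z})$-classes of (not necessarily primitive) positive definite integral binary quadratic forms of discriminant $D$, with $\omega_Q=2$ if $Q$ is equivalent to $a(x^2+y^2)$, $\omega_Q=3$ if $Q$ is equivalent to $a(x^2+xy+y^2)$, $\omega_Q=1$ otherwise. $H(0):=-\frac1{12}$, and $H(x):=0$ for every other rational $x$. $\mathscr{H}_{k,m,M,b}(p^r):=\sum_{t\in\mathbb{Z},\,p\nmid t,\,t\equiv m\,(M)}H\left(\frac{p^r-t^2}{b}\right)t^k$. Let $q=e^{2\pi i\tau}$, $\mathcal{H}(\tau)=\sum_{n\ge0}H(n)q^n$, $(\mathcal{H}|V_b)(\tau)=\mathcal{H}(b\tau)$, and $\theta_{j,m,M}(\tau)=\sum_{n\in\mathbb{Z},\,n\equiv m\,(M)}n^jq^{n^2}$ (with $0^0=1$). Rankin–Cohen bracket, for functions $F_1,F_2$ with associated weights $\kappa_1,\kappa_2$: $[F_1,F_2]_k=\frac1{(2\pi i)^k}\sum_{i=0}^k(-1)^i\binom{\kappa_1+k-1}{k-i}\binom{\kappa_2+k-1}{i}\frac{\partial^iF_1}{\partial\tau^i}\frac{\partial^{k-i}F_2}{\partial\tau^{k-i}}$,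 with generalized binomials $\binom{\alpha}{i}=\frac{\Gamma(\alpha+1)}{i!\,\Gamma(\alpha-i+1)}$. In $[\mathcal{H}|V_b,\theta_{j,m,M}]$ the weights are $\kappa_1=\frac32$, $\kappa_2=\frac12+j$. For $\ell\ge0$, $n\ge1$: $\lambda_{\ell,m,M,b}(n)=\sum_{\varepsilon\in\{\pm1\}}\varepsilon^\ell\sum^*(t-\sqrt b\,s)^{\ell+1}$, where $\sum^*$ runs over integers $t\ge1,s\ge0$ with $t^2-bs^2=n$ and $t\equiv\varepsilon m\pmod M$, and terms with $s=0$ have weight $\frac12$. $\Lambda_{\ell,m,M,b}=\sum_{n\ge1}\lambda_{\ell,m,M,b}(n)q^n$. For $\ell\ge0$ and $j\in\{0,1\}$, $j\equiv\ell\pmod2$: $f_{\ell,m,M,b}=[\mathcal{H}|V_b,\theta_{j,m,M}]_{\lfloor\ell/2\rfloor}+b^{-1/2}2^{-1-\ell}\binom{\ell}{\lfloor\ell/2\rfloor}\Lambda_{\ell,m,M,b}=\sum_{n\ge0}\gamma_{\ell,m,M,b}(n)q^n$, and $\alpha_{\ell,m,M,b}(n)=\binom{\ell}{\lfloor\ell/2\rfloor}^{-1}\gamma_{\ell,m,M,b}(n)$. *)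

(* Defs.v *)
From HB Require Import structures.
From mathcomp Require Export all_boot all_order all_algebra.
From mathcomp Require Export all_classical all_reals all_analysis.
From mathcomp Require Export complex.

Set Implicit Arguments.
Unset Strict Implicit.
Unset Printing Implicit Defensive.

Export Order.TTheory GRing.Theory Num.Theory.
Export numFieldNormedType.Exports.

Local Open Scope classical_set_scope.
Local Open Scope ring_scope.

(** * Jacobi symbol *)

Definition legendre (a : int) (p : nat) : int :=
  if (p%:Z %| a)%Z then 0
  else if `[< exists x : int, (x ^+ 2 = a %[mod p%:Z])%Z >] then 1 else -1.

(* Meaningful for odd [n > 0]. *)
Definition jacobi (a : int) (n : nat) : int :=
  \prod_(p <- primes n) legendre a p ^+ logn p n.

(** * Hurwitz class numbers *)

(* [(a, b, c)] stands for the form a x^2 + b x y + c y^2. *)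
Definition bqform : Type := (int * int * int)%type.

Definition bqeval (Q : bqform) (x y : int) : int :=
  Q.1.1 * x ^+ 2 + Q.1.2 * x * y + Q.2 * y ^+ 2.

Definition bqdisc (Q : bqform) : int := Q.1.2 ^+ 2 - 4 * Q.1.1 * Q.2.

Definition bqposdef (Q : bqform) : Prop :=
  forall x y : int, (x, y) != (0, 0) -> 0 < bqeval Q x y.

Definition bqequiv (Q Q' : bqform) : Prop :=
  exists u v w z : int, u * z - v * w = 1 /\
    forall x y, bqeval Q' x y = bqeval Q (u * x + v * y) (w * x + z * y).

Definition bqclass (Q : bqform) : set bqform := [set Q' | bqequiv Q Q'].

Definition bqclasses (D : int) : set (set bqform) :=
  [set bqclass Q | Q in [set Q | bqposdef Q /\ bqdisc Q = D]].

(* A form is equivalent to a(x^2+y^2) iff its class contains that form. *)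
Definition bqomega (C : set bqform) : nat :=
  if `[< exists a : int, C (a, 0, a) >] then 2%N
  else if `[< exists a : int, C (a, a, a) >] then 3%N
  else 1%N.

Definition hurwitz (x : rat) : rat :=
  if x == 0 then - (12%:R)^-1
  else if [&& x \is a Num.int, 0 < x &
              ((- numq x) %% 4)%Z \in [:: 0; 1] ] then
    \sum_(C \in bqclasses (- numq x)) ((bqomega C)%:R : rat)^-1
  else 0.

(* The summand vanishes as soon as t^2 > p^r, so the sum has finite support. *)
Definition hurwitz_moment (k : nat) (m : int) (M b p r : nat) : rat :=
  \sum_(t \in [set t : int | ~~ (p%:Z %| t)%Z /\ (t = m %[mod M%:Z])%Z])
     hurwitz (((p ^ r)%:Z - t ^+ 2)%:~R / b%:R) * t%:~R ^+ k.

Definition Tcoef (F : fieldType) (k mu : nat) : F :=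
  (k - 2 * mu + 1)%:R / (k - mu + 1)%:R * 'C(k, mu)%:R.

(* The complex numbers as a [numClosedFieldType]: through its carrier, R[i]
   gets the topology and the complex derivative of numFieldNormedType. *)
Definition cplx (R : realType) : numClosedFieldType := R[i].

Section Analytic.
Variable R : realType.
Local Notation C := (cplx R).

Definition toC (x : R) : C := x%:C%C.

(** * The generating functions, as functions of tau in the upper half-plane *)

(* e^(2 pi i tau) *)
Definition nome (tau : C) : C :=
  toC (expR (- (2 * pi * complex.Im tau))) *
  ((cos (2 * pi * complex.Re tau) +i* sin (2 * pi * complex.Re tau))%C : C).

Definition hurwitz_gf (tau : C) : C :=
  limn (series (fun n : nat => ratr (hurwitz n%:R) * nome tau ^+ n)).

Definition Vop (b : nat) (F : C -> C) : C -> C := fun tau => F (b%:R * tau).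

(* The sum over all integers is the limit of the sums over -N <= n <= N (it
   converges absolutely in the upper half-plane). *)
Definition theta (j : nat) (m : int) (M : nat) (tau : C) : C :=
  limn (fun N : nat =>
    \sum_(i < N.*2.+1 | (((i : nat)%:Z - N%:Z) == m %[mod M%:Z])%Z)
       ((i : nat)%:Z - N%:Z)%:~R ^+ j
       * nome tau ^+ (absz ((i : nat)%:Z - N%:Z) ^ 2)).

(** * Rankin-Cohen brackets *)

(* Euler's integral, hence Gamma(x) for [x > 0] only; all the arguments that
   occur in the brackets below are positive. *)
Definition EulerGamma (x : R) : R :=
  \int[lebesgue_measure]_(t in `]0, +oo[) (t `^ (x - 1) * expR (- t)).

Definition gbinom (alpha : R) (i : nat) : R :=
  EulerGamma (alpha + 1) / (i`!%:R * EulerGamma (alpha - i%:R + 1)).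

Definition rankin_cohen (kappa1 kappa2 : R) (k : nat) (F1 F2 : C -> C)
    (tau : C) : C :=
  (toC (2 * pi) * ('i%C : C)) ^- k *
  \sum_(0 <= i < k.+1)
     (-1) ^+ i * toC (gbinom (kappa1 + k%:R - 1) (k - i))
               * toC (gbinom (kappa2 + k%:R - 1) i)
               * derive1n i F1 tau * derive1n (k - i) F2 tau.

(** * The correction term and the coefficients *)

Definition lambda (l : nat) (m : int) (M b n : nat) : R :=
  \sum_(e <- [:: 1; -1 : int])
    e%:~R ^+ l *
    \sum_(ts \in [set ts : nat * nat | (1 <= ts.1)%N /\
                    ts.1%:Z ^+ 2 - b%:Z * ts.2%:Z ^+ 2 = n%:Z /\
                    (ts.1%:Z = e * m %[mod M%:Z])%Z])
      (if ts.2 == 0%N then 2^-1 else 1 : R)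
      * (ts.1%:R - Num.sqrt b%:R * ts.2%:R) ^+ l.+1.

Definition Lambda (l : nat) (m : int) (M b : nat) (tau : C) : C :=
  limn (series (fun n : nat =>
    if n == 0%N then 0 else toC (lambda l m M b n) * nome tau ^+ n)).

Definition fform (l : nat) (m : int) (M b : nat) (tau : C) : C :=
  let j : nat := odd l in
  rankin_cohen (3 / 2) (1 / 2 + j%:R) l./2
    (Vop b hurwitz_gf) (theta j m M) tau
  + toC ((Num.sqrt b%:R)^-1 * 2 ^- l.+1 * 'C(l, l./2)%:R)
    * Lambda l m M b tau.

(* The coefficients of the q-expansion of [fform] (unique when it exists). *)
Definition gammacoef (l : nat) (m : int) (M b : nat) : nat -> C :=
  get [set c : nat -> C | forall tau : C, 0 < complex.Im tau ->
    series (fun n => c n * nome tau ^+ n) @ \oo --> fform l m M b tau].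

Definition alphacoef (l : nat) (m : int) (M b n : nat) : C :=
  ('C(l, l./2)%:R)^-1 * gammacoef l m M b n.

End Analytic.

(* Main.v *)
(* A function with a q-expansion on the upper half-plane has only one, and
   q-expansions with subexponential coefficients may be added, multiplied and
   differentiated term by term.  Up to the factor binom(l, l/2), the n-th
   coefficient of the bracket [H|V_b, theta] is therefore the sum over t = m (4)
   of H((n - t^2)/b) c_l(t, n), where c_l(sqrt n cos x, n) =
   2^-l n^(l/2) U_l(cos x); the half-integer binomials combine into those of
   the odd part of (t + sqrt(t^2 - n))^(l+1).  Inverting the Chebyshev
   polynomials, t^k is the sum of 2^(-2 mu) T(k, mu) n^mu c_(k - 2 mu)(t, n), so
   the alpha-combination at p^r gives the full moment sum_t H((p^r - t^2)/b) t^k,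
   and the terms with p | t are compared with the one at p^(r-2) under t = p t'.
   There (p^(r-2) - t'^2)/b is p^(2a) times a number whose negative is a nonzero
   square mod p, and then H(p^2 N) = p H(N): count the matrices of determinant p
   carrying forms of discriminant D to forms of discriminant p^2 D, once by left
   and once by right cosets of SL_2(Z).  The exception is t'^2 = p^(r-2), where
   H(0) = -1/12 leaves the term with p - 1.  Finally b is a square, so
   t^2 - b s^2 = p^r factors over Z; the solutions with p | t come from p^(r-2),
   and the only other one has t - sqrt b s = 1: this is the term with
   (-1/m) (2/p^r).  If p^r = 3 (4), then p^r - t^2 = 2 (4) for odd t and every
   class number vanishes. *)

Require Import Defs.
From mathcomp Require Import measurable_realfun cyclic finfield finmap ring lra zify.

Set Implicit Arguments.
Unset Strict Implicit.
Unset Printing Implicit Defensive.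

Local Open Scope classical_set_scope.
Local Open Scope ring_scope.

(** * q-expansions in the upper half-plane *)

(** [gammacoef] chooses among all sequences whose q-series converges to [fform], with no growth
    condition. Evaluating it takes one explicit expansion and a uniqueness statement for series that
    merely converge. Termwise operations, in contrast, rest on the growth bound [subexp], which is
    therefore carried along. As k is odd, every l = k - 2 mu is odd, so j = 1 and both weights are
    3/2. All Gamma values then have argument at least 3/2, and Gamma(x + 1) = x Gamma(x) for x > 1
    suffices. Writing h for [mass], the double count gives (p + 1) h(D) = h(p^2 D) + h(D) when D is
    a nonzero square mod p, and (p + 1) h(p^2 D) = h(p^4 D) + p h(D) for every D < 0. The first
    relation starts h(p^2 N) = p h(N), the second propagates it to N = p^(2a) D. The factor p^(k+1)
    in front of the terms at p^(r-2) is p^k from t = p t' times p from the class number. The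
    correction at p^r minus p^(l+1) times the one at p^(r-2) does not depend on l, so it leaves the
    sum over mu. *)

Section ComplexLimits.
Variable R : realType.
Local Notation C := (cplx R).
Local Notation toC := (@toC R).
Local Notation nrm := (@ComplexField.Normc.normc R).
Implicit Types (z w : C) (x y : R).

Lemma toCD x y : toC (x + y) = toC x + toC y.
Proof. exact: (rmorphD (real_complex R)). Qed.

Lemma toCN x : toC (- x) = - toC x.
Proof. exact: (rmorphN (real_complex R)). Qed.

Lemma toCM x y : toC (x * y) = toC x * toC y.
Proof. exact: (rmorphM (real_complex R)). Qed.

Lemma toCX x n : toC (x ^+ n) = toC x ^+ n.
Proof. exact: (rmorphXn (real_complex R)). Qed.

Lemma toCV x : toC (x^-1) = (toC x)^-1.
Proof. exact: (fmorphV (real_complex R)). Qed.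

Lemma toC_nat n : toC n%:R = n%:R.
Proof. exact: (rmorph_nat (real_complex R)). Qed.

Lemma toC_int n : toC n%:~R = n%:~R.
Proof. exact: (rmorph_int (real_complex R)). Qed.

Lemma normE z : `|z| = toC (nrm z).
Proof. by []. Qed.

Lemma nrm_ge0 z : 0 <= nrm z.
Proof. by rewrite -lecR; exact: (normr_ge0 z). Qed.

Lemma nrm0 : nrm 0 = 0.
Proof. exact: ComplexField.Normc.normc0. Qed.

Lemma nrm1 : nrm 1 = 1.
Proof. exact: ComplexField.Normc.normc1. Qed.

Lemma nrm_eq0 z : (nrm z == 0) = (z == 0).
Proof.
apply/eqP/eqP => [|->]; last exact: nrm0.
exact: ComplexField.Normc.eq0_normc.
Qed.

Lemma nrmM z w : nrm (z * w) = nrm z * nrm w.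
Proof. exact: ComplexField.Normc.normcM. Qed.

Lemma nrmX z n : nrm (z ^+ n) = nrm z ^+ n.
Proof. by elim: n => [|n IH]; rewrite ?nrm1 // !exprS nrmM IH. Qed.

Lemma nrmN z : nrm (- z) = nrm z.
Proof. exact: normcN. Qed.

Lemma nrmD z w : nrm (z + w) <= nrm z + nrm w.
Proof. exact: le_normcD. Qed.

Lemma nrmV z : nrm z^-1 = (nrm z)^-1.
Proof. exact: ComplexField.Normc.normcV. Qed.

Lemma nrm_toC x : nrm (toC x) = `|x|.
Proof. by rewrite /nrm/= expr0n/= addr0 sqrtr_sqr. Qed.

Lemma nrm_nat n : nrm (n%:R) = n%:R.
Proof. by rewrite -toC_nat nrm_toC normr_nat. Qed.

Lemma nrm_distC z w : nrm (z - w) = nrm (w - z).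
Proof. by rewrite -nrmN opprB. Qed.

Lemma nrm_sum I (r : seq I) (P : pred I) (F : I -> C) :
  nrm (\sum_(i <- r | P i) F i) <= \sum_(i <- r | P i) nrm (F i).
Proof.
elim/big_ind2: _ => [|x1 x2 y1 y2 h1 h2|//]; first by rewrite nrm0.
by apply: le_trans (nrmD _ _) _; exact: lerD.
Qed.

Lemma nrm_i : nrm 'i%C = 1.
Proof. by rewrite /nrm/= expr0n expr1n/= add0r sqrtr1. Qed.

Lemma Re_le_nrm z : `|complex.Re z| <= nrm z.
Proof. by rewrite -lecR; exact: normc_ge_Re. Qed.

Lemma Im_le_nrm z : `|complex.Im z| <= nrm z.
Proof.
have := Re_le_nrm (z * 'i%C); rewrite ReiNIm normrN nrmM.
by rewrite nrm_i mulr1.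
Qed.

Lemma nrm_le_ReIm z : nrm z <= `|complex.Re z| + `|complex.Im z|.
Proof.
rewrite [in leLHS](complexE z); apply: le_trans (nrmD _ _) _.
by rewrite nrmM nrm_i mul1r !nrm_toC.
Qed.

(** The norm of [C] is again [C]-valued, so the epsilon in its limits is a positive complex number.
    Such a number is real, which reduces limits in [C] to limits of real sequences. *)
Lemma cvgC_nrm (u : nat -> C) (l : C) :
  (u @ \oo --> l) <-> (fun n => nrm (u n - l)) @ \oo --> (0 : R).
Proof.
split=> [/cvgrPdist_lt h|/cvgrPdist_lt h]; apply/cvgrPdist_lt => e e0.
  have := h (toC e); rewrite ltcR => /(_ e0); apply: filterS => n.
  by rewrite normE ltcR nrm_distC sub0r normrN ger0_norm ?nrm_ge0.
have eE : (e : C) = toC (complex.Re (e : C)).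
  by rewrite /Defs.toC RRe_real// gtr0_real.
have e0' : 0 < complex.Re (e : C) by move: e0; rewrite eE ltcR.
move: (h _ e0'); apply: filterS => n.
rewrite sub0r normrN ger0_norm ?nrm_ge0// => hn.
by rewrite normE nrm_distC eE ltcR.
Qed.

End ComplexLimits.

(** * Second-order Taylor bound for e^(2 pi i tau) *)

Section ElementaryBounds.
Variable R : realType.
Local Notation C := (cplx R).
Local Notation toC := (@toC R).
Local Notation nrm := (@ComplexField.Normc.normc R).
Implicit Types (z w : C) (x y : R).

Lemma expR_le_normr x : expR x <= expR `|x|.
Proof. by rewrite ler_expR ler_norm. Qed.

Lemma expRB1_le x : expR x - 1 <= x * expR x.
Proof.
have := expR_ge1Dx (- x); rewrite expRN => h.
have e0 := expR_gt0 x.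
have : (1 - x) * expR x <= 1 by rewrite -ler_pdivlMr// mul1r.
by rewrite mulrBl mul1r; lra.
Qed.

Lemma normr_expRB1 x : `|expR x - 1| <= `|x| * expR `|x|.
Proof.
have h1 := expRB1_le x; have h2 := expR_ge1Dx x.
have h3 := expR_le_normr x; have h4 : 1 <= expR `|x| by rewrite -expR0 ler_expR.
have [x0|x0] := leP 0 x.
  by rewrite !ger0_norm//; lra.
rewrite (ltr0_norm x0) ltr0_norm ?subr_lt0 ?expR_lt1//.
rewrite (ltr0_norm x0) in h4; nra.
Qed.

Lemma normr_expRB1B x : `|expR x - 1 - x| <= x ^+ 2 * expR `|x|.
Proof.
have h1 := expRB1_le x; have h2 := expR_ge1Dx x.
rewrite ger0_norm; last by lra.
(* By [expRB1_le], 0 <= e^x - 1 - x <= x (e^x - 1). *)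
apply: (@le_trans _ _ (`|x| * `|expR x - 1|)).
  rewrite -normrM; apply: le_trans (ler_norm _); lra.
rewrite -real_normK ?num_real// expr2 -mulrA ler_wpM2l ?normr_ge0//.
exact: normr_expRB1.
Qed.

Lemma normr_sin_le x : `|sin x| <= `|x|.
Proof.
wlog x0 : x / 0 < x => [hw|].
  have [x0|x0|->] := ltgtP x 0; last by rewrite sin0.
    by have := hw (- x); rewrite sinN !normrN oppr_gt0; apply.
  exact: hw.
have [c _] := @MVT R sin cos 0 x x0 (fun _ _ => is_derive_sin _)
  (continuous_subspaceT (@continuous_sin R)).
rewrite sin0 !subr0 => ->; rewrite normrM ler_piMl// ler_norml.
by rewrite cos_geN1 cos_le1.
Qed.

Lemma cosB1E x : cos x - 1 = - (sin (x / 2) ^+ 2 *+ 2).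
Proof.
have -> : cos x = cos ((x / 2) *+ 2) by rewrite -mulr_natr divfK.
by rewrite cos_mulr2n cos2sin2; lra.
Qed.

Lemma normr_cosB1 x : `|cos x - 1| <= x ^+ 2.
Proof.
rewrite cosB1E normrN ger0_norm ?mulrn_wge0 ?sqr_ge0//.
have h : sin (x / 2) ^+ 2 <= (x / 2) ^+ 2.
  rewrite -(real_normK (num_real (sin _))) -(real_normK (num_real (x / 2))).
  by rewrite lerXn2r ?nnegrE// normr_sin_le.
rewrite exprMn in h; have := sqr_ge0 x; lra.
Qed.

Lemma normr_cosB1_le x : `|cos x - 1| <= `|x|.
Proof.
rewrite cosB1E normrN ger0_norm ?mulrn_wge0 ?sqr_ge0//.
have h1 : `|sin (x / 2)| <= `|x| / 2.
  by apply: le_trans (normr_sin_le _) _; rewrite normrM [ `|2^-1|]ger0_norm.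
have h2 : `|sin (x / 2)| <= 1 by rewrite ler_norml sin_geN1 sin_le1.
rewrite -(real_normK (num_real (sin _))).
have := normr_ge0 (sin (x / 2)); nra.
Qed.

Lemma normr_sinB x : `|sin x - x| <= x ^+ 2.
Proof.
wlog x0 : x / 0 < x => [hw|].
  have [x0|x0|->] := ltgtP x 0; last by rewrite sin0 subr0 normr0 expr0n.
    have := hw (- x); rewrite sinN oppr_gt0 sqrrN opprK addrC distrC; exact.
  exact: hw.
have hd : forall y, y \in `]0, x[%R ->
    is_derive y 1 (fun t => sin t - t) ((fun t => cos t - 1) y).
  by move=> y _; apply: is_deriveB.
have hc : {within `[0, x], continuous (fun t : R => sin t - t)}.
  apply: continuous_subspaceT => y.
  by apply: cvgB; [exact: continuous_sin|exact: cvg_id].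
have [c /andP[c0 cx]] := MVT x0 hd hc.
rewrite sin0 !subr0 => ->; rewrite normrM expr2 (gtr0_norm x0) ler_wpM2r ?(ltW x0)//.
apply: le_trans (normr_cosB1_le _) _.
rewrite !bnd_simp in c0 cx.
by rewrite gtr0_norm// ltW.
Qed.

Definition twoipi : C := toC (2 * pi) * ('i%C : C).

Lemma nomeE (t : C) : nome t = (expR (- (2 * pi * complex.Im t)) *
  cos (2 * pi * complex.Re t) +i* (expR (- (2 * pi * complex.Im t)) *
  sin (2 * pi * complex.Re t)))%C.
Proof. by rewrite /nome /Defs.toC; simpc. Qed.

Lemma nrm_nome (t : C) : nrm (nome t) = expR (- (2 * pi * complex.Im t)).
Proof.
rewrite /nome nrmM nrm_toC ger0_norm ?expR_ge0//.
by rewrite /ComplexField.Normc.normc cos2Dsin2 sqrtr1 mulr1.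
Qed.

Lemma nomeD (t u : C) : nome (t + u) = nome t * nome u.
Proof.
rewrite !nomeE; case: t => a b; case: u => c d /=; simpc.
rewrite !mulrDr opprD expRD cosD sinD; congr (_ +i* _)%C; ring.
Qed.

Lemma nome0 : nome (0 : C) = 1.
Proof. by rewrite nomeE /= !mulr0 oppr0 expR0 cos0 sin0 mulr1 mulr0. Qed.

Lemma nomeMn (t : C) n : nome (n%:R * t) = nome t ^+ n.
Proof.
elim: n => [|n IH]; first by rewrite mul0r nome0.
by rewrite exprS -IH -nomeD mulrSr mulrDl mul1r addrC.
Qed.

Lemma nrm_twoipi : nrm twoipi = 2 * pi.
Proof.
by rewrite nrmM nrm_i mulr1 nrm_toC ger0_norm// mulr_ge0// pi_ge0.
Qed.

(** The bound is global in [w] because it is applied to n h with n unbounded; the exponential factor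
    is later absorbed by the decay of q^n. The 4 counts the pieces into which the real and imaginary
    parts of the remainder are cut, each at most r^2 e^r with r = 2 pi |w|. *)
Lemma nome_taylor w :
  nrm (nome w - 1 - twoipi * w) <=
    4 * (2 * pi * nrm w) ^+ 2 * expR (2 * pi * nrm w).
Proof.
have p0 : 0 <= 2 * pi :> R by rewrite mulr_ge0// pi_ge0.
have hX : `|- (2 * pi * complex.Im w)| <= 2 * pi * nrm w.
  by rewrite normrN normrM ger0_norm// ler_wpM2l// Im_le_nrm.
have hY : `|2 * pi * complex.Re w| <= 2 * pi * nrm w.
  by rewrite normrM ger0_norm// ler_wpM2l// Re_le_nrm.
have -> : nome w - 1 - twoipi * w =
   ((expR (- (2 * pi * complex.Im w)) * cos (2 * pi * complex.Re w) - 1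
      - (- (2 * pi * complex.Im w))) +i*
    (expR (- (2 * pi * complex.Im w)) * sin (2 * pi * complex.Re w)
      - (2 * pi * complex.Re w)))%C.
  rewrite nomeE /twoipi /Defs.toC; case: w {hX hY} => a b /=; simpc.
  by congr (_ +i* _)%C; rewrite ?subr0//; ring.
apply: le_trans (nrm_le_ReIm _) _ => /=.
move: (- _) (2 * pi * complex.Re w) (2 * pi * nrm w) hX hY => X Y r hX hY.
have r0 : 0 <= r by exact: le_trans (normr_ge0 _) hX.
have eX : expR X <= expR r by rewrite ler_expR (le_trans (ler_norm _)).
have eX' : expR `|X| <= expR r by rewrite ler_expR.
have e0 := expR_ge0 r; have eX0 := expR_ge0 X.
have X2 : X ^+ 2 <= r ^+ 2.
  by rewrite -(real_normK (num_real X)) lerXn2r ?nnegrE.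
have Y2 : Y ^+ 2 <= r ^+ 2.
  by rewrite -(real_normK (num_real Y)) lerXn2r ?nnegrE.
have h1 : `|expR X * (cos Y - 1)| <= r ^+ 2 * expR r.
  rewrite normrM (ger0_norm eX0) mulrC ler_pM//.
  exact: le_trans (normr_cosB1 _) _.
have h2 : `|expR X - 1 - X| <= r ^+ 2 * expR r.
  apply: le_trans (normr_expRB1B _) _; rewrite ler_pM ?sqr_ge0 ?expR_ge0//.
have h3 : `|expR X * (sin Y - Y)| <= r ^+ 2 * expR r.
  rewrite normrM (ger0_norm eX0) mulrC ler_pM//.
  exact: le_trans (normr_sinB _) _.
have h4 : `|Y * (expR X - 1)| <= r ^+ 2 * expR r.
  rewrite normrM expr2 -mulrA ler_pM//.
  by apply: le_trans (normr_expRB1 _) _; rewrite ler_pM ?expR_ge0.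
have -> : expR X * cos Y - 1 - X = expR X * (cos Y - 1) + (expR X - 1 - X) by ring.
have -> : expR X * sin Y - Y = expR X * (sin Y - Y) + Y * (expR X - 1) by ring.
apply: le_trans (lerD (ler_normD _ _) (ler_normD _ _)) _; lra.
Qed.

End ElementaryBounds.

(** * Sequences of subexponential growth *)

Section Subexponential.
Variable R : realType.
Implicit Types (a b : nat -> R).

(** Every s > 0 is allowed because |q| = e^(-2 pi Im tau) comes arbitrarily close to 1 in the
    half-plane. The condition is stable under products and polynomial factors. *)
Definition subexp a :=
  forall s : R, 0 < s -> exists K : R, forall n, `|a n| <= K * expR (s * n%:R).

Lemma subexp_le a b : (forall n, `|a n| <= `|b n|) -> subexp b -> subexp a.
Proof.
move=> ab hb s s0; have [K hK] := hb s s0.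
by exists K => n; apply: le_trans (ab n) (hK n).
Qed.

Lemma subexp_cst (c : R) : subexp (fun=> c).
Proof.
move=> s s0; exists `|c| => n; rewrite ler_peMr// -expR0 ler_expR.
by rewrite mulr_ge0// ltW.
Qed.

Lemma subexpD a b : subexp a -> subexp b -> subexp (fun n => a n + b n).
Proof.
move=> ha hb s s0; have [K hK] := ha s s0; have [L hL] := hb s s0.
exists (K + L) => n; apply: le_trans (ler_normD _ _) _.
by rewrite mulrDl lerD.
Qed.

Lemma subexpM a b : subexp a -> subexp b -> subexp (fun n => a n * b n).
Proof.
move=> ha hb s s0; have s2 : 0 < s / 2 by rewrite divr_gt0.
have [K hK] := ha _ s2; have [L hL] := hb _ s2.
exists (K * L) => n; rewrite normrM.
have -> : expR (s * n%:R) = expR (s / 2 * n%:R) * expR (s / 2 * n%:R).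
  by rewrite -expRD; congr expR; field.
by rewrite mulrACA ler_pM.
Qed.

Lemma subexp_nat : subexp (fun n => n%:R).
Proof.
move=> s s0; exists s^-1 => n; rewrite normr_nat ler_pdivlMl//.
by apply: le_trans (expR_ge1Dx _); rewrite lerDr.
Qed.

Lemma subexpX a d : subexp a -> subexp (fun n => a n ^+ d).
Proof.
move=> ha; elim: d => [|d IH]; first exact: subexp_cst.
by apply: subexp_le (subexpM ha IH) => n; rewrite exprS.
Qed.

Lemma subexp_poly (K : R) (d : nat) :
  subexp (fun n => K * n.+1%:R ^+ d).
Proof.
apply: subexpM (subexp_cst _) (subexpX _ _).
have := subexpD (subexp_nat) (subexp_cst 1).
by apply: subexp_le => n; rewrite natr1.
Qed.

Lemma subexp_summable a (y : R) : 0 < y -> subexp a ->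
  cvgn (series (fun n => `|a n| * expR (- (y * n%:R)))).
Proof.
move=> y0 ha; have y2 : 0 < y / 2 by rewrite divr_gt0.
have [K hK] := ha _ y2.
have K0 : 0 <= K.
  have := hK 0%N; rewrite mulr0 expR0 mulr1; exact: le_trans.
apply: (@series_le_cvg _ _ (geometric K (expR (- (y / 2))))) => [n|n|n|].
- by rewrite mulr_ge0 ?expR_ge0.
- by rewrite /= mulr_ge0// exprn_ge0 ?expR_ge0.
- rewrite /= -expRM_natl.
  have -> : expR (n%:R * - (y / 2)) = expR (y / 2 * n%:R) * expR (- (y * n%:R)).
    by rewrite -expRD; congr expR; field.
  by rewrite mulrA ler_wpM2r ?expR_ge0.
- apply: is_cvg_geometric_series; rewrite ger0_norm ?expR_ge0//.
  by rewrite expR_lt1 oppr_lt0.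
Qed.

End Subexponential.

(** * Convergent q-series and their linear combinations *)

Section QExpansions.
Variable R : realType.
Local Notation C := (cplx R).
Local Notation toC := (@toC R).
Local Notation nrm := (@ComplexField.Normc.normc R).
Implicit Types (z w tau : C) (x y : R) (c d : nat -> C) (F G : C -> C).

Lemma series_dominated c (a : nat -> R) : (forall n, nrm (c n) <= a n) ->
  cvgn (series a) -> cvgn (series c).
Proof.
move=> ca cva.
have a0 n : 0 <= a n := le_trans (nrm_ge0 _) (ca n).
have hRe : cvgn (series (fun n => complex.Re (c n))).
  apply: normed_cvg; apply: (series_le_cvg _ a0 _ cva) => n /=; first exact: normr_ge0.
  exact: le_trans (Re_le_nrm _) (ca n).
have hIm : cvgn (series (fun n => complex.Im (c n))).
  apply: normed_cvg; apply: (series_le_cvg _ a0 _ cva) => n /=; first exact: normr_ge0.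
  exact: le_trans (Im_le_nrm _) (ca n).
set x := limn (series (fun n => complex.Re (c n))).
set y := limn (series (fun n => complex.Im (c n))).
apply/cvg_ex; exists ((x +i* y)%C : C); apply/cvgC_nrm.
have sE n : series c n = (series (fun n => complex.Re (c n)) n +i*
    series (fun n => complex.Im (c n)) n)%C.
  rewrite /series/=; elim: n => [|n IH]; first by rewrite !big_geq.
  by rewrite !big_nat_recr//= IH; case: (c n).
have hs : (fun n => `|series (fun n => complex.Re (c n)) n - x| +
   `|series (fun n => complex.Im (c n)) n - y|) @ \oo --> (0 : R).
  rewrite -[X in _ --> X]addr0; apply: cvgD; rewrite -[X in _ --> X](@normr0 R R).
    by apply: cvg_norm; rewrite -(subrr x); apply: cvgB => //; exact: cvg_cst.
  by apply: cvg_norm; rewrite -(subrr y); apply: cvgB => //; exact: cvg_cst.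
apply: squeeze_cvgr (cvg_cst 0) hs; apply: nearW => n; rewrite nrm_ge0/=.
by apply: le_trans (nrm_le_ReIm _) _; rewrite sE; simpc.
Qed.

Lemma nrm_lim_le c (l : C) (A : R) :
  c @ \oo --> l -> (forall n, nrm (c n) <= A) -> nrm l <= A.
Proof.
move=> /cvgC_nrm cl cA; rewrite leNgt; apply/negP => Al.
have /cvgrPdist_lt/(_ (nrm l - A)) := cl; rewrite subr_gt0 => /(_ Al).
move=> [N _ /(_ N (leqnn N))] /=; rewrite sub0r normrN ger0_norm ?nrm_ge0//.
have := nrmD (l - c N) (c N); rewrite subrK nrm_distC.
have := cA N; lra.
Qed.

Lemma nrm_series_le c (a : nat -> R) (l : C) : (forall n, nrm (c n) <= a n) ->
  cvgn (series a) -> series c @ \oo --> l -> nrm l <= limn (series a).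
Proof.
move=> ca cva cl; apply: nrm_lim_le cl _ => n.
have a0 k : 0 <= a k := le_trans (nrm_ge0 _) (ca k).
apply: le_trans (nrm_sum _ _ _) _.
apply: (@le_trans _ _ (series a n)); first exact: ler_sum.
apply: nondecreasing_cvgn_le => //.
by apply/nondecreasing_seqP => k; rewrite /series/= big_nat_recr//= lerDl.
Qed.

(** The second clause is the one in [gammacoef]; the first makes the convergence absolute, as used
    for products and derivatives. *)
Definition qexp F c :=
  subexp (fun n => nrm (c n)) /\
  forall tau, 0 < complex.Im tau ->
    series (fun n => c n * nome tau ^+ n) @ \oo --> F tau.

Lemma nrm_qterm tau c n :
  nrm (c n * nome tau ^+ n) =
  `|nrm (c n)| * expR (- ((2 * pi * complex.Im tau) * n%:R)).
Proof.
rewrite nrmM nrmX nrm_nome -expRM_natl mulrN [n%:R * _]mulrC.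
by rewrite ger0_norm ?nrm_ge0.
Qed.

Lemma pi2_gt0 : 0 < 2 * pi :> R.
Proof. by rewrite mulr_gt0// pi_gt0. Qed.

Lemma qseries_cvg c tau : subexp (fun n => nrm (c n)) -> 0 < complex.Im tau ->
  cvgn (series (fun n => c n * nome tau ^+ n)).
Proof.
move=> hc t0; have y0 : 0 < 2 * pi * complex.Im tau by rewrite mulr_gt0// pi2_gt0.
apply: series_dominated (subexp_summable y0 hc) => n.
by rewrite nrm_qterm.
Qed.

Lemma qexp_lim c : subexp (fun n => nrm (c n)) ->
  qexp (fun tau => limn (series (fun n => c n * nome tau ^+ n))) c.
Proof. by move=> hc; split=> // tau t0; exact: qseries_cvg. Qed.

Lemma qexp_ext F G c d : (forall tau, 0 < complex.Im tau -> F tau = G tau) ->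
  c =1 d -> qexp F c -> qexp G d.
Proof.
move=> FG cd; have -> : d = c by apply/funext => n.
move=> [hc hF]; split=> [//|tau t0].
by have := hF tau t0; rewrite (FG tau t0).
Qed.

Lemma qexpD F G c d : qexp F c -> qexp G d ->
  qexp (fun tau => F tau + G tau) (fun n => c n + d n).
Proof.
move=> [hc hF] [hd hG]; split.
  apply: subexp_le (subexpD hc hd) => n.
  by rewrite !ger0_norm ?addr_ge0 ?nrm_ge0// nrmD.
move=> tau t0.
have -> : series (fun n => (c n + d n) * nome tau ^+ n) =
  (fun N => series (fun n => c n * nome tau ^+ n) N
     + series (fun n => d n * nome tau ^+ n) N).
  apply/funext => N; rewrite /series/= -big_split/=.
  by apply: eq_bigr => i _; rewrite mulrDl.
by apply: cvgD; [exact: hF|exact: hG].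
Qed.

Lemma qexp0 : qexp (fun=> 0) (fun=> 0).
Proof.
split; first by rewrite nrm0; exact: subexp_cst.
move=> tau _; rewrite [X in X @ _](_ : _ = fun=> 0); first exact: cvg_cst.
by apply/funext => N; rewrite /series/= big1// => i _; rewrite mul0r.
Qed.

Lemma qexpZ F c (k : C) : qexp F c ->
  qexp (fun tau => k * F tau) (fun n => k * c n).
Proof.
move=> [hc hF]; split.
  apply: subexp_le (subexpM (subexp_cst (nrm k)) hc) => n.
  by rewrite !ger0_norm ?mulr_ge0 ?nrm_ge0// nrmM.
move=> tau t0.
have -> : series (fun n => k * c n * nome tau ^+ n) =
  (fun N => k * series (fun n => c n * nome tau ^+ n) N).
  apply/funext => N; rewrite /series/= big_distrr/=.
  by apply: eq_bigr => i _; rewrite mulrA.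
by apply: cvgMr; exact: hF.
Qed.

Lemma qexp_sum (I : Type) (r : seq I) (P : pred I) (F : I -> C -> C)
  (c : I -> nat -> C) : (forall i, P i -> qexp (F i) (c i)) ->
  qexp (fun tau => \sum_(i <- r | P i) F i tau) (fun n => \sum_(i <- r | P i) c i n).
Proof.
move=> h; elim: r => [|i r IH].
  by apply: (qexp_ext _ _ qexp0) => // x; rewrite big_nil.
case Pi : (P i).
  by apply: (qexp_ext _ _ (qexpD (h i Pi) IH)) => x; rewrite big_cons Pi.
by apply: (qexp_ext _ _ IH) => x; rewrite big_cons Pi.
Qed.

End QExpansions.

Lemma sum_convolution (A : pzSemiRingType) (a b : nat -> A) N :
  \sum_(0 <= n < N) \sum_(i < n.+1) a i * b (n - i)%N =
  \sum_(0 <= i < N) a i * \sum_(0 <= j < N - i) b j.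
Proof.
elim: N => [|N IH]; first by rewrite !big_geq.
rewrite big_nat_recr//= IH [in RHS]big_nat_recr//= subSnn big_nat1.
rewrite big_ord_recr/= subnn addrA; congr (_ + _).
rewrite -(big_mkord xpredT (fun i => a i * b (N - i)%N)) -big_split/=.
apply: eq_big_nat => i /andP[_ iN]; rewrite -mulrDr; congr (_ * _).
by rewrite subSn 1?ltnW// big_nat_recr.
Qed.

(** * Products of q-series *)

Section QAlgebra.
Variable R : realType.
Local Notation C := (cplx R).
Local Notation toC := (@toC R).
Local Notation nrm := (@ComplexField.Normc.normc R).
Implicit Types (z w tau : C) (x y : R) (c d : nat -> C) (F G : C -> C).

(** The pairs i, j < N with i + j >= N lie outside the square of side N/2, so the error is at most
    the difference of the products of partial sums at N and at N/2. *)
Lemma cvg_series_nonneg_half (a b : nat -> R) :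
  (forall n, 0 <= a n) -> (forall n, 0 <= b n) ->
  cvgn (series a) -> cvgn (series b) ->
  (fun N => series a N * series b N -
     \sum_(0 <= i < N) a i * \sum_(0 <= j < N - i) b j) @ \oo --> (0 : R).
Proof.
move=> a0 b0 ca cb.
have half : (fun N => N./2) @ \oo --> \oo.
  move=> P [N _ NP]; exists N.*2 => // n /= Nn; apply: NP => /=.
  by rewrite -(doubleK N) half_leq.
have hs : (fun N => series a N * series b N - series a N./2 * series b N./2)
    @ \oo --> (0 : R).
  rewrite -(subrr (limn (series a) * limn (series b))); apply: cvgB.
    exact: cvgM.
  by apply: cvgM; apply: (cvg_comp _ _ half).
apply: squeeze_cvgr (cvg_cst 0) hs; apply: nearW => N; apply/andP; split.
  rewrite subr_ge0 /series/= big_distrl/=; apply: ler_sum_nat => i _.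
  rewrite ler_wpM2l// [leRHS](big_cat_nat (leq0n (N - i)%N) (leq_subr _ _))/=.
  by rewrite lerDl sumr_ge0.
rewrite lerD2l lerN2 /series/= big_distrl/=.
have N2 : (N./2 <= N)%N by rewrite leq_half_double -addnn leqW// leq_addr.
rewrite [leRHS](big_cat_nat (leq0n N./2) N2)/=.
apply: (@le_trans _ _ (\sum_(0 <= i < N./2) a i * \sum_(0 <= j < N - i) b j)); last first.
  by rewrite lerDl sumr_ge0// => i _; rewrite mulr_ge0// sumr_ge0.
apply: ler_sum_nat => i /andP[_ iN]; rewrite ler_wpM2l//.
have N3 : (N./2 <= N - i)%N.
  by rewrite leq_subRL 1?(leq_trans (ltnW iN))// -{2}(odd_double_half N) -addnn; lia.
by rewrite [leRHS](big_cat_nat (leq0n _) N3)/= lerDl sumr_ge0.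
Qed.

(** The difference between the Cauchy product and the product of partial sums is bounded by the same
    difference for the norms, which is the nonnegative case. *)
Lemma cvg_series_mul c d (l k : C) :
  cvgn (series (nrm \o c)) -> cvgn (series (nrm \o d)) ->
  series c @ \oo --> l -> series d @ \oo --> k ->
  series (fun n => \sum_(i < n.+1) c i * d (n - i)%N) @ \oo --> l * k.
Proof.
move=> nc nd cl dk.
have h0 := cvg_series_nonneg_half (fun n => nrm_ge0 (c n)) (fun n => nrm_ge0 (d n)) nc nd.
have hp : (fun N => series c N * series d N) @ \oo --> l * k by apply: cvgM cl dk.
have hd : (fun N => series (fun n => \sum_(i < n.+1) c i * d (n - i)%N) N
    - series c N * series d N) @ \oo --> (0 : C).
  apply/cvgC_nrm; apply: squeeze_cvgr (cvg_cst 0) h0; apply: nearW => N.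
  rewrite nrm_ge0/= subr0 nrm_distC /series/= sum_convolution.
  rewrite !big_distrl/= -!sumrB; apply: le_trans (nrm_sum _ _ _) _.
  apply: ler_sum_nat => i /andP[_ iN].
  rewrite -!mulrBr nrmM ler_wpM2l ?nrm_ge0//.
  have hB (V : zmodType) (u : nat -> V) : \sum_(0 <= j < N) u j -
      \sum_(0 <= j < N - i) u j = \sum_(N - i <= j < N) u j.
    by rewrite (big_cat_nat (leq0n (N - i)%N) (leq_subr _ _))/= addrAC subrr add0r.
  by rewrite !hB; exact: nrm_sum.
set f := series _ in hd *; set g := (fun N => series c N * _) in hp.
have -> : f = (fun N => (f N - g N) + g N) by apply/funext => N; rewrite subrK.
by rewrite -[l * k]add0r; apply: cvgD hd hp.
Qed.

Lemma qexp_abs_cvg c tau : subexp (fun n => nrm (c n)) -> 0 < complex.Im tau ->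
  cvgn (series (nrm \o (fun n => c n * nome tau ^+ n))).
Proof.
move=> hc t0; have y0 : 0 < 2 * pi * complex.Im tau by rewrite mulr_gt0// pi2_gt0.
rewrite (_ : nrm \o _ = (fun n => `|nrm (c n)| *
   expR (- ((2 * pi * complex.Im tau) * n%:R)))); first exact: subexp_summable.
by apply/funext => n /=; rewrite nrm_qterm.
Qed.

Definition convol (A : pzSemiRingType) (c d : nat -> A) (n : nat) : A :=
  \sum_(i < n.+1) c i * d (n - i)%N.

Lemma qexpM F G c d : qexp F c -> qexp G d ->
  qexp (fun tau => F tau * G tau) (convol c d).
Proof.
move=> [hc hF] [hd hG]; split.
  (* One half of s bounds the coefficients, the other absorbs the n + 1 terms of the convolution. *)
  move=> s s0; have s2 : 0 < s / 2 by rewrite divr_gt0.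
  have [K hK] := hc _ s2; have [L hL] := hd _ s2.
  have [M hM] := subexp_poly 1 1 s2.
  exists (M * (K * L)) => n; rewrite ger0_norm ?nrm_ge0//.
  apply: le_trans (nrm_sum _ _ _) _.
  apply: (@le_trans _ _ (\sum_(i < n.+1) K * L * expR (s / 2 * n%:R))).
    apply: ler_sum => i _; rewrite nrmM.
    have -> : expR (s / 2 * n%:R) = expR (s / 2 * i%:R) * expR (s / 2 * (n - i)%:R).
      by rewrite -expRD -mulrDr -natrD subnKC// -ltnS.
    rewrite mulrACA ler_pM ?nrm_ge0//.
      by apply: le_trans (hK i); rewrite ger0_norm ?nrm_ge0.
    by apply: le_trans (hL _); rewrite ger0_norm ?nrm_ge0.
  rewrite sumr_const card_ord -[leLHS]mulr_natl.
  have -> : expR (s * n%:R) = expR (s / 2 * n%:R) * expR (s / 2 * n%:R).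
    by rewrite -expRD; congr expR; field.
  have K0 : 0 <= K * L.
    rewrite mulr_ge0//.
      by have := le_trans (normr_ge0 _) (hK 0%N); rewrite mulr0 expR0 mulr1.
    by have := le_trans (normr_ge0 _) (hL 0%N); rewrite mulr0 expR0 mulr1.
  rewrite [leRHS](_ : _ = M * expR (s / 2 * n%:R) * (K * L * expR (s / 2 * n%:R))); last by ring.
  rewrite ler_wpM2r//; first by rewrite mulr_ge0 ?expR_ge0.
  by apply: le_trans (hM n); rewrite mul1r expr1 normr_nat.
move=> tau t0.
have -> : (fun n => convol c d n * nome tau ^+ n) = (fun n =>
    \sum_(i < n.+1) (c i * nome tau ^+ i) * (d (n - i)%N * nome tau ^+ (n - i))).
  apply/funext => n; rewrite /convol big_distrl/=.
  by apply: eq_bigr => i _; rewrite mulrACA -exprD subnKC// -ltnS.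
exact: cvg_series_mul (qexp_abs_cvg hc t0) (qexp_abs_cvg hd t0) (hF _ t0) (hG _ t0).
Qed.

End QAlgebra.

(** * Termwise differentiation *)

Section QCalculus.
Variable R : realType.
Local Notation C := (cplx R).
Local Notation toC := (@toC R).
Local Notation twoipi := (twoipi R).
Local Notation nrm := (@ComplexField.Normc.normc R).
Implicit Types (z w tau h : C) (x y : R) (c d : nat -> C) (F G : C -> C).

(** The n-th term of the remainder is c_n q^n (e^(2 pi i n h) - 1 - 2 pi i n h). By [nome_taylor] it
    costs a factor e^(2 pi n |h|), and |h| <= Im tau / 2 still leaves the decay e^(-pi n Im tau);
    hence a constant [A] uniform in [h]. *)
Lemma qexp_increment F G c tau : qexp F c ->
  qexp G (fun n => twoipi * n%:R * c n) -> 0 < complex.Im tau ->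
  exists2 A : R, 0 <= A & forall h, nrm h <= complex.Im tau / 2 ->
    nrm (F (h + tau) - F tau - h * G tau) <= A * nrm h ^+ 2.
Proof.
move=> [hc hF] [_ hG] t0.
pose a n : R := nrm (c n) * n%:R ^+ 2 * (4 * (2 * pi) ^+ 2).
have ha : subexp a.
  apply: subexpM; last exact: subexp_cst.
  by apply: subexpM hc _; apply: subexpX; exact: subexp_nat.
have a0 n : 0 <= a n.
  by rewrite !mulr_ge0 ?nrm_ge0 ?exprn_ge0 ?pi_ge0.
have y0 : 0 < pi * complex.Im tau by rewrite mulr_gt0// pi_gt0.
have cva := subexp_summable y0 ha.
set A := limn (series (fun n => `|a n| * expR (- (pi * complex.Im tau * n%:R)))).
exists A.
  apply: limr_ge => //; apply: nearW => n; rewrite /series/= sumr_ge0//.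
move=> h hh.
have t1 : 0 < complex.Im (h + tau).
  have := Im_le_nrm h; rewrite ler_norml => /andP[h1 _].
  have -> : complex.Im (h + tau) = complex.Im h + complex.Im tau.
    by case: (h) => ? ?; case: (tau).
  lra.
pose u n := c n * nome tau ^+ n * (nome (n%:R * h) - 1 - twoipi * (n%:R * h)).
have cvu : series u @ \oo --> F (h + tau) - F tau - h * G tau.
  have -> : series u = (fun N => series (fun n => c n * nome (h + tau) ^+ n) N
     - series (fun n => c n * nome tau ^+ n) N
     - h * series (fun n => twoipi * n%:R * c n * nome tau ^+ n) N).
    apply/funext => N; rewrite /series/= big_distrr/= -!sumrB.
    apply: eq_bigr => i _; rewrite /u nomeMn nomeD (exprMn _ (nome h)); ring.
  apply: cvgB; first by apply: cvgB; exact: hF.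
  by apply: cvgMr; exact: hG.
pose b n := nrm h ^+ 2 * (`|a n| * expR (- (pi * complex.Im tau * n%:R))).
have cvb : series b @ \oo --> nrm h ^+ 2 * A.
  have -> : series b = (fun N => nrm h ^+ 2 *
      series (fun n => `|a n| * expR (- (pi * complex.Im tau * n%:R))) N).
    by apply/funext => N; rewrite /series/= big_distrr.
  by apply: cvgMr.
rewrite [leRHS]mulrC -(cvg_lim _ cvb)//.
apply: nrm_series_le cvu => [n|]; last by apply/cvg_ex; eexists; exact: cvb.
rewrite /u nrmM nrm_qterm (ger0_norm (nrm_ge0 _)).
have h1 := nome_taylor (n%:R * h).
rewrite nrmM nrm_nat in h1.
apply: (@le_trans _ _ (nrm (c n) * expR (- (2 * pi * complex.Im tau * n%:R)) *
  (4 * (2 * pi * (n%:R * nrm h)) ^+ 2 * expR (2 * pi * (n%:R * nrm h))))).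
  by rewrite ler_wpM2l// mulr_ge0 ?expR_ge0 ?nrm_ge0.
rewrite /b ger0_norm// /a.
rewrite [leLHS](_ : _ = nrm h ^+ 2 * (nrm (c n) * n%:R ^+ 2 * (4 * (2 * pi) ^+ 2) *
  (expR (- (2 * pi * complex.Im tau * n%:R)) * expR (2 * pi * (n%:R * nrm h))))); last by ring.
rewrite ler_wpM2l ?exprn_ge0 ?nrm_ge0// ler_wpM2l ?(a0 n)// -expRD ler_expR.
rewrite (_ : _ + _ = - (pi * complex.Im tau * n%:R)
  - n%:R * pi * (complex.Im tau - 2 * nrm h)); last by ring.
rewrite gerBl !mulr_ge0 ?pi_ge0//; lra.
Qed.

Lemma derive1_eq_lim F tau (g : C) (A e : R) : 0 <= A -> 0 < e ->
  (forall h, nrm h <= e -> nrm (F (h + tau) - F tau - h * g) <= A * nrm h ^+ 2) ->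
  derive1 F tau = g.
Proof.
move=> A0 e0 hA; rewrite /derive1; apply: cvg_lim; first exact: norm_hausdorff.
apply/cvgrPdist_lt => eps eps0.
have epsE : (eps : C) = toC (complex.Re (eps : C)).
  by rewrite /Defs.toC RRe_real// gtr0_real.
set ep := complex.Re (eps : C) in epsE.
have ep0 : 0 < ep by move: eps0; rewrite epsE ltcR.
have d0 : 0 < Num.min e (ep / (A + 1)).
  by rewrite lt_min e0/= divr_gt0// ltr_wpDl.
have near1 : \forall h \near (0 : C)^', `|h| < toC (Num.min e (ep / (A + 1))).
  by apply: dnbhs0_lt; rewrite ltcR.
have near2 : \forall h \near (0 : C)^', h != 0 by exact: nbhs_dnbhs_neq.
apply: filterS2 near1 near2 => h /= h1 hn0.
rewrite normE ltcR lt_min in h1; case/andP: h1 => h1 h2.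
have hp : 0 < nrm h by rewrite lt_neqAle nrm_ge0 eq_sym nrm_eq0 hn0.
rewrite normE epsE ltcR nrm_distC.
have -> : h^-1 *: (F (h + tau) - F tau) - g = h^-1 * (F (h + tau) - F tau - h * g).
  by rewrite mulrBr mulKf.
rewrite nrmM nrmV ltr_pdivrMl//.
apply: le_lt_trans (hA _ (ltW h1)) _.
rewrite expr2 mulrCA ltr_pM2l//.
rewrite ltr_pdivlMr in h2; last by rewrite ltr_wpDl.
by apply: le_lt_trans h2; rewrite mulrC ler_wpM2l ?nrm_ge0// lerDl.
Qed.

Lemma qexp_derive1 F c : qexp F c ->
  qexp (derive1 F) (fun n => twoipi * n%:R * c n).
Proof.
move=> hF.
have hs : subexp (fun n => nrm (twoipi * n%:R * c n)).
  apply: subexp_le (subexpM (subexpM (subexp_cst (nrm twoipi)) (@subexp_nat R)) hF.1) => n.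
  by rewrite !nrmM nrm_nat.
apply: qexp_ext (qexp_lim hs) => // tau t0.
have [A A0 hA] := qexp_increment hF (qexp_lim hs) t0.
by rewrite (derive1_eq_lim A0 _ hA)// divr_gt0.
Qed.

Lemma qexp_derive1n F c k : qexp F c ->
  qexp (derive1n k F) (fun n => (twoipi * n%:R) ^+ k * c n).
Proof.
move=> hF; elim: k => [|k IH].
  by apply: qexp_ext hF => // n; rewrite expr0 mul1r.
by apply: qexp_ext (qexp_derive1 IH) => // n; rewrite exprS mulrA.
Qed.

End QCalculus.

(** * Uniqueness of q-expansions *)

Section QUnique.
Variable R : realType.
Local Notation C := (cplx R).
Local Notation toC := (@toC R).
Local Notation nrm := (@ComplexField.Normc.normc R).
Implicit Types (z w tau h : C) (x y : R) (c d : nat -> C) (F G : C -> C).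

Lemma cvg_series_terms_bounded c : cvgn (series c) ->
  exists B : R, forall n, nrm (c n) <= B.
Proof.
move=> /cvg_ex[/= l /cvgC_nrm cl].
have /cvg_seq_bounded[B [_ hB]] : cvgn (fun n => nrm (series c n - l)).
  by apply/cvg_ex; eexists; exact: cl.
have {}hB n : nrm (series c n - l) <= B + 1.
  by apply: le_trans (hB (B + 1) _ n I); rewrite ?ltrDl// ler_norm.
exists ((B + 1) *+ 2) => n.
have -> : c n = (series c n.+1 - l) - (series c n - l).
  by rewrite /series/= big_nat_recr//=; ring.
by apply: le_trans (nrmD _ _) _; rewrite nrmN mulr2n lerD.
Qed.

(** Convergence at tau = i bounds |d_k| r0^k by B, where r0 = e^(-2 pi). If the coefficients below n
    vanish, then at tau = (j + 2) i the terms beyond n add up to at most B x^(n+1) / (1 - r0) with x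
    = r0^(j+1), while the n-th one has norm |d_n| x^n r0^n. So |d_n| = O(x), and x tends to 0 as j
    grows. *)
Lemma qseries_eq0 d : (forall tau, 0 < complex.Im tau ->
    series (fun n => d n * nome tau ^+ n) @ \oo --> (0 : C)) ->
  forall n, d n = 0.
Proof.
move=> hd; set r0 : R := expR (- (2 * pi)).
have r00 : 0 < r0 by exact: expR_gt0.
have r01 : r0 < 1 by rewrite /r0 expR_lt1 oppr_lt0 pi2_gt0.
pose t j : C := ((0 : R) +i* j%:R)%C.
have nq j k : nrm (d k * nome (t j) ^+ k) = nrm (d k) * (r0 ^+ j) ^+ k.
  rewrite nrmM nrmX nrm_nome /= /r0 -expRM_natl; congr (_ * expR _ ^+ _); ring.
have [B hB] : exists B : R, forall n, nrm (d n) * r0 ^+ n <= B.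
  have h1 : 0 < complex.Im (t 1%N) by rewrite /= ltr0n.
  have [|B hB] := @cvg_series_terms_bounded (fun n => d n * nome (t 1%N) ^+ n).
    by apply/cvg_ex; eexists; exact: hd h1.
  by exists B => n; have := hB n; rewrite nq expr1.
have B0 : 0 <= B by apply: le_trans (hB 0%N); rewrite mulr_ge0 ?nrm_ge0.
elim/ltn_ind => n IH; apply/eqP; rewrite -nrm_eq0.
have key j : nrm (d n) <= B / r0 ^+ n / (1 - r0) * r0 ^+ j.+1.
  set x := r0 ^+ j.+1.
  have x0 : 0 < x by rewrite exprn_gt0.
  have xr : x <= r0 by rewrite /x exprS ler_piMr ?(ltW r00)// exprn_ile1 ?ltW.
  have tj : 0 < complex.Im (t j.+2) by rewrite /= ltr0n.
  have hlim := hd _ tj.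
  rewrite -(cvg_shiftn n.+1) in hlim.
  have {hlim} : (fun M => series (fun k => d k * nome (t j.+2) ^+ k) (M + n.+1)%N
      - d n * nome (t j.+2) ^+ n) @ \oo --> 0 - d n * nome (t j.+2) ^+ n.
    by apply: cvgB hlim _; exact: cvg_cst.
  rewrite sub0r => hl; have h := nrm_lim_le (A := B * x ^+ n.+1 / (1 - r0)) hl.
  have {h} : nrm (- (d n * nome (t j.+2) ^+ n)) <= B * x ^+ n.+1 / (1 - r0).
    apply: h => M; rewrite /series/= (big_cat_nat (leq0n n.+1) (leq_addl _ _))/=.
    rewrite big_nat_recr//= big_nat big1 ?add0r; last first.
      by move=> i /andP[_ ilt]; rewrite IH// mul0r.
    rewrite addrAC subrr add0r -{1}[n.+1]add0n big_addn addnK.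
    apply: le_trans (nrm_sum _ _ _) _.
    apply: (@le_trans _ _ (\sum_(0 <= i < M) B * x ^+ n.+1 * r0 ^+ i)).
      apply: ler_sum => i _; rewrite nq exprS -/x exprMn mulrA.
      rewrite [(i + _)%N]addnC (exprD x) -[leRHS]mulrA; apply: ler_pM => //.
      - by rewrite mulr_ge0 ?nrm_ge0// exprn_ge0 ?ltW.
      - by rewrite mulr_ge0// exprn_ge0 ?ltW.
      - rewrite ler_wpM2l ?exprn_ge0 ?(ltW x0) ?(ltW r00)//.
        by rewrite lerXn2r ?nnegrE ?(ltW x0) ?(ltW r00).
    rewrite -big_distrr/= ler_wpM2l//.
      by rewrite mulr_ge0// exprn_ge0 ?ltW.
    have := @geometric_le_lim R M 1 r0 ler01 r00.
    rewrite gtr0_norm// => /(_ r01); rewrite div1r; apply: le_trans.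
    by rewrite /series/=; apply: ler_sum => i _; rewrite mul1r.
  rewrite nrmN nq => h.
  have hx : (r0 ^+ j.+2) ^+ n = x ^+ n * r0 ^+ n.
    by rewrite exprS exprMn mulrC.
  rewrite hx -ler_pdivlMr ?mulr_gt0 ?exprn_gt0// in h.
  apply: le_trans h _; rewrite exprSr le_eqVlt; apply/orP; left; apply/eqP.
  by rewrite -/x; field; rewrite ?lt0r_neq0 ?exprn_gt0 ?subr_gt0.
have hl : (fun j => B / r0 ^+ n / (1 - r0) * r0 ^+ j.+1) @ \oo --> (0 : R).
  rewrite -(mulr0 (B / r0 ^+ n / (1 - r0))); apply: cvgMr.
  have := @cvg_expr R r0; rewrite gtr0_norm// => /(_ r01).
  rewrite -(cvg_shiftn 1); under eq_fun do rewrite addn1; exact.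
rewrite eq_le nrm_ge0 andbT -(cvg_lim _ hl)//.
apply: limr_ge; first by apply/cvg_ex; eexists; exact: hl.
by apply: nearW => j; exact: key.
Qed.

(** Only convergence is assumed, since the sequence chosen by [gammacoef] comes with no growth
    bound. *)
Lemma qexp_unique c d F :
  (forall tau, 0 < complex.Im tau ->
    series (fun n => c n * nome tau ^+ n) @ \oo --> F tau) ->
  (forall tau, 0 < complex.Im tau ->
    series (fun n => d n * nome tau ^+ n) @ \oo --> F tau) -> c = d.
Proof.
move=> hc hd; apply/funext => n; apply/eqP; rewrite -subr_eq0; apply/eqP.
apply: (@qseries_eq0 (fun n => c n - d n)) => tau t0.
have -> : series (fun n => (c n - d n) * nome tau ^+ n) =
  (fun N => series (fun n => c n * nome tau ^+ n) N
     - series (fun n => d n * nome tau ^+ n) N).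
  by apply/funext => N; rewrite /series/= -sumrB; apply: eq_bigr => i _; rewrite mulrBl.
by rewrite -(subrr (F tau)); apply: cvgB; [exact: hc|exact: hd].
Qed.

End QUnique.

(** * The Gamma function and binomials of half-integers *)

Section EulerGamma.
Variable R : realType.
Implicit Types (s t x : R).
Local Notation mu := (@lebesgue_measure R).

Definition gamma_kernel s t : R := t `^ s * expR (- t).

Lemma gamma_kernel_ge0 s t : 0 <= gamma_kernel s t.
Proof. by rewrite mulr_ge0 ?powR_ge0 ?expR_ge0. Qed.

(** This is u <= e^u at u = t / (2s), raised to the power s. It yields integrability and also
    dominates the negative term of the derivative in [EulerGammaS]. *)
Lemma gamma_kernel_le s t : 0 < s -> 0 <= t ->
  gamma_kernel s t <= (2 * s) `^ s * expR (- (t / 2)).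
Proof.
move=> s0; rewrite le_eqVlt => /orP[/eqP <-|t0].
  rewrite /gamma_kernel powR0 ?gt_eqF// mul0r mulr_ge0 ?powR_ge0 ?expR_ge0//.
have s2 : 0 < 2 * s by rewrite mulr_gt0.
have h : t / (2 * s) <= expR (t / (2 * s)).
  by apply: le_trans (expR_ge1Dx _); rewrite lerDr.
have {}h : (t / (2 * s)) `^ s <= expR (t / 2).
  have -> : expR (t / 2) = (expR (t / (2 * s))) `^ s.
    by rewrite -expRM; congr expR; field; rewrite gt_eqF.
  by rewrite ge0_ler_powR ?nnegrE ?expR_ge0// ?ltW// divr_gt0.
have -> : gamma_kernel s t = (2 * s) `^ s * ((t / (2 * s)) `^ s * expR (- t)).
  rewrite /gamma_kernel mulrA -powRM ?divr_ge0 ?ltW//.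
  by rewrite [2 * s * _]mulrC divfK// gt_eqF.
rewrite ler_wpM2l ?powR_ge0//.
have -> : expR (- (t / 2)) = expR (t / 2) * expR (- t).
  by rewrite -expRD; congr expR; field.
by rewrite ler_wpM2r ?expR_ge0.
Qed.

Lemma expR_neg_half_cvg0 : expR (- (t / 2)) @[t --> +oo] --> (0 : R).
Proof.
apply: (cvg_comp (fun t : R => t / 2) (fun u => expR (- u))).
  by apply: gt0_cvgMly => //; exact: cvg_id.
exact: cvgr_expR.
Qed.

Lemma is_derive_expR_neg (c t : R) :
  is_derive t 1 (fun t : R => expR (- (t * c))) (- c * expR (- (t * c))).
Proof.
have h1 : is_derive t 1 (fun t : R => - (t * c)) (- c).
  have -> : (fun t : R => - (t * c)) = (fun t => (- c) *: t).
    by apply/funext => u; rewrite /= mulrC -mulNr.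
  by apply: is_derive_eq; rewrite /GRing.scale/= mulr1.
have := @is_derive1_comp R expR (fun t => - (t * c)) t _ _ (is_derive_expR _) h1.
by rewrite mulrC.
Qed.

Lemma gamma_kernel_cvgy s : 0 < s -> gamma_kernel s t @[t --> +oo] --> (0 : R).
Proof.
move=> s0.
have h : (2 * s) `^ s * expR (- (t / 2)) @[t --> +oo] --> (0 : R).
  by rewrite -(mulr0 ((2 * s) `^ s)); apply: cvgMr; exact: expR_neg_half_cvg0.
apply: squeeze_cvgr (cvg_cst 0) h.
near=> t; rewrite gamma_kernel_ge0 gamma_kernel_le//.
Unshelve. all: by end_near. Qed.

Lemma gamma_kernel_cvg0 s : 0 < s ->
  gamma_kernel s t @[t --> 0^'+] --> gamma_kernel s 0.
Proof.
move=> s0; rewrite {2}/gamma_kernel powR0 ?gt_eqF//; apply: cvgM.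
  exact: powR_cvg0.
apply: cvg_at_right_filter; apply: cvg_comp; last exact: continuous_expR.
exact: cvgN cvg_id.
Qed.

Lemma gamma_kernel_continuous s t : 0 < t -> {for t, continuous (gamma_kernel s)}.
Proof.
move=> t0; apply: cvgM.
  suff /derivable1_diffP/differentiable_continuous : derivable ((@powR R)^~ s) t 1 by [].
  by apply: derivable_powR; rewrite in_itv/= t0.
apply: cvg_comp; last exact: continuous_expR.
exact: cvgN cvg_id.
Qed.

Lemma gamma_kernel_within s : 0 < s -> {within `[(0%R:R), +oo[, continuous (gamma_kernel s)}.
Proof.
move=> s0; apply/continuous_within_itvcyP; split; last exact: gamma_kernel_cvg0.
by move=> t; rewrite in_itv/= andbT => t0; exact: gamma_kernel_continuous.
Qed.

Lemma measurable_gamma_kernel s : 0 < s ->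
  measurable_fun `[(0%R:R), +oo[ (gamma_kernel s).
Proof.
move=> s0; apply: subspace_continuous_measurable_fun => //.
exact: gamma_kernel_within.
Qed.

Lemma continuous_expR_neg_half : continuous (fun t : R => expR (- (t / 2))).
Proof.
move=> t; have [h _] := is_derive_expR_neg 2^-1 t.
exact/differentiable_continuous/derivable1_diffP.
Qed.

Lemma expR_neg_half_within : {within `[(0%R:R), +oo[, continuous (fun t : R => expR (- (t / 2)))}.
Proof.
exact: continuous_subspaceT continuous_expR_neg_half.
Qed.

Lemma integral_expR_neg_half :
  (\int[mu]_(t in `[(0%R:R), +oo[) (expR (- (t / 2)))%:E = 2%:E)%E.
Proof.
rewrite (@ge0_continuous_FTC2y _ _ (fun t => (-2) * expR (- (t / 2))) 0 0).
- by rewrite mul0r oppr0 expR0 mulr1 -EFinB sub0r opprK.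
- by move=> x _; exact: expR_ge0.
- exact: expR_neg_half_within.
- by rewrite -(mulr0 (-2)); apply: cvgMr; exact: expR_neg_half_cvg0.
- by move=> x _; apply: derivableM => //; have [h _] := is_derive_expR_neg 2^-1 x.
- apply: cvg_at_right_filter; apply: cvgMr.
  exact: continuous_expR_neg_half.
- move=> x _; rewrite derive1E.
  have h := is_derive_expR_neg 2^-1 x.
  have -> : (fun t : R => -2 * expR (- (t / 2))) = -2 \*: (fun t => expR (- (t / 2))) by [].
  rewrite deriveZ; last by case: h.
  by rewrite (derive_val (is_derive := h)) /GRing.scale/=; lra.
Qed.

Lemma integrable_expR_neg_half :
  mu.-integrable `[(0%R:R), +oo[ (EFin \o (fun t => expR (- (t / 2)))).
Proof.
apply/integrableP; split.
  apply/measurable_EFinP; apply: subspace_continuous_measurable_fun => //.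
  exact: expR_neg_half_within.
under eq_integral do rewrite /= ger0_norm ?expR_ge0//.
by rewrite integral_expR_neg_half ltry.
Qed.

Lemma integrable_gamma_kernel s : 0 < s ->
  mu.-integrable `[(0%R:R), +oo[ (EFin \o gamma_kernel s).
Proof.
move=> s0.
have : mu.-integrable `[(0%R:R), +oo[
    (fun t => ((2 * s) `^ s)%:E * (expR (- (t / 2)))%:E)%E.
  by apply: integrableZl => //; exact: integrable_expR_neg_half.
apply: le_integrable => //.
  by apply/measurable_EFinP; exact: measurable_gamma_kernel.
move=> t; rewrite /= in_itv/= andbT => t0; rewrite lee_fin.
by rewrite !ger0_norm ?gamma_kernel_ge0 ?gamma_kernel_le// mulr_ge0 ?powR_ge0 ?expR_ge0.
Qed.

Lemma EulerGammaE x : 1 < x ->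
  EulerGamma x = \int[mu]_(t in `[(0%R:R), +oo[) gamma_kernel (x - 1) t.
Proof.
move=> x1; rewrite /EulerGamma -Rintegral_itv_obnd_cbnd//.
apply: integrableS (integrable_gamma_kernel (_ : 0 < x - 1)) => //; last by rewrite subr_gt0.
by apply: subset_itvr; rewrite bnd_simp.
Qed.

Lemma is_derive_gamma_kernel s t : 0 < t ->
  is_derive t 1 (gamma_kernel (s + 1)) ((s + 1) * gamma_kernel s t - gamma_kernel (s + 1) t).
Proof.
move=> t0.
have h1 := is_derive1_powR (s + 1) t0.
have h2 := is_derive_expR_neg 1 t.
have -> : gamma_kernel (s + 1) = (@powR R)^~ (s + 1) * (fun t => expR (- (t * 1))).
  by apply/funext => u; rewrite /gamma_kernel fctE /= mulr1.
by apply: is_derive_eq; rewrite /gamma_kernel fctE /GRing.scale/= !mulr1 addrK; ring.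
Qed.

Lemma EulerGammaS x : 1 < x -> EulerGamma (x + 1) = x * EulerGamma x.
Proof.
move=> x1; have s0 : 0 < x - 1 by rewrite subr_gt0.
have s1 : 0 < x by exact: lt_trans x1.
rewrite !EulerGammaE ?ltr_wpDr ?ltW// addrK.
(* Integration by parts. The derivative x t^(x-1) e^(-t) - t^x e^(-t) of t^x e^(-t) changes sign,
   whereas the fundamental theorem on a ray is applied to nonnegative integrands. Adding C e^(-t/2),
   with C from [gamma_kernel_le], makes it nonnegative; the integral 2C of this term cancels at the
   end. *)
set C := (2 * x) `^ x.
pose g t := x * gamma_kernel (x - 1) t - gamma_kernel x t + C * expR (- (t / 2)).
pose F t := gamma_kernel x t + (- (2 * C)) * expR (- (t / 2)).
have FE t : 0 < t -> is_derive t 1 F (g t).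
  move=> t0; have h1 := is_derive_gamma_kernel (x - 1) t0; rewrite subrK in h1.
  have h2 := is_derive_expR_neg 2^-1 t.
  have h3 := @is_deriveZ _ _ _ _ (- (2 * C)) _ _ _ h2.
  have -> : F = gamma_kernel x + (- (2 * C)) \*: (fun t => expR (- (t / 2))) by [].
  by apply: is_derive_eq; rewrite /GRing.scale/= /g; field.
have ig1 := integrable_gamma_kernel s0.
have ig2 := integrable_gamma_kernel s1.
have ie := integrable_expR_neg_half.
have mD : measurable `[(0 : R), +oo[ by [].
have hg : \int[mu]_(t in `[(0%R:R), +oo[) g t = 2 * C.
  rewrite (@Rintegral_ge0_continuous_FTC2y _ _ F 0 0).
  - by rewrite /F /gamma_kernel powR0 ?gt_eqF// !mul0r oppr0 expR0; ring.
  - move=> u u0; rewrite /g -addrA addr_ge0//.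
      by rewrite mulr_ge0 ?gamma_kernel_ge0// ltW.
    by rewrite addrC subr_ge0 gamma_kernel_le.
  - move=> u; apply: cvgD; first apply: cvgB.
    + by apply: cvgMr; exact: gamma_kernel_within.
    + exact: gamma_kernel_within.
    + by apply: cvgMr; exact: expR_neg_half_within.
  - rewrite -[0]addr0 -[X in _ --> _ + X](mulr0 (- (2 * C))); apply: cvgD.
      exact: gamma_kernel_cvgy.
    by apply: cvgMr; exact: expR_neg_half_cvg0.
  - by move=> u u0; have [] := FE u u0.
  - apply: cvgD; first exact: gamma_kernel_cvg0.
    apply: cvg_at_right_filter; apply: cvgMr.
    exact: continuous_expR_neg_half.
  - move=> u; rewrite in_itv/= andbT => u0; rewrite derive1E.
    by have [_ ->] := FE u u0.
have h2 : \int[mu]_(t in `[(0%R:R), +oo[) expR (- (t / 2)) = 2.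
  by rewrite /Rintegral integral_expR_neg_half.
have ig3 : mu.-integrable `[(0%R:R), +oo[
    (EFin \o (fun t => x * gamma_kernel (x - 1) t)).
  have : mu.-integrable `[(0%R:R), +oo[
      (fun t => x%:E * (gamma_kernel (x - 1) t)%:E)%E by apply: integrableZl.
  exact.
have ig4 : mu.-integrable `[(0%R:R), +oo[
    (EFin \o (fun t => C * expR (- (t / 2)))).
  have : mu.-integrable `[(0%R:R), +oo[
      (fun t => C%:E * (expR (- (t / 2)))%:E)%E by apply: integrableZl.
  exact.
have ig5 : mu.-integrable `[(0%R:R), +oo[
    (EFin \o (fun t => x * gamma_kernel (x - 1) t - gamma_kernel x t)).
  have : mu.-integrable `[(0%R:R), +oo[
      (fun t => (x * gamma_kernel (x - 1) t)%:E - (gamma_kernel x t)%:E)%E.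
    by apply: integrableB.
  exact.
rewrite /g RintegralD// RintegralB// !RintegralZl// h2 in hg.
lra.
Qed.

(** On [1, 2] the integrand is at least e^(-2). *)
Lemma EulerGamma_gt0 x : 1 < x -> 0 < EulerGamma x.
Proof.
move=> x1; have s0 : 0 < x - 1 by rewrite subr_gt0.
rewrite EulerGammaE// /Rintegral.
have iK := integrable_gamma_kernel s0.
have mK : measurable_fun `[(0%R:R), +oo[ (EFin \o gamma_kernel (x - 1)).
  by apply/measurable_EFinP; exact: measurable_gamma_kernel.
have sub : `[(1%R:R), 2%R] `<=` `[(0%R:R), +oo[.
  by move=> t; rewrite /= !in_itv/= andbT => /andP[t1 _]; exact: le_trans t1.
suff h : ((expR (- 2))%:E <= \int[mu]_(t in `[(0%R:R), +oo[) (gamma_kernel (x - 1) t)%:E)%E.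
  rewrite -lte_fin fineK; last exact: integrable_fin_num iK.
  by apply: lt_le_trans h; rewrite lte_fin expR_gt0.
have mD : measurable `[(0 : R), +oo[ by [].
have m12 : measurable `[(1 : R), 2] by [].
apply: (@le_trans _ _ (\int[mu]_(t in `[(1%R:R), 2%R]) (gamma_kernel (x - 1) t)%:E)%E); last first.
  apply: ge0_subset_integral => // t _; by rewrite lee_fin gamma_kernel_ge0.
have -> : (expR (- 2))%:E = (\int[mu]_(t in `[(1%R:R), 2%R]) (expR (- 2))%:E)%E.
  rewrite integral_cst// /= lebesgue_measure_itv/= lte_fin ltr1n.
  by rewrite -EFinD -EFinM; congr EFin; ring.
apply: ge0_le_integral => //.
- exact: measurable_funS mD sub mK.
- move=> t; rewrite /= in_itv/= => /andP[t1 t2]; rewrite lee_fin /gamma_kernel.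
  rewrite -[leLHS]mul1r ler_pM ?expR_ge0 ?ler_expR ?lerN2//.
  by rewrite -[X in X <= _](powRr0 t) ler_powR// ltW.
Qed.

End EulerGamma.

Section HalfIntegerBinomials.
Variable R : realType.

(** This is kappa + n - 1 for kappa = 3/2, the common weight of both factors of the bracket when l
    is odd. *)
Let alpha (n : nat) : R := n%:R + 1 / 2.

Lemma gbinom0 (a : R) : 0 < a -> gbinom a 0 = 1.
Proof.
move=> a0; rewrite /gbinom fact0 subr0 mul1r divff// gt_eqF//.
by apply: EulerGamma_gt0; rewrite ltrDr.
Qed.

Lemma gbinomS (a : R) i : 1 < a - i%:R ->
  gbinom a i.+1 = gbinom a i * (a - i%:R) / i.+1%:R.
Proof.
move=> ai; rewrite /gbinom factS natrM.
have -> : a - i.+1%:R + 1 = a - i%:R by rewrite -natr1; ring.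
rewrite (EulerGammaS ai); have := EulerGamma_gt0 ai => /lt0r_neq0.
move: (EulerGamma (a + 1)) (EulerGamma (a - i%:R)) => G g g0.
have f0 : (i`!%:R : R) != 0 by rewrite pnatr_eq0 -lt0n fact_gt0.
have s0 : (i.+1%:R : R) != 0 by rewrite pnatr_eq0.
have a0 : a - i%:R != 0 by rewrite gt_eqF// (lt_trans ltr01).
by move: i.+1%:R s0 => y y0; field; rewrite g0 f0 y0 a0.
Qed.

Lemma gbinom_half_diag n : gbinom (alpha n) n =
  'C(n.*2.+1, n)%:R * n.*2.+2%:R / 2 ^+ n.*2.+1.
Proof.
elim: n => [|n IH].
  by rewrite gbinom0 ?bin0 ?expr1 ?mul1r ?divff// /alpha; lra.
(* Both binomials have Gamma(3/2) in the denominator, so only the numerator and the factorial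
   change. *)
have -> : gbinom (alpha n.+1) n.+1 =
    gbinom (alpha n) n * (n%:R + 3 / 2) / n.+1%:R.
  rewrite /gbinom /alpha factS natrM.
  have -> : n.+1%:R + 1 / 2 + 1 = (n%:R + 1 / 2 + 1) + 1 :> R by rewrite -natr1; ring.
  have -> : n.+1%:R + 1 / 2 - n.+1%:R + 1 = 1 / 2 + 1 :> R by ring.
  have -> : n%:R + 1 / 2 - n%:R + 1 = 1 / 2 + 1 :> R by ring.
  rewrite (@EulerGammaS R (n%:R + 1 / 2 + 1)); last by have := ler0n R n; lra.
  have g0 : EulerGamma (1 / 2 + 1 : R) != 0 by rewrite gt_eqF// EulerGamma_gt0//; lra.
  have f0 : (n`!%:R : R) != 0 by rewrite pnatr_eq0 -lt0n fact_gt0.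
  have s0 : (n.+1%:R : R) != 0 by rewrite pnatr_eq0.
  move: (EulerGamma (n%:R + _ + _)) (EulerGamma _) g0 => G g g0.
  by move: n.+1%:R s0 => y y0; field; rewrite g0 f0 y0.
have h1 : (n.+1 * 'C(n.*2.+3, n.+1) = n.*2.+3 * 'C(n.*2.+2, n))%N.
  by rewrite -mul_bin_diag.
have h2 : (n.*2.+2 * 'C(n.*2.+1, n) = n.+2 * 'C(n.*2.+2, n))%N.
  rewrite (mul_bin_down n.*2.+2 n); congr (_ * _)%N; lia.
move/(congr1 (fun k => k%:R : R)): h1; move/(congr1 (fun k => k%:R : R)): h2.
rewrite !natrM IH doubleS => h2 h1.
have -> : 'C(n.*2.+3, n.+1)%:R = n.*2.+3%:R * (n.*2.+2%:R * 'C(n.*2.+1, n)%:R) / n.+2%:R / n.+1%:R :> R.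
  rewrite h2 [n.+2%:R * _]mulrC mulrA mulfK ?pnatr_eq0// -h1 [n.+1%:R * _]mulrC.
  by rewrite mulfK ?pnatr_eq0.
rewrite !exprS -(natr1 n.*2.+3) -(natr1 n.*2.+2) -(natr1 n.*2.+1) -(natr1 n.*2).
rewrite -!(natr1 n.+1) -(natr1 n) -!muln2 natrM.
have n0 := ler0n R n.
field.
rewrite expf_eq0 pnatr_eq0/= andbF/=; apply/andP; split; apply: lt0r_neq0; lra.
Qed.

(** The inductive step of [gbinom_half_prod] with x = n - i - 1 and y = i; K B is its right-hand
    side at i. *)
Let gbinom_step_identity (x y g1 g2 K B : R) : 0 <= x -> 0 <= y ->
  g1 * (x + y + 1 + 1 / 2 - x) / (x + 1) * g2 = K * B ->
  g1 * (g2 * (x + y + 1 + 1 / 2 - y) / (y + 1)) =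
  K * ((x * 2 + 1 + 1) * ((x * 2 + 1 + 1 + 1) * B) / (y * 2 + 1 + 1) /
    (y * 2 + 1 + 1 + 1)).
Proof.
move=> x0 y0 h.
rewrite [RHS](_ : _ = K * B * ((x * 2 + 1 + 1) * (x * 2 + 1 + 1 + 1) /
    (y * 2 + 1 + 1) / (y * 2 + 1 + 1 + 1))); last by ring.
rewrite -h; field; do ?[apply/andP; split]; apply: lt0r_neq0; lra.
Qed.

(** From i to i + 1 the left side is multiplied by (n - i)(n - i + 1/2) / ((i + 1)(i + 3/2)).
    Doubling all four factors gives the quotient of the binomials of 2n + 2 at 2i + 3 and 2i + 1. *)
Lemma gbinom_half_prod n i : (i <= n)%N ->
  gbinom (alpha n) (n - i) * gbinom (alpha n) i =
  'C(n.*2.+1, n)%:R / 2 ^+ n.*2.+1 * 'C(n.*2.+2, i.*2.+1)%:R.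
Proof.
elim: i => [_|i IH lt_in].
  rewrite subn0 gbinom0 ?mulr1 ?gbinom_half_diag ?bin1; first by ring.
  by rewrite /alpha; have := ler0n R n; lra.
have {}IH := IH (ltnW lt_in).
have ni : (n - i = (n - i.+1).+1)%N by lia.
have nE : n%:R = (n - i.+1)%:R + i%:R + 1 :> R by rewrite -natrD natr1; congr _%:R; lia.
have x0 := ler0n R (n - i.+1); have i0 := ler0n R i.
rewrite ni gbinomS in IH; last by rewrite /alpha nE; lra.
rewrite gbinomS; last by rewrite /alpha nE; lra.
have h1 : (i.*2.+3 * 'C(n.*2.+2, i.*2.+3) = (n - i.+1).*2.+1 .+1 * 'C(n.*2.+2, i.*2.+2))%N.
  rewrite mul_bin_left; congr (_ * _)%N; lia.
have h2 : (i.*2.+2 * 'C(n.*2.+2, i.*2.+2) = (n - i.+1).*2.+3 * 'C(n.*2.+2, i.*2.+1))%N.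
  rewrite mul_bin_left; congr (_ * _)%N; lia.
move/(congr1 (fun k => k%:R : R)): h1; move/(congr1 (fun k => k%:R : R)): h2.
rewrite !natrM => h2 h1.
have -> : 'C(n.*2.+2, i.+1.*2.+1)%:R =
   (n - i.+1).*2.+2%:R * ((n - i.+1).*2.+3%:R * 'C(n.*2.+2, i.*2.+1)%:R) / i.*2.+2%:R / i.*2.+3%:R :> R.
  rewrite doubleS -h2 [i.*2.+2%:R * _]mulrC mulrA mulfK ?pnatr_eq0// -h1 [i.*2.+3%:R * _]mulrC.
  by rewrite mulfK ?pnatr_eq0.
move: IH; rewrite /alpha {1 3}nE nE.
set x := (n - i.+1)%:R in nE x0 *; set B := 'C(n.*2.+2, i.*2.+1)%:R.
set K := _ / 2 ^+ _.
rewrite -!(natr1 (_.*2.+2)) -!(natr1 (_.*2.+1)) -!(natr1 (_.*2)) -!(natr1 i) -!(natr1 (n - i.+1)) -!muln2 !natrM -/x.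
move=> IH.
exact: gbinom_step_identity IH.
Qed.

End HalfIntegerBinomials.

(** * Chebyshev polynomials *)

Section Chebyshev.
Variable F : numFieldType.
Implicit Types (t n w : F).

(* With t = sqrt n * cos x, this is 2^-l n^(l/2) U_l(cos x). *)
Fixpoint cheb_pair (t n : F) (l : nat) : F * F :=
  if l is l'.+1 then
    let: (c, d) := cheb_pair t n l' in (t * c - n / 4 * d, c)
  else (1, 0).

Definition cheb t n l := (cheb_pair t n l).1.

Lemma cheb0 t n : cheb t n 0 = 1. Proof. by []. Qed.

Lemma cheb1 t n : cheb t n 1 = t.
Proof. by rewrite /cheb/= mulr1 mulr0 subr0. Qed.

Lemma chebSS t n l : cheb t n l.+2 = t * cheb t n l.+1 - n / 4 * cheb t n l.
Proof. by rewrite /cheb /=; case: cheb_pair. Qed.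

(* The real part and 1/sqrt(-s) times the imaginary part of (t + sqrt(-s))^l. *)
Definition even_part t s l : F := \sum_(0 <= i < l.+1) 'C(l, i.*2)%:R * (- s) ^+ i * t ^+ (l - i.*2).
Definition odd_part t s l : F := \sum_(0 <= i < l.+1) 'C(l, i.*2.+1)%:R * (- s) ^+ i * t ^+ (l - i.*2.+1).

Lemma binr_expS t l i : 'C(l, i)%:R * t ^+ (l.+1 - i) = t * ('C(l, i)%:R * t ^+ (l - i)).
Proof.
have [li|il] := ltnP l i; first by rewrite bin_small// !mul0r mulr0.
by rewrite subSn// exprS; ring.
Qed.

(** Multiplication of E + w O by t + w, where w^2 = -s; [odd_partS] is the other component. *)
Lemma even_partS t s l : even_part t s l.+1 = t * even_part t s l - s * odd_part t s l.
Proof.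
rewrite /even_part /odd_part.
under eq_bigr => i _.
  have -> : 'C(l.+1, i.*2)%:R * (- s) ^+ i * t ^+ (l.+1 - i.*2) =
     t * ('C(l, i.*2)%:R * (- s) ^+ i * t ^+ (l - i.*2)) +
     (if i is i'.+1 then - s * ('C(l, i'.*2.+1)%:R * (- s) ^+ i' * t ^+ (l - i'.*2.+1)) else 0).
    case: i => [|i]; first by rewrite !bin0 addr0 !subn0 exprS; ring.
    rewrite doubleS binS natrD mulrDl mulrDl subSS; congr (_ + _).
      by rewrite mulrAC -subSS binr_expS; ring.
    by rewrite exprS; ring.
  over.
rewrite big_split/= -big_distrr/=; congr (_ + _).
  rewrite big_nat_recr//= bin_small ?mul0r ?addr0//; lia.
by rewrite big_nat_recl//= add0r -big_distrr/= mulNr.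
Qed.

Lemma odd_partS t s l : odd_part t s l.+1 = t * odd_part t s l + even_part t s l.
Proof.
rewrite /even_part /odd_part.
under eq_bigr => i _.
  have -> : 'C(l.+1, i.*2.+1)%:R * (- s) ^+ i * t ^+ (l.+1 - i.*2.+1) =
     t * ('C(l, i.*2.+1)%:R * (- s) ^+ i * t ^+ (l - i.*2.+1)) +
     'C(l, i.*2)%:R * (- s) ^+ i * t ^+ (l - i.*2).
    rewrite binS natrD mulrDl mulrDl subSS; congr (_ + _).
    by rewrite mulrAC -subSS binr_expS; ring.
  over.
rewrite big_split/= -big_distrr/=; congr (_ * _ + _);
  rewrite big_nat_recr//= bin_small ?mul0r ?addr0//; lia.
Qed.

(** For -s = t^2 - n the numbers t + w and t - w are the roots of X^2 - 2tX + n, so the odd parts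
    satisfy the recurrence of 2^l c_l. *)
Lemma cheb_odd_part t n l : 2 ^+ l * cheb t n l = odd_part t (n - t ^+ 2) l.+1.
Proof.
set s := n - t ^+ 2.
have rec k : odd_part t s k.+2 = 2 * t * odd_part t s k.+1 - n * odd_part t s k.
  by rewrite odd_partS even_partS !odd_partS /s; ring.
have o0 : odd_part t s 0 = 0 by rewrite /odd_part big_nat1 bin_small// !mul0r.
have o1 : odd_part t s 1 = 1.
  by rewrite odd_partS o0 /even_part big_nat1 bin0 subn0 !expr0; ring.
suff: 2 ^+ l * cheb t n l = odd_part t s l.+1 /\
      2 ^+ l.+1 * cheb t n l.+1 = odd_part t s l.+2 by case.
elim: l => [|l [h1 h2]]; first by rewrite cheb0 cheb1 rec o0 o1; split; ring.
split=> //; rewrite chebSS rec -h2 -h1 !exprS.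
by field.
Qed.

(** The ballot number, equal to T(k, mu) for 2 mu <= k; in this form it obeys the Pascal rule, also
    just beyond that range. *)
Definition ballot k mu : F := 'C(k, mu)%:R - (if mu is mu'.+1 then 'C(k, mu')%:R else 0).

Lemma ballotS k mu : ballot k.+1 mu.+1 = ballot k mu.+1 + ballot k mu.
Proof. by rewrite /ballot binS; case: mu => [|mu]; rewrite ?bin0 ?binS !natrD; ring. Qed.

Lemma Tcoef_ballot k mu : (mu.*2 <= k)%N -> Tcoef F k mu = ballot k mu.
Proof.
move=> hk; rewrite /Tcoef /ballot; case: mu hk => [|mu] hk.
  by rewrite bin0 muln0 !subn0 divff ?mulr1 ?subr0// pnatr_eq0 addn1.
have h : (mu.+1 * 'C(k, mu.+1) = (k - mu) * 'C(k, mu))%N by rewrite mul_bin_left.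
move/(congr1 (fun k => k%:R : F)): h; rewrite !natrM => h.
have -> : (k - mu.+1 + 1 = k - mu)%N by lia.
have -> : (k - 2 * mu.+1 + 1)%:R = (k - mu)%:R - mu.+1%:R :> F.
  by rewrite -natrB; [congr _%:R|]; lia.
have k0 : (k - mu)%:R != 0 :> F by rewrite pnatr_eq0; lia.
have -> : 'C(k, mu)%:R = mu.+1%:R * 'C(k, mu.+1)%:R / (k - mu)%:R :> F.
  by rewrite h mulrAC divff ?mul1r.
by field.
Qed.

(** Induction on k: t c_l = c_(l+1) + (n/4) c_(l-1) raises the two indices, and [ballotS] collects
    the coefficients. *)
Lemma cheb_expansion t n k :
  \sum_(0 <= mu < k./2.+1) (n / 4) ^+ mu * ballot k mu * cheb t n (k - mu.*2) = t ^+ k.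
Proof.
set w := n / 4.
have ballot0 j : ballot j 0 = 1 by rewrite /ballot bin0 subr0.
elim: k => [|k IH]; first by rewrite big_nat1 ballot0 cheb0 !mulr1.
pose c1 k mu := if (k < mu.*2)%N then 0 else cheb t n (k - mu.*2).
(* [c2 k mu] is c_(k - 2 mu - 1) with the convention c_(-1) = 0, which truncated subtraction would
   miss. *)
pose c2 k mu := if (k < mu.*2.+1)%N then 0 else cheb t n (k - mu.*2.+1).
have tc mu : (mu.*2 <= k)%N -> t * cheb t n (k - mu.*2) =
    cheb t n (k.+1 - mu.*2) + w * c2 k mu.
  move=> hmu; rewrite /c2; have [h|h] := ltnP k mu.*2.+1.
    have -> : (k = mu.*2)%N by lia.
    by rewrite subnn subSnn cheb0 cheb1; ring.
  have -> : (k.+1 - mu.*2 = (k - mu.*2.+1).+2)%N by lia.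
  have -> : (k - mu.*2 = (k - mu.*2.+1).+1)%N by lia.
  by rewrite chebSS /w; ring.
rewrite exprS -IH big_distrr/=.
have -> : \sum_(0 <= mu < k./2.+1) t * (w ^+ mu * ballot k mu * cheb t n (k - mu.*2)) =
  \sum_(0 <= mu < k./2.+1) w ^+ mu * ballot k mu * cheb t n (k.+1 - mu.*2) +
  \sum_(0 <= mu < k./2.+1) w ^+ mu.+1 * ballot k mu * c2 k mu.
  rewrite -big_split/=; apply: eq_big_nat => mu /andP[_ hmu].
  have -> : t * (w ^+ mu * ballot k mu * cheb t n (k - mu.*2)) =
     w ^+ mu * ballot k mu * (t * cheb t n (k - mu.*2)) by ring.
  rewrite tc; last by lia.
  by rewrite exprS; ring.
rewrite [in LHS]big_nat_recl//= [X in _ = X + _]big_nat_recl//=.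
rewrite !ballot0 -addrA; congr (_ + _).
have eqS mu : w ^+ mu.+1 * ballot k.+1 mu.+1 * cheb t n (k.+1 - mu.+1.*2) =
   w ^+ mu.+1 * ballot k mu.+1 * cheb t n (k.+1 - mu.+1.*2) +
   w ^+ mu.+1 * ballot k mu * cheb t n (k.+1 - mu.+1.*2).
  by rewrite ballotS; ring.
under eq_bigr do rewrite eqS.
rewrite big_split/=.
have c2E mu : (mu.*2.+1 <= k)%N -> c2 k mu = cheb t n (k.+1 - mu.+1.*2).
  by move=> h; rewrite /c2 ltnNge h/= doubleS subSS.
have [ok|ek] := boolP (odd k).
  have kE : (uphalf k = k./2.+1)%N by lia.
  rewrite kE; congr (_ + _).
    (* The top term is 0, as the binomials of odd k at (k + 1)/2 and (k - 1)/2 agree. *)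
    rewrite big_nat_recr//= [X in _ + X](_ : _ = 0) ?addr0//.
    rewrite /ballot (_ : 'C(k, k./2.+1) = 'C(k, k./2)); first by ring.
    by rewrite -bin_sub; [congr 'C(_, _)|]; lia.
  by apply: eq_big_nat => mu /andP[_ hmu]; rewrite c2E//; lia.
have kE : (uphalf k = k./2)%N by lia.
rewrite kE; congr (_ + _).
(* For even k the top term carries c_(-1) = 0. *)
rewrite [in RHS]big_nat_recr//= [X in _ = _ + X](_ : _ = 0) ?addr0.
  by apply: eq_big_nat => mu /andP[_ hmu]; rewrite c2E//; lia.
by rewrite /c2 ifT ?mulr0//; lia.
Qed.

End Chebyshev.

(** * Binary quadratic forms and class numbers *)

Section Forms.
(* [(u, v, w, z)] is the matrix with rows (u, v) and (w, z). *)
Definition imat : Type := (int * int * int * int)%type.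

Implicit Types (Q x y : bqform) (M N : imat) (D : int).

Definition mdet M : int := let: (u, v, w, z) := M in u * z - v * w.

Definition mmul M N : imat :=
  let: (u, v, w, z) := M in let: (u', v', w', z') := N in
  (u * u' + v * w', u * v' + v * z', w * u' + z * w', w * v' + z * z').

Definition madj M : imat := let: (u, v, w, z) := M in (z, - v, - w, u).

Definition mid : imat := (1, 0, 0, 1).

Definition act Q M : bqform :=
  let: (a, b, c) := Q in let: (u, v, w, z) := M in
  (a * u ^+ 2 + b * u * w + c * w ^+ 2,
   2 * a * u * v + b * (u * z + v * w) + 2 * c * w * z,
   a * v ^+ 2 + b * v * z + c * z ^+ 2).

Lemma mdet_mul M N : mdet (mmul M N) = mdet M * mdet N.
Proof. by case: M => [[[u v] w] z]; case: N => [[[u' v'] w'] z'] /=; ring. Qed.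

Lemma mmulA M N P : mmul M (mmul N P) = mmul (mmul M N) P.
Proof.
case: M => [[[u v] w] z]; case: N => [[[u' v'] w'] z'].
by case: P => [[[a b] c] d] /=; congr (_, _, _, _); ring.
Qed.

Lemma mul1m M : mmul mid M = M.
Proof. by case: M => [[[u v] w] z] /=; congr (_, _, _, _); ring. Qed.

Lemma mdet_adj M : mdet (madj M) = mdet M.
Proof. by case: M => [[[u v] w] z] /=; ring. Qed.

Lemma mmul_adj M : mdet M = 1 -> mmul M (madj M) = mid.
Proof. by case: M => [[[u v] w] z] /= h; congr (_, _, _, _); rewrite -?h; ring. Qed.

Lemma madj_mul M : mdet M = 1 -> mmul (madj M) M = mid.
Proof. by case: M => [[[u v] w] z] /= h; congr (_, _, _, _); rewrite -?h; ring. Qed.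

Lemma actM Q M N : act (act Q M) N = act Q (mmul M N).
Proof.
case: Q => [[a b] c]; case: M => [[[u v] w] z]; case: N => [[[u' v'] w'] z'] /=.
by congr (_, _, _); ring.
Qed.

Lemma act1 Q : act Q mid = Q.
Proof. by case: Q => [[a b] c] /=; congr (_, _, _); ring. Qed.

Lemma bqdisc_act Q M : bqdisc (act Q M) = mdet M ^+ 2 * bqdisc Q.
Proof.
by case: Q => [[a b] c]; case: M => [[[u v] w] z]; rewrite /bqdisc /=; ring.
Qed.

Lemma bqeval_act Q u v w z (s t : int) :
  bqeval (act Q (u, v, w, z)) s t = bqeval Q (u * s + v * t) (w * s + z * t).
Proof. by case: Q => [[a b] c]; rewrite /bqeval /=; ring. Qed.

Lemma bqeval_inj Q x : (forall s t, bqeval Q s t = bqeval x s t) -> Q = x.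
Proof.
case: Q => [[a b] c]; case: x => [[a' b'] c'] h.
have := h 1 0; have := h 0 1; have := h 1 1; rewrite /bqeval /= => h1 h2 h3.
by congr (_, _, _); lia.
Qed.

Lemma bqequivP Q x : bqequiv Q x <-> exists2 M, mdet M = 1 & x = act Q M.
Proof.
split=> [[u [v [w [z [h hQ]]]]]|[[[[u v] w] z] h ->]].
  exists (u, v, w, z) => //; apply: bqeval_inj => s t.
  by rewrite hQ bqeval_act.
by exists u, v, w, z; split=> // s t; rewrite bqeval_act.
Qed.

Lemma bqequiv_refl Q : bqequiv Q Q.
Proof. by apply/bqequivP; exists mid; rewrite ?act1. Qed.

Lemma bqequiv_sym Q x : bqequiv Q x -> bqequiv x Q.
Proof.
move=> /bqequivP[M h ->]; apply/bqequivP; exists (madj M); rewrite ?mdet_adj//.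
by rewrite actM mmul_adj// act1.
Qed.

Lemma bqequiv_trans x Q y : bqequiv Q x -> bqequiv x y -> bqequiv Q y.
Proof.
move=> /bqequivP[M hM ->] /bqequivP[N hN ->]; apply/bqequivP.
by exists (mmul M N); rewrite ?actM// mdet_mul hM hN.
Qed.

Lemma eq_bqclass Q x : (bqclass Q = bqclass x) <-> bqequiv Q x.
Proof.
split=> [h|h].
  by have : bqclass x x := bqequiv_refl x; rewrite -h.
apply/seteqP; split=> y /= hy.
  exact: bqequiv_trans (bqequiv_sym h) hy.
exact: bqequiv_trans h hy.
Qed.

Lemma bqposdefP Q : bqposdef Q <-> 0 < Q.1.1 /\ bqdisc Q < 0.
Proof.
case: Q => [[a b] c]; rewrite /bqposdef /bqdisc /bqeval /=; split=> [h|[a0 d0] s t st].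
  have a0 : 0 < a by have := h 1 0 isT; lia.
  split=> //.
  (* At (-b, 2a) the form takes the value -a times its discriminant. *)
  have := h (- b) (2 * a); rewrite xpair_eqE => /(_ ltac:(lia)).
  have -> : a * (- b) ^+ 2 + b * (- b) * (2 * a) + c * (2 * a) ^+ 2 =
    a * - (b ^+ 2 - 4 * a * c) by ring.
  by rewrite pmulr_rgt0// oppr_gt0.
have h : 4 * a * (a * s ^+ 2 + b * s * t + c * t ^+ 2) =
    (2 * a * s + b * t) ^+ 2 - (b ^+ 2 - 4 * a * c) * t ^+ 2 by ring.
have [t0|t0] := eqVneq t 0.
  move: st; rewrite t0 xpair_eqE eqxx andbT => s0.
  have : 0 < s ^+ 2 by rewrite exprn_even_gt0.
  by nia.
have t2 : 0 < t ^+ 2 by rewrite exprn_even_gt0.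
have : 0 < 4 * a * (a * s ^+ 2 + b * s * t + c * t ^+ 2).
  by rewrite h ltr_wpDl ?sqr_ge0// -mulNr mulr_gt0// oppr_gt0.
by rewrite pmulr_rgt0// mulr_gt0.
Qed.

Lemma bqposdef_act Q M : mdet M != 0 -> bqposdef Q -> bqposdef (act Q M).
Proof.
move=> m0 hQ s t st; case: M m0 => [[[u v] w] z] /= m0; rewrite bqeval_act.
apply: hQ; apply: contraNneq st => -[h1 h2].
have hs : (u * z - v * w) * s = 0.
  transitivity (z * (u * s + v * t) - v * (w * s + z * t)); first by ring.
  by rewrite h1 h2; ring.
have ht : (u * z - v * w) * t = 0.
  transitivity (u * (w * s + z * t) - w * (u * s + v * t)); first by ring.
  by rewrite h1 h2; ring.
move/eqP: hs; move/eqP: ht; rewrite !mulf_eq0 (negbTE m0)/= => /eqP -> /eqP ->.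
by rewrite eqxx.
Qed.

(** * Reduction of forms and finiteness of the class set *)

Definition bqreduced Q := (`|Q.1.2| <= Q.1.1 <= Q.2).

Lemma bqreduction Q : bqposdef Q -> exists2 x, bqequiv Q x & bqreduced x.
Proof.
have [n] := ubnP (absz Q.1.1); elim: n Q => // n IH [[a b] c] /= an hQ.
have [/= a0 d0] := (bqposdefP _).1 hQ.
(* k is b / (2a) rounded to a nearest integer, so that -a <= b' < a. If c' < a, exchanging the outer
   coefficients lowers the leading one, and the descent goes on. *)
pose k := ((b + a) %/ (2 * a))%Z; pose b' := b - 2 * a * k.
pose c' := a * k ^+ 2 - b * k + c.
have hb' : `|b'| <= a.
  have := divz_eq (b + a) (2 * a); have := modz_ge0 (b + a) (_ : 2 * a != 0).
  have := ltz_pmod (b + a) (_ : 0 < 2 * a); rewrite -/k /b' => h1 h2 h3.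
  have {}h1 := h1 ltac:(lia); have {}h2 := h2 ltac:(lia).
  by lia.
have eq1 : act (a, b, c) (1, - k, 0, 1) = (a, b', c').
  by rewrite /= /b' /c'; congr (_, _, _); ring.
have e1 : bqequiv (a, b, c) (a, b', c').
  by apply/bqequivP; exists (1, - k, 0, 1); rewrite ?eq1//=; ring.
have [ac|ca] := leP a c'; first by exists (a, b', c'); rewrite // /bqreduced /= hb' ac.
have p1 : bqposdef (act (act (a, b, c) (1, - k, 0, 1)) (0, -1, 1, 0)).
  by apply: bqposdef_act => //; apply: bqposdef_act; rewrite //= mulr0.
rewrite eq1 in p1.
have c0 : 0 < c' by have [/= + _] := (bqposdefP _).1 p1; lia.
have [|x hx rx] := IH _ _ p1; first by rewrite /=; lia.
exists x => //; apply: bqequiv_trans hx; apply: bqequiv_trans e1 _.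
by apply/bqequivP; exists (0, -1, 1, 0).
Qed.

Definition bqbox (n : nat) : seq bqform :=
  let r := [seq i%:Z - n%:Z | i <- iota 0 n.*2.+1] in
  [seq (ab, c) | ab <- [seq (a, b) | a <- r, b <- r], c <- r].

Lemma size_bqbox n : size (bqbox n) = (n.*2.+1 ^ 3)%N.
Proof. by rewrite !size_allpairs size_map size_iota !expnS muln1 mulnA. Qed.

Lemma mem_bqbox n a b c : `|a| <= n%:Z -> `|b| <= n%:Z -> `|c| <= n%:Z ->
  (a, b, c) \in bqbox n.
Proof.
have hr (i : int) : `|i| <= n%:Z -> i \in [seq i%:Z - n%:Z | i <- iota 0 n.*2.+1].
  move=> hi; apply/mapP; exists (absz (i + n%:Z)); last by lia.
  by rewrite mem_iota; lia.
move=> ha hb hc; apply/allpairsP; exists ((a, b), c); split; [|exact: hr|by []].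
by apply/allpairsP; exists (a, b); split; [exact: hr|exact: hr|].
Qed.

(** A reduced form has b^2 <= a^2 <= ac, so |D| >= 3ac and all coefficients are at most |D|. The
    explicit box gives finiteness and also the polynomial bound behind the growth of H(n). *)
Lemma bqclasses_box D C : D < 0 -> bqclasses D C ->
  C \in [seq bqclass Q | Q <- bqbox (absz D)].
Proof.
move=> D0 [Q [hQ hD] <-]; have [[[a b] c] Qx /andP[ba ac]] := bqreduction hQ.
rewrite /= in ba ac.
rewrite ((eq_bqclass _ _).2 Qx).
apply: map_f.
have /bqequivP[M hM hx] := Qx.
have : bqdisc (a, b, c) = D by rewrite hx bqdisc_act hM hD mul1r.
rewrite /bqdisc /= => hd.
have [/= a0 _] : 0 < (a, b, c).1.1 /\ bqdisc (a, b, c) < 0.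
  by apply/bqposdefP; rewrite hx; apply: bqposdef_act => //; rewrite hM.
have b2 : b ^+ 2 <= a ^+ 2 by rewrite -[b ^+ 2]real_normK ?num_real// lerXn2r ?nnegrE//; lia.
have a2 : a ^+ 2 <= a * c by rewrite expr2 ler_pM2l.
have cc : c <= a * c by rewrite ler_peMl; lia.
by apply: mem_bqbox; nia.
Qed.

Lemma finite_bqclasses D : D < 0 -> finite_set (bqclasses D).
Proof.
move=> D0; apply: (@sub_finite_set _ _ [set` [seq bqclass Q | Q <- bqbox (absz D)]]).
  by move=> C /(bqclasses_box D0).
exact: finite_seq.
Qed.

Definition mass D : rat := \sum_(C \in bqclasses D) ((bqomega C)%:R : rat)^-1.

Lemma mass_bounds D : D < 0 -> 0 <= mass D <= ((absz D).*2.+1 ^ 3)%:R.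
Proof.
move=> D0; have fD := finite_bqclasses D0.
have -> : mass D = \sum_(C <- fset_set (bqclasses D)) ((bqomega C)%:R : rat)^-1.
  by rewrite /mass fsbig_finite.
apply/andP; split; first by rewrite sumr_ge0// => C _; rewrite invr_ge0.
have : \sum_(C <- fset_set (bqclasses D)) ((bqomega C)%:R : rat)^-1 <=
    \sum_(C <- fset_set (bqclasses D)) (1 : rat).
  by apply: ler_sum => C _; rewrite /bqomega; do ?case: ifP.
move/le_trans; apply.
rewrite big_const_seq iter_addr_0 count_predT ler_nat -size_bqbox.
rewrite -(size_map (fun Q => bqclass Q)); apply: uniq_leq_size; first exact: fset_uniq.
by move=> C; rewrite in_fset_set// => /set_mem; exact: bqclasses_box.
Qed.

(** When the congruence test in [hurwitz] fails, both sides are 0: b^2 - 4ac is always 0 or 1 mod 4,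
    so there are no forms. *)
Lemma hurwitz_nat_pos (n : nat) : (0 < n)%N -> hurwitz n%:R = mass (- n%:Z).
Proof.
move=> n0; rewrite /hurwitz pnatr_eq0 (gtn_eqF n0).
have nE : n%:R = (n%:Z)%:~R :> rat by [].
have -> : numq n%:R = n%:Z by rewrite nE numq_int.
rewrite natr_int ltr0n n0/=; case: ifPn => // hn.
rewrite /mass fsbig1// => C [[[a b] c] [_]]; rewrite /bqdisc/= => hd.
case/negP: hn; rewrite -hd !inE.
have hb : b = 2 * (b %/ 2)%Z + (b %% 2)%Z by lia.
have hr : (b %% 2)%Z = 0 \/ (b %% 2)%Z = 1 by lia.
set k := (b %/ 2)%Z in hb; set r := (b %% 2)%Z in hb hr.
have -> : b ^+ 2 - 4 * a * c = 4 * (k ^+ 2 + k * r - a * c) + r ^+ 2 by rewrite hb; ring.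
by case: hr => ->; lia.
Qed.

Lemma finite_int_ball (n : nat) : finite_set [set i : int | `|i| <= n%:Z].
Proof.
apply: (@sub_finite_set _ _ [set` [seq i%:Z - n%:Z | i <- iota 0 n.*2.+1]]).
  move=> i; rewrite /mkset => hi; apply/mapP; exists (absz (i + n%:Z)); last by lia.
  by rewrite mem_iota; lia.
exact: finite_seq.
Qed.

Lemma posdef_rep_bound (a b c s t A : int) :
  0 < a -> b ^+ 2 - 4 * a * c < 0 -> a * s ^+ 2 + b * s * t + c * t ^+ 2 = A ->
  `|t| <= 4 * a * A.
Proof.
move=> a0 d0 hA.
have h : 4 * a * A = (2 * a * s + b * t) ^+ 2 - (b ^+ 2 - 4 * a * c) * t ^+ 2.
  by rewrite -hA; ring.
have t2 : t ^+ 2 <= 4 * a * A.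
  rewrite h; have := sqr_ge0 (2 * a * s + b * t); have := sqr_ge0 t.
  move: (_ ^+ 2) (t ^+ 2) (b ^+ 2 - _) d0 => X Y d; nia.
apply: le_trans t2; rewrite -real_normK ?num_real// expr2.
have [->|t0] := eqVneq `|t| 0; first by rewrite mulr0.
by rewrite ler_peMr//; lia.
Qed.

(** The outer coefficients of [x] are the values of [Q] at the columns of [M], and a positive
    definite form takes a given value only at points of a bounded region. *)
Lemma finite_act Q x : bqposdef Q -> finite_set [set M | act Q M = x].
Proof.
case: Q => [[a b] c]; case: x => [[A B] C] /bqposdefP[/= a0 d0].
rewrite /bqdisc /= in d0.
have c0 : 0 < c by nia.
have [n nE] : exists n : nat, n%:Z = 4 * (a + c) * (`|A| + `|C|).
  exists (absz (4 * (a + c) * (`|A| + `|C|))).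
  by rewrite gez0_abs// mulr_ge0 ?addr_ge0// mulr_ge0// ltW// addr_gt0.
pose S := [set i : int | `|i| <= n%:Z].
have fS : finite_set S := finite_int_ball n.
apply: (@sub_finite_set _ _ (((S `*` S) `*` S) `*` S)); last first.
  by do !apply: finite_setX.
have d0' : b ^+ 2 - 4 * c * a < 0 by rewrite mulrAC.
move=> [[[u v] w] z] /= [hA _ hC].
have hw := posdef_rep_bound a0 d0 hA.
have hz := posdef_rep_bound a0 d0 hC.
have hu := @posdef_rep_bound c b a w u A c0 d0' ltac:(rewrite -hA; ring).
have hv := @posdef_rep_bound c b a z v C c0 d0' ltac:(rewrite -hC; ring).
have bnd e X : 0 < e -> e <= a + c -> X <= `|A| + `|C| -> 4 * e * X <= n%:Z.
  move=> e0 hec hX; rewrite nE; apply: (@le_trans _ _ (4 * e * (`|A| + `|C|))).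
    by rewrite ler_wpM2l// mulr_ge0// ltW.
  by rewrite ler_wpM2r ?ler_wpM2l// addr_ge0.
have ac : a <= a + c by lia.
have ca : c <= a + c by lia.
have hA' : A <= `|A| + `|C| by rewrite ler_wpDr// ler_norm.
have hC' : C <= `|A| + `|C| by rewrite ler_wpDl// ler_norm.
split; [split; [split|]|].
- exact: le_trans hu (bnd _ _ c0 ca hA').
- exact: le_trans hv (bnd _ _ c0 ca hC').
- exact: le_trans hw (bnd _ _ a0 ac hA').
- exact: le_trans hz (bnd _ _ a0 ac hC').
Qed.

(** * Counting transporters and automorphisms *)

Definition cnt (A : set imat) : rat := \sum_(M \in A) (1 : rat).

Lemma cnt_bij (A B : set imat) (h : imat -> imat) : set_bij A B h -> cnt A = cnt B.
Proof. by move=> hb; rewrite /cnt (reindex_fsbig h A B). Qed.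

Lemma cnt_seq (s : seq imat) : uniq s -> cnt [set` s] = (size s)%:R.
Proof.
move=> us; rewrite /cnt -fsbig_seq// big_const_seq iter_addr_0 count_predT.
by [].
Qed.

Lemma cnt_set0 : cnt set0 = 0.
Proof. exact: fsbig_set0. Qed.

Lemma cnt_gt0 A M : finite_set A -> A M -> 0 < cnt A.
Proof.
move=> fA AM; rewrite /cnt (fsbigD1 M)//=.
by rewrite ltr_wpDr// fsumr_ge0.
Qed.

Definition sl_trans x y := [set M | mdet M = 1 /\ act x M = y].

Definition aut x := sl_trans x x.

Lemma finite_sl_trans x y : bqposdef x -> finite_set (sl_trans x y).
Proof. by move=> /(finite_act y); apply: sub_finite_set => M []. Qed.

Lemma cnt_aut_gt0 x : bqposdef x -> 0 < cnt (aut x).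
Proof.
move=> px; apply: (cnt_gt0 (finite_sl_trans x px)); split; last exact: act1.
by [].
Qed.

Lemma cnt_sl_trans x y z : bqequiv x y -> cnt (sl_trans x z) = cnt (sl_trans y z).
Proof.
move=> /bqequivP[M hM ->]; symmetry; apply: (@cnt_bij _ _ (mmul M)); split.
- move=> N [hN <-]; split; first by rewrite mdet_mul hM hN.
  by rewrite actM.
- move=> N N' _ _ h.
  by rewrite -(mul1m N) -(mul1m N') -(madj_mul hM) -!mmulA h.
- move=> N [hN <-]; exists (mmul (madj M) N).
    split; first by rewrite mdet_mul mdet_adj hM hN.
    by rewrite actM mmulA mmul_adj// mul1m.
  by rewrite mmulA mmul_adj// mul1m.
Qed.

Lemma cnt_sl_trans_sym x y : cnt (sl_trans x y) = cnt (sl_trans y x).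
Proof.
have half a b M : sl_trans a b M -> sl_trans b a (madj M).
  move=> [hM <-]; split; first by rewrite mdet_adj.
  by rewrite actM mmul_adj// act1.
have adjK M : madj (madj M) = M.
  by case: M => [[[u v] w] z] /=; congr (_, _, _, _); ring.
apply: (@cnt_bij _ _ madj); split.
- by move=> M; exact: half.
- by move=> M N _ _ h; rewrite -(adjK M) -(adjK N) h.
- by move=> M hM; exists (madj M); [exact: half|exact: adjK].
Qed.

Lemma cnt_aut_equiv x y : bqequiv x y -> cnt (aut x) = cnt (aut y).
Proof.
move=> xy; rewrite /aut (cnt_sl_trans _ xy) cnt_sl_trans_sym.
exact: cnt_sl_trans.
Qed.

Lemma cnt_sl_trans0 x y : ~ bqequiv x y -> cnt (sl_trans x y) = 0.
Proof.
move=> xy; rewrite -cnt_set0; congr cnt; apply/seteqP; split=> // M [hM hx].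
by apply: xy; apply/bqequivP; exists M.
Qed.

Lemma int_le1 (i : int) : i ^+ 2 <= 1 -> [\/ i = 0, i = 1 | i = -1].
Proof.
move=> h; have : -1 <= i <= 1 by nia.
move=> h2; have [h0|h0] := eqVneq i 0; first by constructor 1.
have [h1|h1] := eqVneq i 1; first by constructor 2.
by constructor 3; lia.
Qed.

(** The columns solve s^2 + t^2 = 1, so all entries lie in {-1, 0, 1} and inspection is enough. *)
Lemma cnt_aut_square (a : int) : 0 < a -> cnt (aut (a, 0, a)) = 4.
Proof.
move=> a0; rewrite [aut _](_ : _ = [set` ([:: (1, 0, 0, 1); (-1, 0, 0, -1);
   (0, 1, -1, 0); (0, -1, 1, 0)] : seq imat)]); first exact: cnt_seq.
apply/seteqP; split=> -[[[u v] w] z]; last first.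
  by rewrite /= !inE => /or4P[] /eqP[-> -> -> ->]; split=> //=; congr (_, _, _); ring.
case=> /= hd [h1 h2 h3].
have {}h1 : u ^+ 2 + w ^+ 2 = 1 by apply: (mulfI (lt0r_neq0 a0)); lia.
have {}h3 : v ^+ 2 + z ^+ 2 = 1 by apply: (mulfI (lt0r_neq0 a0)); lia.
have {h2} : u * v + w * z = 0 by apply: (mulfI (lt0r_neq0 a0)); lia.
have := sqr_ge0 u; have := sqr_ge0 v; have := sqr_ge0 w; have := sqr_ge0 z.
move=> z2 w2 v2 u2.
have hu := int_le1 (ltac:(lia) : u ^+ 2 <= 1).
have hv := int_le1 (ltac:(lia) : v ^+ 2 <= 1).
have hw := int_le1 (ltac:(lia) : w ^+ 2 <= 1).
have hz := int_le1 (ltac:(lia) : z ^+ 2 <= 1).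
move: hd h1 h3; clear - hu hv hw hz; case: hu => ->; case: hv => ->; case: hw => ->; case: hz => -> //=.
Qed.

Lemma cnt_aut_hex (a : int) : 0 < a -> cnt (aut (a, a, a)) = 6.
Proof.
move=> a0; rewrite [aut _](_ : _ = [set` ([:: (1, 0, 0, 1); (-1, 0, 0, -1);
   (1, 1, -1, 0); (-1, -1, 1, 0); (0, 1, -1, -1); (0, -1, 1, 1)] : seq imat)]); first exact: cnt_seq.
apply/seteqP; split=> -[[[u v] w] z]; last first.
  rewrite /= !inE => /orP[/eqP[-> -> -> ->]|/orP[/eqP[-> -> -> ->]|/or4P[] /eqP[-> -> -> ->]]];
   split=> //=; congr (_, _, _); ring.
case=> /= hd [h1 h2 h3].
have {}h1 : u ^+ 2 + u * w + w ^+ 2 = 1 by apply: (mulfI (lt0r_neq0 a0)); lia.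
have {}h3 : v ^+ 2 + v * z + z ^+ 2 = 1 by apply: (mulfI (lt0r_neq0 a0)); lia.
have {}h2 : 2 * u * v + u * z + v * w + 2 * w * z = 1 by apply: (mulfI (lt0r_neq0 a0)); lia.
(* Completing the square: (2t + s)^2 + 3 s^2 = 4. *)
have hexb (s t : int) : s ^+ 2 + s * t + t ^+ 2 = 1 -> s ^+ 2 <= 1.
  move=> h; have := sqr_ge0 (2 * t + s).
  have : (2 * t + s) ^+ 2 + 3 * s ^+ 2 = 4.
    by transitivity (4 * (s ^+ 2 + s * t + t ^+ 2)); [ring|rewrite h].
  by clear; lia.
have eqC (s t : int) : s ^+ 2 + s * t + t ^+ 2 = 1 -> t ^+ 2 + t * s + s ^+ 2 = 1.
  by move=> <-; ring.
have hu : u ^+ 2 <= 1 := hexb _ _ h1.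
have hv : v ^+ 2 <= 1 := hexb _ _ h3.
have hw : w ^+ 2 <= 1 := hexb _ _ (eqC _ _ h1).
have hz : z ^+ 2 <= 1 := hexb _ _ (eqC _ _ h3).
move/int_le1 : hu => hu; move/int_le1 : hv => hv.
move/int_le1 : hw => hw; move/int_le1 : hz => hz.
move: hd h1 h2 h3; clear - hu hv hw hz; case: hu => ->; case: hv => ->; case: hw => ->; case: hz => -> //=.
Qed.

(** Reduction forces a = 1. [bqreduced] keeps both signs of b on its boundary, so discriminant -3
    leaves (1, 1, 1) and (1, -1, 1), which differ by a translation. *)
Lemma small_disc_reduction Q : 0 < Q.1.1 ->
  (bqdisc Q = -4 -> bqequiv Q (1, 0, 1)) /\ (bqdisc Q = -3 -> bqequiv Q (1, 1, 1)).
Proof.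
move=> Q0; suff h : bqdisc Q = -4 \/ bqdisc Q = -3 ->
    exists2 x, bqequiv Q x & (bqdisc Q = -4 -> x = (1, 0, 1)) /\
      (bqdisc Q = -3 -> x = (1, 1, 1) \/ x = (1, -1, 1)).
  split=> hd.
    by have [|x Qx [hx _]] := h; [left|rewrite -hx].
  have [|x Qx [_ /(_ hd) [<-//|hx]]] := h; first by right.
  apply: bqequiv_trans Qx _; rewrite hx; apply/bqequivP.
  by exists (1, 1, 0, 1).
move=> hd; have pQ : bqposdef Q by apply/bqposdefP; split=> //; case: hd => ->.
have [[[a b] c] Qx /andP[/= ba ac]] := bqreduction pQ.
exists (a, b, c) => //; have /bqequivP[M hM hx] := Qx.
have hd' : bqdisc (a, b, c) = bqdisc Q by rewrite hx bqdisc_act hM expr1n mul1r.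
rewrite -hd' in hd *; rewrite /bqdisc /= in hd *.
have b2 : b ^+ 2 <= a ^+ 2 by rewrite -[b ^+ 2]real_normK ?num_real// lerXn2r ?nnegrE//; lia.
have a0 : 0 < a.
  have [/= + _] : 0 < (a, b, c).1.1 /\ bqdisc (a, b, c) < 0; last by [].
  by apply/bqposdefP; rewrite hx; apply: bqposdef_act => //; rewrite hM.
have a2 : a ^+ 2 <= a * c by rewrite expr2 ler_pM2l.
have a1 : a = 1 by nia.
rewrite {}a1 in ba ac hd b2 a2 *; clear hd' hx.
have hb := int_le1 b2.
split=> h; case: hb => hb; rewrite {}hb in h ba hd *.
- by congr (_, _, _); lia.
- by lia.
- by lia.
- by lia.
- by left; congr (_, _, _); lia.
- by right; congr (_, _, _); lia.
Qed.

Definition bqscale (k : int) Q : bqform := (k * Q.1.1, k * Q.1.2, k * Q.2).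

Lemma act_bqscale k Q M : act (bqscale k Q) M = bqscale k (act Q M).
Proof.
by case: Q => [[a b] c]; case: M => [[[u v] w] z]; rewrite /bqscale /=; congr (_, _, _); ring.
Qed.

Lemma trace_disc (t : int) : t ^+ 2 - 4 < 0 -> t ^+ 2 - 4 = -4 \/ t ^+ 2 - 4 = -3.
Proof.
move=> h; have : -1 <= t <= 1 by nia.
move=> h'; have : t = 0 \/ t = 1 \/ t = -1 by lia.
by move=> [->|[->|->]]; [left|right|right].
Qed.

(** An automorphism (u, v, w, z) with w != 0 fixes the root of [Q], so [Q] is proportional to the
    form [g] = (w, z - u, -v) of its fixed points, up to the sign e. The discriminant of [g] is
    trace^2 - 4 < 0, hence -4 or -3; so [g], and with it [Q], is equivalent to a multiple of x^2 +
    y^2 or x^2 + xy + y^2. *)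
Lemma aut_trivial Q : bqposdef Q -> ~ (exists a, bqequiv Q (a, 0, a)) ->
  ~ (exists a, bqequiv Q (a, a, a)) ->
  aut Q = [set` [:: mid; (-1, 0, 0, -1)]].
Proof.
move=> pQ n4 n3; apply/seteqP; split=> M; last first.
  rewrite /= !inE => /orP[] /eqP ->; split=> //; first exact: act1.
  by case: (Q) => [[a b] c] /=; congr (_, _, _); ring.
case: M => [[[u v] w] z]; have /bqposdefP[] := pQ.
case: Q pQ n4 n3 => [[a b] c] pQ n4 n3 /= a0 d0 [/= hd [h1 h2 h3]].
rewrite /bqdisc /= in d0.
(* [e1] and [e2] compare the first rows in S M = M^(-T) S, where S is the Gram matrix of the
   form. *)
have e1 : a * (z - u) = b * w.
  suff : 2 * a * z - b * w = 2 * a * u + b * w by clear; lia.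
  transitivity ((2 * a * u + b * w) * (u * z - v * w)); last by rewrite hd mulr1.
  by rewrite -[in 2 * a * z]h1 -[X in _ - X * w]h2; ring.
have e2 : a * v = - (c * w).
  suff : b * z - 2 * c * w = 2 * a * v + b * z by clear; lia.
  transitivity ((2 * a * v + b * z) * (u * z - v * w)); last by rewrite hd mulr1.
  by rewrite -[X in X * z - _]h2 -[X in _ - 2 * X * _]h3; ring.
have [w0|w0] := eqVneq w 0.
  have an0 := lt0r_neq0 a0.
  have zu : z = u.
    by apply/eqP; rewrite -subr_eq0; apply/eqP/(mulfI an0); rewrite e1 w0 !mulr0.
  have v0 : v = 0 by apply: (mulfI an0); rewrite e2 w0 !mulr0 oppr0.
  have hu : u ^+ 2 = 1 by rewrite -hd zu v0 mul0r subr0.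
  rewrite zu v0 w0.
  have [u0|u1|u1] := int_le1 (ltac:(by rewrite hu) : u ^+ 2 <= 1).
  - by move: hu; rewrite u0.
  - by rewrite u1 !inE eqxx.
  - by rewrite u1 !inE eqxx orbT.
have [e e2' ew] : exists2 e : int, e ^+ 2 = 1 & 0 < e * w.
  by have [w1|w1|w1] := ltgtP w 0; [exists (-1)|exists 1|]; lia.
pose g : bqform := (e * w, e * (z - u), - (e * v)).
have gE : bqscale a g = bqscale (e * w) (a, b, c).
  by rewrite /bqscale /g /=; congr (_, _, _); [ring|rewrite mulrCA e1; ring|rewrite mulrN mulrCA e2; ring].
have dg : bqdisc g = (u + z) ^+ 2 - 4.
  rewrite /bqdisc /g /=.
  transitivity (e ^+ 2 * ((u + z) ^+ 2 - 4 * (u * z - v * w))); first by ring.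
  by rewrite e2' hd; ring.
have dgN : bqdisc g < 0.
  have h : a ^+ 2 * bqdisc g = (e * w) ^+ 2 * (b ^+ 2 - 4 * a * c).
    case: gE; rewrite /bqdisc /g /= => g1 g2 g3.
    transitivity ((a * (e * (z - u))) ^+ 2 - 4 * (a * (e * w)) * (a * (- (e * v)))); first by ring.
    by rewrite g2 g3; ring.
  have a2 : 0 < a ^+ 2 by rewrite exprn_gt0.
  by rewrite -(pmulr_rlt0 _ a2) h pmulr_rlt0// exprn_gt0.
have [r4 r3] := @small_disc_reduction g ew.
have hd34 : bqdisc g = -4 \/ bqdisc g = -3.
  by rewrite dg; apply: trace_disc; rewrite -dg.
have key x : bqequiv g x -> exists y, bqequiv (a, b, c) y /\
    bqscale a x = bqscale (e * w) y.
  move=> /bqequivP[M hM ->]; exists (act (a, b, c) M); split.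
    by apply/bqequivP; exists M.
  by rewrite -!act_bqscale -gE.
have ew0 : e * w != 0 by rewrite gt_eqF.
case: hd34 => [/r4|/r3] /key[[[A B] C] [hy [/= hA hB hC]]].
  case: n4; exists A.
  suff [B0 CA] : B = 0 /\ C = A by rewrite B0 CA in hy.
  by split; apply: (mulfI ew0); rewrite -?hB -?hC -?hA ?mulr0.
case: n3; exists A.
suff [BA CA] : B = A /\ C = A by rewrite BA CA in hy.
by split; apply: (mulfI ew0); rewrite -?hB -?hC -?hA.
Qed.

Lemma cnt_aut Q : bqposdef Q -> cnt (aut Q) = 2 * (bqomega (bqclass Q))%:R.
Proof.
move=> pQ; rewrite /bqomega; case: asboolP => [[a Qa]|n4].
  rewrite (cnt_aut_equiv Qa) cnt_aut_square.
    by rewrite -natrM.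
  have /bqequivP[M hM hx] := Qa.
  have /bqposdefP[] : bqposdef (a, 0, a) by rewrite hx; apply: bqposdef_act => //; rewrite hM.
  by [].
case: asboolP => [[a Qa]|n3].
  rewrite (cnt_aut_equiv Qa) cnt_aut_hex.
    by rewrite -natrM.
  have /bqequivP[M hM hx] := Qa.
  have /bqposdefP[] : bqposdef (a, a, a) by rewrite hx; apply: bqposdef_act => //; rewrite hM.
  by [].
by rewrite aut_trivial// cnt_seq// mulr1.
Qed.

(** * Class numbers as sums weighted by automorphisms *)

Definition bqrep (C : set bqform) : bqform := xget (0, 0, 0) C.

Lemma bqrepP D C : bqclasses D C ->
  [/\ bqposdef (bqrep C), bqdisc (bqrep C) = D & C = bqclass (bqrep C)].
Proof.
move=> [Q [pQ dQ] <-].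
have /bqequivP[M hM hR] : bqequiv Q (bqrep (bqclass Q)).
  by rewrite -/(bqclass Q _); apply: xgetPex; exists Q; exact: bqequiv_refl.
split; [|by rewrite hR bqdisc_act hM dQ mul1r|].
  by rewrite hR; apply: bqposdef_act => //; rewrite hM.
by apply/eq_bqclass; apply/bqequivP; exists M.
Qed.

Definition clseq D : seq (set bqform) := fset_set (bqclasses D).

Lemma clseq_uniq D : uniq (clseq D).
Proof. exact: fset_uniq. Qed.

Lemma mem_clseq D C : D < 0 -> C \in clseq D <-> bqclasses D C.
Proof.
move=> D0; rewrite /clseq in_fset_set; last exact: finite_bqclasses.
by split=> [/set_mem|/mem_set].
Qed.

(* Weights are 1/#Aut, Aut taken in SL_2(Z), where #Aut = 2 omega; [xget] in
   [bqrep] never takes its default value on a class. *)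
Definition wt (C : set bqform) : rat := (cnt (aut (bqrep C)))^-1.

Lemma mass_clseq D : D < 0 -> mass D = 2 * \sum_(C <- clseq D) wt C.
Proof.
move=> D0; rewrite /mass fsbig_finite; last exact: finite_bqclasses.
rewrite big_distrr/=; apply: eq_big_seq => C /(mem_clseq _ D0).1 hC.
have [pR _ CE] := bqrepP hC.
by rewrite /wt (cnt_aut pR) -CE invfM mulrA divff ?mul1r.
Qed.

(** Orbit-stabilizer: only the class of [Q] contributes, and its transporter has as many elements as
    the automorphism group by which it is divided. *)
Lemma sum_sl_trans D Q : bqposdef Q -> bqdisc Q = D ->
  \sum_(C <- clseq D) cnt (sl_trans Q (bqrep C)) * wt C = 1.
Proof.
move=> pQ dQ; have D0 : D < 0 by rewrite -dQ; have /bqposdefP[] := pQ.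
have hC : bqclasses D (bqclass Q) by exists Q.
rewrite (bigD1_seq (bqclass Q)) ?clseq_uniq//=; last exact/mem_clseq.
have [pR dR CE] := bqrepP hC.
have Qr : bqequiv Q (bqrep (bqclass Q)) by apply/eq_bqclass.
rewrite /wt (cnt_sl_trans _ Qr) divff ?gt_eqF ?cnt_aut_gt0//.
rewrite big1_seq ?addr0// => C /andP[nC /(mem_clseq _ D0).1 hC'].
rewrite cnt_sl_trans0 ?mul0r// => /eq_bqclass h.
have [_ _ CE'] := bqrepP hC'.
by move/eqP: nC; apply; rewrite CE' h.
Qed.

(** * Class numbers of discriminants D and p^2 D *)

(* The matrices [lcoset p i], i <= p, represent the cosets SL_2(Z) M of
   matrices M of determinant p; i runs over P^1(F_p), with i = p at infinity. *)
Definition lcoset (p i : nat) : imat :=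
  if (i < p)%N then (1, i%:Z, 0, p%:Z) else (p%:Z, 0, 0, 1).

(** Transposition exchanges left and right cosets, so one family of representatives serves both
    counts. *)
Definition tr M : imat := let: (u, v, w, z) := M in (u, w, v, z).

Definition in_lcoset (p i : nat) M : bool :=
  let: (u, v, w, z) := M in
  if (i < p)%N then (p%:Z %| v - u * i%:Z)%Z && (p%:Z %| z - w * i%:Z)%Z
  else (p%:Z %| u)%Z && (p%:Z %| w)%Z.

Lemma mdet_lcoset p i : mdet (lcoset p i) = p%:Z.
Proof. by rewrite /lcoset; case: ifP => _ /=; ring. Qed.

Lemma tr_mul M N : tr (mmul M N) = mmul (tr N) (tr M).
Proof.
case: M => [[[u v] w] z]; case: N => [[[u' v'] w'] z'] /=.
by congr (_, _, _, _); ring.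
Qed.

Lemma trK : involutive tr.
Proof. by move=> [[[u v] w] z]. Qed.

Lemma mdet_tr M : mdet (tr M) = mdet M.
Proof. by case: M => [[[u v] w] z] /=; ring. Qed.

Section PrimeDet.
Variable p : nat.
Hypothesis pp : prime p.

Let p0 : (0 < p)%N. Proof. exact: prime_gt0. Qed.
Let P0 : (p%:Z : int) != 0. Proof. by rewrite eqz_nat -lt0n. Qed.

Lemma prime_dvdzM (a b : int) : (p%:Z %| a * b)%Z = (p%:Z %| a)%Z || (p%:Z %| b)%Z.
Proof. by rewrite !dvdzE abszM Euclid_dvdM. Qed.

Lemma in_lcosetP i M : in_lcoset p i M -> exists g, M = mmul g (lcoset p i).
Proof.
case: M => [[[u v] w] z]; rewrite /in_lcoset /lcoset; case: ifP => _ /andP[/dvdzP[a ha] /dvdzP[b hb]].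
  exists (u, a, w, b) => /=; rewrite -ha -hb.
  by congr (_, _, _, _); ring.
by exists (a, v, b, z) => /=; rewrite ha hb; congr (_, _, _, _); ring.
Qed.

Lemma mmul_in_lcoset i g : in_lcoset p i (mmul g (lcoset p i)).
Proof.
case: g => [[[u v] w] z]; rewrite /in_lcoset /lcoset; case: ifP => _ /=.
  apply/andP; split; apply/dvdzP; [exists v|exists z]; ring.
by apply/andP; split; apply/dvdzP; [exists u|exists w]; ring.
Qed.

Lemma mmul_lcoset_inj i g h : mmul g (lcoset p i) = mmul h (lcoset p i) -> g = h.
Proof.
case: g => [[[u v] w] z]; case: h => [[[u' v'] w'] z']; rewrite /lcoset.
case: ifP => _ /= [].
  rewrite !mulr1 !mulr0 !addr0 => -> /addrI/(mulIf P0) -> -> /addrI/(mulIf P0) -> //.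
by rewrite !mulr0 !mulr1 !addr0 !add0r => /(mulIf P0) -> -> /(mulIf P0) -> ->.
Qed.

Lemma linear_congruence (a b : int) : ~~ (p%:Z %| a)%Z ->
  exists2 j0 : nat, (j0 < p)%N &
  forall j : nat, (j < p)%N -> (p%:Z %| b - a * j%:Z)%Z = (j == j0).
Proof.
move=> pa; have [u [v huv]] := Bezoutz a p%:Z.
have g1 : gcdz a p%:Z = 1.
  have : coprimez p%:Z a by rewrite coprimezE prime_coprime// -dvdzE.
  by rewrite /coprimez gcdzC => /eqP.
rewrite g1 in huv.
exists (absz ((u * b) %% p%:Z)%Z).
  have := ltz_pmod (u * b) (_ : 0 < p%:Z); have := modz_ge0 (u * b) P0; lia.
move=> j jp.
have -> : (p%:Z %| b - a * j%:Z)%Z = (p%:Z %| u * b - j%:Z)%Z.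
  have e1 : u * b - j%:Z = u * (b - a * j%:Z) - v * j%:Z * p%:Z.
    by rewrite -[j%:Z in LHS]mul1r -huv; ring.
  have e2 : b - a * j%:Z = a * (u * b - j%:Z) + v * b * p%:Z.
    by rewrite -[b in LHS]mul1r -huv; ring.
  apply/idP/idP => h; first by rewrite e1 rpredB// ?dvdz_mull.
  by rewrite e2 rpredD// ?dvdz_mull.
rewrite -eqz_mod_dvd (modz_small (m := j%:Z)); last by rewrite /= ltz_nat jp.
by have := modz_ge0 (u * b) P0; lia.
Qed.

Lemma sum_linear_congruence (a b : int) : ~~ (p%:Z %| a)%Z ->
  (\sum_(j < p) (p%:Z %| (b - a * (j : nat)%:Z)%R)%Z = 1)%N.
Proof.
move=> /(linear_congruence b)[j0 hj0 hj].
rewrite (bigD1 (Ordinal hj0))//= hj// eqxx big1 ?addn0// => j jn.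
rewrite hj//; case: eqP => // e; case/eqP: jn; exact: val_inj.
Qed.

(** Since p^2 does not divide the determinant, [M] has rank exactly 1 mod p: either its second
    column is i times a nonzero first one for a unique i, or its first column is 0. *)
Lemma sum_in_lcoset M : mdet M = p%:Z -> (\sum_(i < p.+1) in_lcoset p i M = 1)%N.
Proof.
case: M => [[[u v] w] z] /= hd; rewrite big_ord_recr/= ltnn.
under eq_bigr do rewrite ltn_ord.
have [pu|pu] := boolP (p%:Z %| u)%Z; have [pw|pw] := boolP (p%:Z %| w)%Z => /=.
- rewrite big1// => i _; apply/eqP; rewrite eqb0; apply/negP => /andP[h1 h2].
  have pv : (p%:Z %| v)%Z by rewrite -[v](subrK (u * i%:Z)) rpredD// dvdz_mulr.
  have pz : (p%:Z %| z)%Z by rewrite -[z](subrK (w * i%:Z)) rpredD// dvdz_mulr.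
  move/dvdzP: pu hd => [a ->]; move/dvdzP: pw => [b ->].
  move/dvdzP: pv => [c ->]; move/dvdzP: pz => [d ->] hd.
  have : (a * d - c * b) * p%:Z = 1 by apply: (mulIf P0); rewrite mul1r -{3}hd; ring.
  move=> e1; have := dvdz_mull (a * d - c * b) (dvdzz p%:Z); rewrite e1.
  by rewrite dvdzE/= dvdn1 => /eqP p1; move: pp; rewrite p1.
- rewrite addn0 -[RHS](sum_linear_congruence z pw); apply: eq_bigr => i _; congr nat_of_bool.
  apply/andb_idl => h; have : (p%:Z %| w * (v - u * i%:Z))%Z.
    have -> : w * (v - u * i%:Z) = u * (z - w * i%:Z) - (u * z - v * w) by ring.
    by rewrite hd rpredB// dvdz_mull.
  by rewrite prime_dvdzM (negbTE pw).
- rewrite addn0 -[RHS](sum_linear_congruence v pu); apply: eq_bigr => i _; congr nat_of_bool.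
  apply/andb_idr => h; have : (p%:Z %| u * (z - w * i%:Z))%Z.
    have -> : u * (z - w * i%:Z) = (u * z - v * w) + w * (v - u * i%:Z) by ring.
    by rewrite hd rpredD// dvdz_mull.
  by rewrite prime_dvdzM (negbTE pu).
- rewrite addn0 -[RHS](sum_linear_congruence v pu); apply: eq_bigr => i _; congr nat_of_bool.
  apply/andb_idr => h; have : (p%:Z %| u * (z - w * i%:Z))%Z.
    have -> : u * (z - w * i%:Z) = (u * z - v * w) + w * (v - u * i%:Z) by ring.
    by rewrite hd rpredD// dvdz_mull.
  by rewrite prime_dvdzM (negbTE pu).
Qed.

Definition det_trans y x := [set M | mdet M = p%:Z /\ act y M = x].

Lemma finite_det_trans y x : bqposdef y -> finite_set (det_trans y x).
Proof. by move=> /(finite_act x); apply: sub_finite_set => M []. Qed.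

Lemma cnt_partition (A : set imat) (c : nat -> pred imat) n : finite_set A ->
  (forall M, A M -> \sum_(i < n) c i M = 1)%N ->
  cnt A = \sum_(i < n) cnt [set M | A M /\ c i M].
Proof.
move=> fA hc.
have cntE B : finite_set B -> cnt B = \sum_(M <- fset_set B) (1 : rat).
  by move=> fB; rewrite /cnt fsbig_finite.
have h i : cnt [set M | A M /\ c i M] = \sum_(M <- fset_set A) ((c i M)%:R : rat).
  transitivity (\sum_(M \in A) (if M \in [set M | c i M] then 1 else 0 : rat)).
    by rewrite /cnt -fsbig_mkcondr; congr (\sum_(_ \in _) _).
  rewrite fsbig_finite//; apply: eq_bigr => M _.
  have -> : (M \in [set M | c i M]) = c i M by apply/idP/idP => [/set_mem|/mem_set].
  by case: (c i M).
under [RHS]eq_bigr do rewrite h.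
rewrite exchange_big/= cntE//; apply: eq_big_seq => M.
rewrite in_fset_set// => /set_mem /hc hM.
by rewrite -natr_sum hM.
Qed.

Lemma cnt_det_left x y : bqposdef y -> cnt (det_trans y x) =
  \sum_(i < p.+1) cnt [set g | mdet g = 1 /\ act (act y g) (lcoset p i) = x].
Proof.
move=> py; rewrite (@cnt_partition _ (in_lcoset p) p.+1 (finite_det_trans x py)); last first.
  by move=> M [hM _]; exact: sum_in_lcoset.
apply: eq_bigr => i _; symmetry; apply: (@cnt_bij _ _ (fun g => mmul g (lcoset p i))).
split.
- move=> g [hg <-]; split; last exact: mmul_in_lcoset.
  by split; rewrite ?mdet_mul ?hg ?mul1r ?mdet_lcoset// -actM.
- by move=> g h _ _; exact: mmul_lcoset_inj.
- move=> M [[hM hx] /in_lcosetP[g hg]]; exists g => //; split; last by rewrite actM -hg.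
  by apply: (mulIf P0); rewrite mul1r -{1}(mdet_lcoset p i) -mdet_mul -hg.
Qed.

Lemma cnt_det_right x y : bqposdef y -> cnt (det_trans y x) =
  \sum_(i < p.+1) cnt (sl_trans (act y (tr (lcoset p i))) x).
Proof.
move=> py; rewrite (@cnt_partition _ (fun i M => in_lcoset p i (tr M)) p.+1 (finite_det_trans x py)); last first.
  by move=> M [hM _]; apply: sum_in_lcoset; rewrite mdet_tr.
apply: eq_bigr => i _; symmetry; apply: (@cnt_bij _ _ (mmul (tr (lcoset p i)))).
split.
- move=> g [hg <-]; split; last by rewrite tr_mul trK; exact: mmul_in_lcoset.
  by split; rewrite ?mdet_mul ?hg ?mulr1 ?mdet_tr ?mdet_lcoset// -actM.
- move=> g h _ _ /(congr1 tr); rewrite !tr_mul !trK => /mmul_lcoset_inj.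
  by move/(congr1 tr); rewrite !trK.
- move=> M [[hM hx] /in_lcosetP[g /(congr1 tr)]]; rewrite trK tr_mul => hg.
  exists (tr g) => //; split; last by rewrite actM -hg.
  by apply: (mulfI P0); rewrite mulr1 -{1}(mdet_lcoset p i) -(mdet_tr (lcoset p i)) -mdet_mul -hg.
Qed.

(** The number of lattices containing Z^2 with index p on which [x] stays integral. *)
Definition lift_count (x : bqform) : rat :=
  \sum_(i < p.+1) (`[< exists y, act y (lcoset p i) = x >])%:R.

Lemma act_lcoset_adj y i : act (act y (lcoset p i)) (madj (lcoset p i)) = bqscale (p%:Z ^+ 2) y.
Proof.
case: y => [[a b] c]; rewrite /lcoset; case: ifP => _ /=; rewrite /bqscale /=; congr (_, _, _); ring.
Qed.

Lemma bqscale_inj k : k != 0 -> injective (bqscale k).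
Proof.
by move=> k0 [[a b] c] [[a' b'] c'] [] /= /(mulfI k0) -> /(mulfI k0) -> /(mulfI k0) ->.
Qed.

Lemma bqposdef_scale k Q : 0 < k -> bqposdef (bqscale k Q) <-> bqposdef Q.
Proof.
move=> k0; have h s t : bqeval (bqscale k Q) s t = k * bqeval Q s t.
  by rewrite /bqeval /bqscale /=; ring.
by split=> hQ s t st; have := hQ s t st; rewrite h pmulr_rgt0.
Qed.

Lemma bqdisc_scale k Q : bqdisc (bqscale k Q) = k ^+ 2 * bqdisc Q.
Proof. by rewrite /bqdisc /bqscale /=; ring. Qed.

(** By [act_lcoset_adj] there is at most one [y] through which [x] factors. If it exists, the sets
    counted are the transporters between representatives and [y], and [sum_sl_trans] gives 1. *)
Lemma sum_lift D x i : bqposdef x -> bqdisc x = p%:Z ^+ 2 * D ->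
  \sum_(C <- clseq D) cnt [set g | mdet g = 1 /\
     act (act (bqrep C) g) (lcoset p i) = x] * wt C =
  (`[< exists y, act y (lcoset p i) = x >])%:R.
Proof.
move=> px dx; case: asboolP => [[y hy]|ny]; last first.
  rewrite big1// => C _; rewrite (_ : [set g | _] = set0) ?cnt_set0 ?mul0r//.
  by apply/seteqP; split=> // g [_ h]; apply: ny; exists (act (bqrep C) g).
have p2 : 0 < p%:Z ^+ 2 :> int by rewrite exprn_gt0// ltz_nat.
have py : bqposdef y.
  rewrite -(bqposdef_scale _ p2) -(act_lcoset_adj _ i) hy.
  by apply: bqposdef_act => //; rewrite mdet_adj mdet_lcoset.
have dy : bqdisc y = D.
  apply: (mulfI (lt0r_neq0 p2)); rewrite -dx -hy bqdisc_act mdet_lcoset//.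
rewrite -[RHS](sum_sl_trans py dy); apply: eq_bigr => C _; congr (_ * _).
rewrite cnt_sl_trans_sym; congr cnt; apply/seteqP; split=> g [hg h]; split=> //.
  by apply: (bqscale_inj (lt0r_neq0 p2)); rewrite -!(act_lcoset_adj _ i) h hy.
by rewrite h.
Qed.

(* Both sides count, with weights 1/#Aut at both ends, the matrices of
   determinant p from representatives of discriminant D to representatives of
   discriminant p^2 D: from the source there are p + 1 cosets M SL_2(Z),
   and [lift_count] counts the cosets SL_2(Z) M through which the target factors. *)
Lemma mass_double_count D : D < 0 ->
  p.+1%:R * \sum_(C <- clseq D) wt C =
  \sum_(C <- clseq (p%:Z ^+ 2 * D)) lift_count (bqrep C) * wt C.
Proof.
move=> D0; have D0' : p%:Z ^+ 2 * D < 0 by rewrite pmulr_rlt0// exprn_gt0// ltz_nat.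
pose S := \sum_(C <- clseq D) \sum_(C' <- clseq (p%:Z ^+ 2 * D))
  cnt (det_trans (bqrep C) (bqrep C')) * wt C' * wt C.
transitivity S.
  rewrite big_distrr/=; apply: eq_big_seq => C /(mem_clseq _ D0).1 /bqrepP[pC dC _].
  rewrite -big_distrl/=; congr (_ * _).
  under eq_bigr do rewrite cnt_det_right// big_distrl/=.
  rewrite exchange_big/= (eq_bigr (fun=> 1)) ?sumr_const ?card_ord// => i _.
  apply: sum_sl_trans; last by rewrite bqdisc_act mdet_tr mdet_lcoset dC.
  by apply: bqposdef_act => //; rewrite mdet_tr mdet_lcoset.
rewrite /S exchange_big/=; apply: eq_big_seq => C' /(mem_clseq _ D0').1 /bqrepP[pC' dC' _].
under eq_big_seq => C /(mem_clseq _ D0).1 /bqrepP[pC dC _].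
  rewrite cnt_det_left// mulrAC [_ * wt C]big_distrl/= mulrC; over.
rewrite -big_distrr/= mulrC exchange_big/=; congr (_ * _).
by apply: eq_bigr => i _; exact: sum_lift.
Qed.

End PrimeDet.

(** * Integer multiples of forms *)

Definition bqdvd (s : int) x : bool := [&& (s %| x.1.1)%Z, (s %| x.1.2)%Z & (s %| x.2)%Z].

Lemma bqdvdP s x : reflect (exists y, x = bqscale s y) (bqdvd s x).
Proof.
apply: (iffP and3P) => [[/dvdzP[a ha] /dvdzP[b hb] /dvdzP[c hc]]|[y ->]].
  exists (a, b, c); case: x ha hb hc => [[A B] C] /= -> -> ->.
  by rewrite /bqscale /= ![_ * s]mulrC.
by rewrite /bqscale /= !dvdz_mulr.
Qed.

Lemma bqdvd_equiv s x y : bqequiv x y -> bqdvd s x -> bqdvd s y.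
Proof.
move=> /bqequivP[M _ ->] /bqdvdP[z ->]; apply/bqdvdP.
by exists (act z M); rewrite act_bqscale.
Qed.

(** Scaling by s is a bijection from the classes of discriminant D onto the classes of multiples of
    s, and it preserves automorphism groups. *)
Lemma sum_scaled_classes D s : D < 0 -> 0 < s ->
  \sum_(C <- clseq (s ^+ 2 * D) | bqdvd s (bqrep C)) wt C = \sum_(C <- clseq D) wt C.
Proof.
move=> D0 s0; have D0' : s ^+ 2 * D < 0 by rewrite pmulr_rlt0// exprn_gt0.
have sn0 := lt0r_neq0 s0; have s2n0 : s ^+ 2 != 0 by rewrite expf_neq0.
pose Phi C := bqclass (bqscale s (bqrep C)).
have PhiP C : bqclasses D C ->
    bqclasses (s ^+ 2 * D) (Phi C) /\ bqequiv (bqscale s (bqrep C)) (bqrep (Phi C)).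
  move=> /bqrepP[pC dC _]; have h : bqclasses (s ^+ 2 * D) (Phi C).
    exists (bqscale s (bqrep C)) => //; split; first exact/bqposdef_scale.
    by rewrite bqdisc_scale dC.
  by split=> //; have [_ _ /eq_bqclass] := bqrepP h.
have equiv_scale x y : bqequiv (bqscale s x) (bqscale s y) -> bqequiv x y.
  move=> /bqequivP[M hM h]; apply/bqequivP; exists M => //.
  by apply: (bqscale_inj sn0); rewrite h act_bqscale.
have wtPhi C : bqclasses D C -> wt (Phi C) = wt C.
  move=> hC; have [_ h] := PhiP _ hC; rewrite /wt -(cnt_aut_equiv h).
  congr (_^-1); congr cnt; apply/seteqP; split=> M [hM e]; split=> //.
    by apply: (bqscale_inj sn0); rewrite -act_bqscale.
  by rewrite act_bqscale e.
rewrite -big_filter (perm_big (map Phi (clseq D)))/=; last first.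
  apply: uniq_perm; first by rewrite filter_uniq// clseq_uniq.
    rewrite map_inj_in_uniq ?clseq_uniq// => C C' /(mem_clseq _ D0).1 hC /(mem_clseq _ D0).1 hC'.
    move=> /eq_bqclass/equiv_scale/eq_bqclass.
    by have [_ _ {2}->] := bqrepP hC; have [_ _ {2}->] := bqrepP hC'.
  move=> C; rewrite mem_filter; apply/andP/mapP.
    move=> [dC /(mem_clseq _ D0').1 hC]; have [pC diC CE] := bqrepP hC.
    have /bqdvdP[y hy] := dC.
    have hCy : bqclasses D (bqclass y).
      exists y => //; split; first by move: pC; rewrite hy bqposdef_scale.
      by apply: (mulfI s2n0); rewrite -bqdisc_scale -hy.
    exists (bqclass y); first exact/mem_clseq.
    rewrite CE hy; apply/eq_bqclass.
    have [_ _ /eq_bqclass/bqequivP[M hM hr]] := bqrepP hCy.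
    by apply/bqequivP; exists M; rewrite ?act_bqscale -?hr.
  move=> [C' /(mem_clseq _ D0).1 hC' ->]; have [h1 h2] := PhiP _ hC'.
  split; last exact/mem_clseq.
  by apply: bqdvd_equiv h2 _; apply/bqdvdP; exists (bqrep C').
rewrite big_map; apply: eq_big_seq => C /(mem_clseq _ D0).1; exact: wtPhi.
Qed.

(** * Lifts at an odd prime and the resulting recurrences *)

Section OddPrime.
Variable p : nat.
Hypotheses (pp : prime p) (p3 : (2 < p)%N).

Let p0 : (0 < p)%N. Proof. exact: prime_gt0. Qed.
Let P0 : (p%:Z : int) != 0. Proof. by rewrite eqz_nat -lt0n. Qed.
Let p2 : ~~ (p%:Z %| (2 : int))%Z.
Proof. by rewrite dvdzE; apply/negP => /dvdn_leq => /(_ isT); lia. Qed.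
Let dvdM := prime_dvdzM pp.

Lemma lift_lcosetP (i : nat) A B C : (i < p)%N ->
  (exists y, act y (lcoset p i) = (A, B, C)) <->
  (p%:Z %| B - 2 * A * i%:Z)%Z && (p%:Z ^+ 2 %| C - i%:Z * B + A * i%:Z ^+ 2)%Z.
Proof.
move=> ip; rewrite /lcoset ip; split.
  move=> [[[a b] c] /= [hA hB hC]]; apply/andP; split; apply/dvdzP.
    by exists b; rewrite -hB -hA; ring.
  by exists c; rewrite -hC -hB -hA; ring.
move=> /andP[/dvdzP[b hb] /dvdzP[c hc]]; exists (A, b, c) => /=.
have hB : B = b * p%:Z + 2 * A * i%:Z by rewrite -hb; ring.
have hC : C = c * p%:Z ^+ 2 + i%:Z * B - A * i%:Z ^+ 2 by rewrite -hc; ring.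
by congr (_, _, _); rewrite ?hC ?hB; ring.
Qed.

Lemma lift_lcoset_inftyP A B C :
  (exists y, act y (lcoset p p) = (A, B, C)) <->
  (p%:Z ^+ 2 %| A)%Z && (p%:Z %| B)%Z.
Proof.
rewrite /lcoset ltnn; split.
  move=> [[[a b] c] /= [hA hB hC]]; apply/andP; split; apply/dvdzP.
    by exists a; rewrite -hA; ring.
  by exists b; rewrite -hB; ring.
by move=> /andP[/dvdzP[a ->] /dvdzP[b ->]]; exists (a, b, C) => /=; congr (_, _, _); ring.
Qed.

Lemma lift_countE A B C : lift_count p (A, B, C) =
  ((\sum_(i < p) ((p%:Z %| (B - 2 * A * (i : nat)%:Z)%R)%Z &&
     (p%:Z ^+ 2 %| (C - (i : nat)%:Z * B + A * (i : nat)%:Z ^+ 2)%R)%Z) +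
   ((p%:Z ^+ 2 %| A)%Z && (p%:Z %| B)%Z))%N)%:R.
Proof.
rewrite /lift_count big_ord_recr/= natrD natr_sum; congr (_ + _).
  apply: eq_bigr => i _; congr (_%:R); congr nat_of_bool.
  by apply/asboolP/idP; move/(lift_lcosetP _ _ _ (ltn_ord i)).
by congr (_%:R); congr nat_of_bool; apply/asboolP/idP => /lift_lcoset_inftyP.
Qed.

Lemma dvdz_sqr_prime (a : int) : (p%:Z %| a ^+ 2)%Z -> (p%:Z %| a)%Z.
Proof. by rewrite expr2 dvdM orbb. Qed.

Lemma dvdz_pscale (a : int) : (p%:Z ^+ 2 %| p%:Z * a)%Z = (p%:Z %| a)%Z.
Proof. by rewrite expr2 dvdz_mul2l. Qed.

Lemma dvdz_p2W (a : int) : (p%:Z ^+ 2 %| a)%Z -> (p%:Z %| a)%Z.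
Proof. by apply: dvdz_trans; rewrite expr2 dvdz_mulr. Qed.

(** Mod p the form is a nonzero multiple of the square of a linear form, and its only zero lifts. If
    p does not divide A, that zero is i = B / (2A), and 4A times the value there is (B - 2Ai)^2
    minus the discriminant. Otherwise it is infinity, and 4CA = B^2 - disc gives p^2 | A. *)
Lemma lift_count_primitive D x : bqdisc x = p%:Z ^+ 2 * D -> ~~ bqdvd p%:Z x ->
  lift_count p x = 1.
Proof.
case: x => [[A B] C]; rewrite /bqdisc /bqdvd /= => hd np; rewrite lift_countE.
suff -> : (\sum_(i < p) ((p%:Z %| (B - 2 * A * (i : nat)%:Z)%R)%Z &&
     (p%:Z ^+ 2 %| (C - (i : nat)%:Z * B + A * (i : nat)%:Z ^+ 2)%R)%Z) +
   ((p%:Z ^+ 2 %| A)%Z && (p%:Z %| B)%Z) = 1)%N by [].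
have pd : (p%:Z ^+ 2 %| B ^+ 2 - 4 * A * C)%Z by rewrite hd dvdz_mulr.
have [pA|pA] := boolP (p%:Z %| A)%Z; last first.
  have -> : (p%:Z ^+ 2 %| A)%Z = false by apply/negbTE; apply: contra pA; exact: dvdz_p2W.
  have pA2 : ~~ (p%:Z %| 2 * A)%Z by rewrite dvdM negb_or p2.
  rewrite addn0 -[RHS](sum_linear_congruence pp B pA2); apply: eq_bigr => i _.
  congr nat_of_bool; apply/andb_idr => h.
  have : (p%:Z ^+ 2 %| (4 * A) * (C - (i : nat)%:Z * B + A * (i : nat)%:Z ^+ 2))%Z.
    have -> : 4 * A * (C - (i : nat)%:Z * B + A * (i : nat)%:Z ^+ 2) =
       (B - 2 * A * (i : nat)%:Z) ^+ 2 - (B ^+ 2 - 4 * A * C) by ring.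
    by rewrite rpredB// !expr2 dvdz_mul.
  rewrite Gauss_dvdzr//.
  have -> : 4 * A = 2 * (2 * A) by ring.
  rewrite coprimezE abszX abszM coprimeXl// coprimeMr !prime_coprime//.
  by rewrite -[p in (p %| _)%N]/(absz p%:Z) -!dvdzE p2 pA2.
have pB : (p%:Z %| B)%Z.
  apply: dvdz_sqr_prime; have -> : B ^+ 2 = (B ^+ 2 - 4 * A * C) + 4 * C * A by ring.
  by rewrite rpredD ?(dvdz_p2W pd)// dvdz_mull.
have pC : ~~ (p%:Z %| C)%Z by move: np; rewrite pA pB.
rewrite big1 ?add0n ?pB ?andbT; last first.
  move=> i _; apply/eqP; rewrite eqb0; apply/negP => /andP[_ /dvdz_p2W h]; case/negP: pC.
  have -> : C = (C - (i : nat)%:Z * B + A * (i : nat)%:Z ^+ 2) + ((i : nat)%:Z * B - A * (i : nat)%:Z ^+ 2) by ring.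
  by rewrite rpredD// rpredB ?(dvdz_mull _ pB) ?(dvdz_mulr _ pA).
suff -> : (p%:Z ^+ 2 %| A)%Z by [].
have : (p%:Z ^+ 2 %| 4 * C * A)%Z.
  have -> : 4 * C * A = B ^+ 2 - (B ^+ 2 - 4 * A * C) by ring.
  by rewrite rpredB// !expr2 dvdz_mul.
rewrite Gauss_dvdzr//.
have -> : 4 * C = 2 * (2 * C) by ring.
rewrite coprimezE abszX !abszM coprimeXl// !coprimeMr !prime_coprime//.
by rewrite -[p in (p %| _)%N]/(absz p%:Z) -!dvdzE p2 pC.
Qed.

(** For a multiple of p the lifts are the zeros mod p on the projective line, with no condition on
    the derivative. *)
Lemma lift_count_scaled A B C : lift_count p (bqscale p%:Z (A, B, C)) =
  ((\sum_(i < p) (p%:Z %| (C - (i : nat)%:Z * B + A * (i : nat)%:Z ^+ 2)%R)%Z +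
   (p%:Z %| A)%Z)%N)%:R.
Proof.
rewrite /bqscale /= lift_countE (dvdz_mulr B (dvdzz p%:Z)) andbT dvdz_pscale; congr ((_ + _)%N%:R).
apply: eq_bigr => i _; congr nat_of_bool.
have -> : p%:Z * B - 2 * (p%:Z * A) * i%:Z = p%:Z * (B - 2 * A * i%:Z) by ring.
rewrite dvdz_mulr//=.
have -> : p%:Z * C - i%:Z * (p%:Z * B) + p%:Z * A * i%:Z ^+ 2 =
   p%:Z * (C - i%:Z * B + A * i%:Z ^+ 2) by ring.
exact: dvdz_pscale.
Qed.

Lemma dvdz_disc_quad A B C (i : int) : ~~ (p%:Z %| A)%Z ->
  (p%:Z %| C - i * B + A * i ^+ 2)%Z =
  (p%:Z %| (B - 2 * A * i) ^+ 2 - (B ^+ 2 - 4 * A * C))%Z.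
Proof.
move=> pA.
have -> : (B - 2 * A * i) ^+ 2 - (B ^+ 2 - 4 * A * C) = 2 * (2 * (A * (C - i * B + A * i ^+ 2))) by ring.
by rewrite !dvdM (negbTE p2) (negbTE pA).
Qed.

(** The discriminant is a nonzero square mod p, so there are two distinct zeros; when p | A one of
    them is infinity. *)
Lemma lift_count_split D (d : int) x : bqdisc x = D -> ~~ (p%:Z %| d)%Z ->
  (p%:Z %| D - d ^+ 2)%Z -> lift_count p (bqscale p%:Z x) = 2.
Proof.
case: x => [[A B] C]; rewrite /bqdisc /= => hd pd hDd; rewrite lift_count_scaled.
have [pA|pA] := boolP (p%:Z %| A)%Z.
  have pB : ~~ (p%:Z %| B)%Z.
    apply: contra pd => pB; apply: dvdz_sqr_prime.
    have -> : d ^+ 2 = B * B - 4 * C * A - (D - d ^+ 2) by rewrite -hd; ring.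
    by rewrite rpredB ?hDd// rpredB ?(dvdz_mull _ pB) ?(dvdz_mull _ pA).
  suff -> : (\sum_(i < p) (p%:Z %| (C - (i : nat)%:Z * B + A * (i : nat)%:Z ^+ 2)%R)%Z = 1)%N by [].
  rewrite -[RHS](sum_linear_congruence pp C pB); apply: eq_bigr => i _; congr nat_of_bool.
  rewrite rpredDr; last by rewrite dvdz_mulr.
  by rewrite [_ * B]mulrC.
rewrite addn0.
have pA2 : ~~ (p%:Z %| 2 * A)%Z by rewrite dvdM negb_or p2.
suff -> : (\sum_(i < p) (p%:Z %| (C - (i : nat)%:Z * B + A * (i : nat)%:Z ^+ 2)%R)%Z = 1 + 1)%N by [].
have s1 := sum_linear_congruence pp (B - d) pA2.
have s2 := sum_linear_congruence pp (B + d) pA2.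
rewrite -[X in _ = (X + _)%N]s1 -[X in _ = (_ + X)%N]s2.
rewrite -big_split/=; apply: eq_bigr => i _; rewrite dvdz_disc_quad//.
set X := 2 * A * i%:Z.
have -> : (B - X) ^+ 2 - (B ^+ 2 - 4 * A * C) = (B - d - X) * (B + d - X) - (D - d ^+ 2).
  by rewrite -hd; ring.
rewrite rpredBr// dvdM.
have [h1|h1] /= := boolP (p%:Z %| B - d - X)%Z; last by [].
rewrite (_ : (p%:Z %| B + d - X)%Z = false)//; apply/negbTE; apply: contra pd => h2.
have : (p%:Z %| 2 * d)%Z.
  have -> : 2 * d = (B + d - X) - (B - d - X) by ring.
  exact: rpredB.
by rewrite dvdM (negbTE p2).
Qed.

(** A single double zero, unless the form vanishes mod p and all p + 1 points are zeros. *)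
Lemma lift_count_ramified D x : bqdisc x = D -> (p%:Z %| D)%Z ->
  lift_count p (bqscale p%:Z x) = 1 + p%:R * (bqdvd p%:Z x)%:R.
Proof.
case: x => [[A B] C]; rewrite /bqdisc /bqdvd /= => hd pD; rewrite lift_count_scaled.
have [pA|pA] /= := boolP (p%:Z %| A)%Z.
  have pB : (p%:Z %| B)%Z.
    apply: dvdz_sqr_prime; have -> : B ^+ 2 = D + 4 * C * A by rewrite -hd; ring.
    by rewrite rpredD// dvdz_mull.
  rewrite pB /= (eq_bigr (fun=> ((p%:Z %| C)%Z : nat))); last first.
    move=> i _; congr nat_of_bool.
    have -> : C - (i : nat)%:Z * B + A * (i : nat)%:Z ^+ 2 = C + (A * (i : nat)%:Z ^+ 2 - (i : nat)%:Z * B) by ring.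
    by rewrite rpredDr// rpredB ?(dvdz_mulr _ pA) ?(dvdz_mull _ pB).
  by rewrite sum_nat_const card_ord natrD natrM addrC.
have pA2 : ~~ (p%:Z %| 2 * A)%Z by rewrite dvdM negb_or p2.
rewrite addn0 mulr0 addr0.
suff -> : (\sum_(i < p) (p%:Z %| (C - (i : nat)%:Z * B + A * (i : nat)%:Z ^+ 2)%R)%Z = 1)%N by [].
rewrite -[RHS](sum_linear_congruence pp B pA2); apply: eq_bigr => i _; congr nat_of_bool.
rewrite dvdz_disc_quad// hd rpredBr// expr2 dvdM orbb//.
Qed.

(** In [mass_double_count] each class counts once and each multiple of p once more; the multiples of
    p add up to the sum for D. *)
Lemma mass_split D (d : int) : D < 0 -> ~~ (p%:Z %| d)%Z -> (p%:Z %| D - d ^+ 2)%Z ->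
  mass (p%:Z ^+ 2 * D) = p%:R * mass D.
Proof.
move=> D0 pd hD; have pz : 0 < p%:Z :> int by rewrite ltz_nat.
have D0' : p%:Z ^+ 2 * D < 0 by rewrite pmulr_rlt0// exprn_gt0.
rewrite !mass_clseq//; have := mass_double_count pp D0.
have -> : \sum_(C <- clseq (p%:Z ^+ 2 * D)) lift_count p (bqrep C) * wt C =
    \sum_(C <- clseq (p%:Z ^+ 2 * D)) wt C + \sum_(C <- clseq D) wt C.
  rewrite -[X in _ = _ + X](sum_scaled_classes D0 pz) [X in _ = _ + X]big_mkcond -big_split/=.
  apply: eq_big_seq => C /(mem_clseq _ D0').1 /bqrepP[pC dC _].
  have [/bqdvdP[y hy]|nd] := boolP (bqdvd _ _).
    rewrite {1}hy (lift_count_split _ pd hD); first by ring.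
    apply: (@mulfI _ (p%:Z ^+ 2)); first by rewrite expf_neq0.
    by rewrite -bqdisc_scale -hy.
  by rewrite (lift_count_primitive dC nd) mul1r addr0.
by rewrite -natr1; lra.
Qed.

(** Here the classes that count more than once are the multiples of p^2, each p more times; they
    come from discriminant D. *)
Lemma mass_ramified D : D < 0 ->
  mass (p%:Z ^+ 2 * (p%:Z ^+ 2 * D)) = p.+1%:R * mass (p%:Z ^+ 2 * D) - p%:R * mass D.
Proof.
move=> D0; have pz : 0 < p%:Z :> int by rewrite ltz_nat.
have D0' : p%:Z ^+ 2 * D < 0 by rewrite pmulr_rlt0// exprn_gt0.
have D0'' : p%:Z ^+ 2 * (p%:Z ^+ 2 * D) < 0 by rewrite pmulr_rlt0// exprn_gt0.
rewrite !mass_clseq//; have := mass_double_count pp D0'.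
have -> : \sum_(C <- clseq (p%:Z ^+ 2 * (p%:Z ^+ 2 * D))) lift_count p (bqrep C) * wt C =
    \sum_(C <- clseq (p%:Z ^+ 2 * (p%:Z ^+ 2 * D))) wt C + p%:R * \sum_(C <- clseq D) wt C.
  have e : p%:Z ^+ 2 * (p%:Z ^+ 2 * D) = (p%:Z ^+ 2) ^+ 2 * D by ring.
  have ps : 0 < p%:Z ^+ 2 :> int by rewrite exprn_gt0.
  rewrite -[X in _ = _ + _ * X](sum_scaled_classes D0 ps) -e big_distrr/=.
  rewrite [X in _ = _ + X]big_mkcond -big_split/=.
  apply: eq_big_seq => C /(mem_clseq _ D0'').1 /bqrepP[pC dC _].
  have [/bqdvdP[y hy]|nd] := boolP (bqdvd p%:Z (bqrep C)).
    have dy : bqdisc y = p%:Z ^+ 2 * D.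
      apply: (@mulfI _ (p%:Z ^+ 2)); first by rewrite expf_neq0.
      by rewrite -bqdisc_scale -hy.
    rewrite {1}hy (lift_count_ramified dy); last by rewrite expr2 -mulrA dvdz_mulr.
    have -> : bqdvd (p%:Z ^+ 2) (bqrep C) = bqdvd p%:Z y.
      by rewrite hy /bqdvd /bqscale /= !dvdz_pscale.
    by case: bqdvd => /=; rewrite ?mulr1n ?mulr0n; ring.
  rewrite (lift_count_primitive dC nd) ifN; first by ring.
  by apply: contra nd => /and3P[h1 h2 h3]; apply/and3P; split; exact: dvdz_p2W.
by lra.
Qed.

Lemma mass_p2 D (d : int) a : D < 0 -> ~~ (p%:Z %| d)%Z -> (p%:Z %| D - d ^+ 2)%Z ->
  mass (p%:Z ^+ 2 * (p%:Z ^+ (2 * a) * D)) = p%:R * mass (p%:Z ^+ (2 * a) * D).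
Proof.
move=> D0 pd hD; elim: a => [|a IH]; first by rewrite muln0 expr0 mul1r; exact: mass_split hD.
have Da : p%:Z ^+ (2 * a) * D < 0 by rewrite pmulr_rlt0// exprn_gt0// ltz_nat.
have -> : p%:Z ^+ (2 * a.+1) * D = p%:Z ^+ 2 * (p%:Z ^+ (2 * a) * D).
  by rewrite mulnS exprD mulrA.
by rewrite mass_ramified// IH -natr1; ring.
Qed.

End OddPrime.
End Forms.

(** * q-expansion of the bracket *)

(** A finite window for sums over all integers: it contains every t with t^2 <= n. *)
Definition zball (n : nat) : seq int := [seq i%:Z - n%:Z | i <- iota 0 n.*2.+1].

Lemma mem_zball n (t : int) : (t \in zball n) = (`|t| <= n%:Z).
Proof.
apply/mapP/idP => [|h].
  by case=> i; rewrite mem_iota => hi ->; lia.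
by exists (absz (t + n%:Z)); [rewrite mem_iota|]; lia.
Qed.

Lemma zball_uniq n : uniq (zball n).
Proof. by rewrite map_inj_uniq ?iota_uniq// => i j /eqP; rewrite (inj_eq (addIr _)) => /eqP[]. Qed.

Lemma size_zball n : size (zball n) = n.*2.+1.
Proof. by rewrite size_map size_iota. Qed.

Lemma zball_fsbig (A : nmodType) (n : nat) (P : pred int) (f : int -> A) :
  (forall t, P t -> n%:Z < `|t| -> f t = 0) ->
  \sum_(t <- zball n | P t) f t = \sum_(t \in [set t | P t]) f t.
Proof.
move=> h; rewrite big_mkcond/= fsbig_seq ?zball_uniq//.
rewrite (fsbig_widen _ setT)//.
  rewrite [in RHS]fsbig_mkcond; apply: eq_fsbigr => t _.
  rewrite /patch; have -> : (t \in [set t | P t]) = P t by apply/idP/idP => [/set_mem|/mem_set].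
  by [].
move=> t [_ ht] /=; case: ifP => // /h; apply.
by rewrite ltNge -mem_zball; apply/negP.
Qed.

Lemma zball_window (A : nmodType) (n n' : nat) (P : pred int) (f : int -> A) :
  (forall t, P t -> `|t| <= n%:Z) -> (forall t, P t -> `|t| <= n'%:Z) ->
  \sum_(t <- zball n | P t) f t = \sum_(t <- zball n' | P t) f t.
Proof.
move=> h h'; rewrite !zball_fsbig// => t Pt; rewrite ltNge.
  by rewrite h'.
by rewrite h.
Qed.

Lemma hurwitz0 : hurwitz 0 = - (12%:R)^-1.
Proof. by rewrite /hurwitz eqxx. Qed.

Lemma hurwitz_neg (x : rat) : x < 0 -> hurwitz x = 0.
Proof. by move=> x0; rewrite /hurwitz lt_eqF// ltNge (ltW x0)/= andbF. Qed.

Lemma hurwitz_nonint (x : rat) : x \isn't a Num.int -> hurwitz x = 0.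
Proof.
move=> xi; rewrite /hurwitz (negbTE xi); case: eqP => // x0.
by rewrite x0 rpred0 in xi.
Qed.

Lemma hurwitz_bounds (n : nat) : `|hurwitz n%:R| <= ((n.+1).*2 ^ 3)%:R.
Proof.
case: n => [|n].
  apply: (@le_trans _ _ (8%:R : rat)); last by rewrite ler_nat.
  by rewrite hurwitz0 normrN ger0_norm; [lra|rewrite invr_ge0].
rewrite hurwitz_nat_pos//; have := @mass_bounds (- n.+1%:Z); rewrite oppr_lt0 ltz_nat => /(_ isT).
move=> /andP[h1 h2]; rewrite ger0_norm//; apply: le_trans h2 _.
by rewrite ler_nat leq_exp2r// abszN absz_nat; lia.
Qed.

Lemma sum_spread_powers (A : pzSemiRingType) (c : nat -> A) (z : A) b n : (0 < b)%N ->
  \sum_(0 <= N < b * n) (if (b %| N)%N then c (N %/ b)%N else 0) * z ^+ N =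
  \sum_(0 <= i < n) c i * z ^+ (b * i).
Proof.
move=> b0; elim: n => [|n IH]; first by rewrite muln0 !big_geq.
rewrite big_nat_recr//= -IH mulnS addnC.
rewrite (big_cat_nat (leq0n _) (leq_addr b (b * n)%N))/=; congr (_ + _).
rewrite big_ltn; last by rewrite -[ltnLHS]addn0 ltn_add2l.
rewrite dvdn_mulr// mulKn// big_nat big1 ?addr0// => i /andP[h1 h2].
rewrite ifN ?mul0r//; apply/negP => /dvdnP[k hk].
move: h1 h2; rewrite hk [(k * b)%N]mulnC ltn_pmul2l// addnC -mulnS ltn_pmul2l// => h1.
by rewrite ltnS leqNgt h1.
Qed.

Section GeneratingFunctions.
Variable R : realType.
Local Notation C := (cplx R).
Local Notation toC := (@toC R).
Local Notation twoipi := (twoipi R).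
Local Notation nrm := (@ComplexField.Normc.normc R).

Lemma nrm_ratr (x : rat) : nrm (ratr x) = ratr `|x|.
Proof.
have -> : ratr x = toC (ratr x) by rewrite /ratr toCM toCV !toC_int.
by rewrite nrm_toC ratr_norm.
Qed.

Lemma nrm_int (x : int) : nrm x%:~R = `|x|%:~R.
Proof. by rewrite -toC_int nrm_toC intr_norm. Qed.

Lemma subexp_nrm_hurwitz :
  subexp (fun n => nrm (ratr (hurwitz n%:R)) : R).
Proof.
apply: subexp_le (subexp_poly 8 3) => n; rewrite nrm_ratr.
have h := hurwitz_bounds n.
rewrite (@ger0_norm R) ?ler0q// (@ger0_norm R) ?mulr_ge0//.
have -> : 8 * n.+1%:R ^+ 3 = ratr ((n.+1).*2 ^ 3)%:R :> R.
  by rewrite ratr_nat -muln2 expnMn natrM mulrC !natrX; congr (_ * _); ring.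
by rewrite ler_rat.
Qed.

Lemma cvg_subsequence (u v : nat -> C) (g : nat -> nat) (l : C) :
  (forall n, n <= g n)%N -> (forall n, v n = u (g n)) ->
  u @ \oo --> l -> v @ \oo --> l.
Proof.
move=> hg hv ul; have -> : v = u \o g by apply/funext => n; rewrite hv.
apply: cvg_comp ul => P [N _ NP]; exists N => // n /= Nn; apply: NP => /=.
exact: leq_trans Nn (hg n).
Qed.

(** The partial sums of F(b tau) are the partial sums in q taken at multiples of b, a subsequence of
    a sequence known to converge. *)
Lemma qexp_V b (c : nat -> C) : (0 < b)%N -> subexp (fun n => nrm (c n)) ->
  qexp (Vop b (fun tau => limn (series (fun n => c n * nome tau ^+ n))))
    (fun N => if (b %| N)%N then c (N %/ b)%N else 0).
Proof.
move=> b0 hc; set c' := (fun N : nat => if _ then _ else _).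
have hc' : subexp (fun N => nrm (c' N)).
  move=> s s0; have [K hK] := hc s s0; exists K => N.
  have K0 : 0 <= K.
    by have := le_trans (normr_ge0 _) (hK 0%N); rewrite mulr0 expR0 mulr1.
  rewrite /c'; case: ifP => _; last by rewrite nrm0 normr0 mulr_ge0// expR_ge0.
  apply: le_trans (hK _) _; rewrite ler_wpM2l// ler_expR ler_pM2l// ler_nat.
  exact: leq_div.
split; [exact: hc'|move=> tau t0]; have h := qseries_cvg hc' t0.
suff e : limn (series (fun n => c n * nome (b%:R * tau) ^+ n)) =
    limn (series (fun N => c' N * nome tau ^+ N)) by rewrite /Vop e; exact: h.
apply: cvg_lim; first exact: norm_hausdorff.
apply: (@cvg_subsequence _ _ (fun n => (b * n)%N)) h => [n|n]; first by rewrite leq_pmull.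
rewrite /series/= sum_spread_powers//; apply: eq_bigr => i _.
by rewrite nomeMn exprM.
Qed.

End GeneratingFunctions.

Lemma big_zball (A : nmodType) N (P : pred int) (f : int -> A) :
  \sum_(t <- zball N | P t) f t =
  \sum_(i < N.*2.+1 | P ((i : nat)%:Z - N%:Z)) f ((i : nat)%:Z - N%:Z).
Proof. by rewrite big_map -(big_mkord (fun i => P (i%:Z - N%:Z)) (fun i => f (i%:Z - N%:Z))) /index_iota subn0. Qed.

(** * Expansions of H|V_b, theta and Lambda *)

Section Expansions.
Variable R : realType.
Local Notation C := (cplx R).
Local Notation toC := (@toC R).
Local Notation twoipi := (twoipi R).
Local Notation nrm := (@ComplexField.Normc.normc R).

Lemma hurwitz_spread b n : (0 < b)%N ->
  (if (b %| n)%N then hurwitz (n %/ b)%N%:R else 0) = hurwitz (n%:R / b%:R).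
Proof.
move=> b0; have bq : b%:R != 0 :> rat by rewrite pnatr_eq0 -lt0n.
case: ifPn => [/dvdnP[k ->]|nd]; first by rewrite mulnK// natrM mulfK.
symmetry; apply: hurwitz_nonint; apply: contra nd => /intrP[z hz].
have hn : n%:Z = z * b%:Z.
  by apply: (@intr_inj rat); rewrite rmorphM/= -hz divfK.
apply/dvdnP; exists (absz z); lia.
Qed.

Lemma qexp_hurwitz b : (0 < b)%N ->
  qexp (Vop b (@hurwitz_gf R)) (fun n => ratr (hurwitz (n%:R / b%:R))).
Proof.
move=> b0; apply: (qexp_ext _ _ (qexp_V b0 (@subexp_nrm_hurwitz R))) => // n.
by rewrite -hurwitz_spread//; case: ifP => // _; rewrite rmorph0.
Qed.

Definition theta_coef (j : nat) (m : int) (M n : nat) : C :=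
  \sum_(t <- zball n | (t == m %[mod M%:Z])%Z && (t ^+ 2 == n%:Z)) t%:~R ^+ j.

Lemma nrm_bigsum_le (I : eqType) (s : seq I) (P : pred I) (F : I -> C) (B : R) : 0 <= B ->
  (forall x, x \in s -> P x -> nrm (F x) <= B) ->
  nrm (\sum_(x <- s | P x) F x) <= (size s)%:R * B.
Proof.
move=> B0 h; apply: le_trans (nrm_sum _ _ _) _.
rewrite big_mkcond/= (@le_trans _ _ (\sum_(x <- s) B))//.
  by rewrite big_seq [leRHS]big_seq; apply: ler_sum => x xs; case: ifP => // /(h _ xs).
by rewrite big_const_seq iter_addr_0 count_predT mulr_natl.
Qed.

Lemma subexp_theta j m M : subexp (fun n => nrm (theta_coef j m M n)).
Proof.
apply: subexp_le (subexp_poly 2 j.+1) => n; rewrite ger0_norm ?nrm_ge0//.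
apply: le_trans (ler_norm _).
apply: (@le_trans _ _ ((size (zball n))%:R * n.+1%:R ^+ j)).
  apply: nrm_bigsum_le => [|t]; first by rewrite exprn_ge0.
  rewrite mem_zball => tn _; rewrite nrmX nrm_int lerXn2r ?nnegrE ?ler0z//.
  by rewrite -[_.+1%:R]/(_.+1%:Z%:~R) ler_int; lia.
rewrite size_zball exprS mulrA ler_wpM2r ?exprn_ge0//.
by rewrite -natrM ler_nat; lia.
Qed.

Lemma qexp_theta j m M : qexp (@theta R j m M) (theta_coef j m M).
Proof.
have hs := subexp_theta j m M.
split; [exact: hs|move=> tau t0]; have h := qseries_cvg hs t0.
suff e : theta j m M tau = limn (series (fun n => theta_coef j m M n * nome tau ^+ n)).
  by rewrite e; exact: h.
rewrite /theta; apply: cvg_lim; first exact: norm_hausdorff.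
(* The sum over |t| <= N is the partial sum over exponents up to N^2, which has N^2 + 1 terms. *)
apply: (@cvg_subsequence _ _ _ (fun N => (N ^ 2).+1)) h => [N|N]; first by nia.
rewrite -(big_zball _ (fun t => (t == m %[mod M%:Z])%Z) (fun t => t%:~R ^+ j * nome tau ^+ (absz t ^ 2))).
move: (nome tau) => q; rewrite /series/=; symmetry.
transitivity (\sum_(0 <= n < (N ^ 2).+1) \sum_(t <- zball N | (t == m %[mod M%:Z])%Z)
    (if t ^+ 2 == n%:Z then t%:~R ^+ j * q ^+ n else 0)).
  apply: eq_big_nat => n /andP[_ nN]; rewrite -big_mkcondr/= /theta_coef.
  rewrite (@zball_window _ n N); first by rewrite big_distrl.
  - by move=> t /andP[_ /eqP ht]; nia.
  - by move=> t /andP[_ /eqP ht]; nia.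
rewrite exchange_big/= big_seq_cond [RHS]big_seq_cond; apply: eq_bigr => t /andP[].
rewrite mem_zball => tN _; rewrite -big_mkcond/=.
have t2 : t ^+ 2 = (absz t ^ 2)%N%:Z by rewrite -mulnn PoszM !abszE -normrM -expr2 ger0_norm ?sqr_ge0.
rewrite (eq_bigl (fun n => n == (absz t ^ 2)%N)); last first.
  by move=> n; rewrite t2 eqz_nat eq_sym.
rewrite big_nat1_eq ifT//=; nia.
Qed.

Definition sbox (n : nat) : seq (nat * nat) := [seq (t, s) | t <- iota 0 n.+1, s <- iota 0 n.+1].

Lemma mem_sbox n t s : ((t, s) \in sbox n) = (t <= n)%N && (s <= n)%N.
Proof.
apply/allpairsP/andP => [[[t' s']]|[tn sn]].
  by rewrite !mem_iota => -[h1 h2 [-> ->]]; split; move: h1 h2 => /=; lia.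
by exists (t, s); rewrite !mem_iota; split=> //=; lia.
Qed.

Lemma sbox_uniq n : uniq (sbox n).
Proof. by apply: allpairs_uniq; rewrite ?iota_uniq// => -[? ?] -[? ?]. Qed.

Lemma size_sbox n : size (sbox n) = (n.+1 ^ 2)%N.
Proof. by rewrite size_allpairs size_iota mulnn. Qed.

Lemma seq_fsbig (T : choiceType) (A : nmodType) (s : seq T) (P : pred T) (S : set T) (f : T -> A) :
  uniq s -> (forall x, S x <-> P x) -> (forall x, P x -> x \in s) ->
  \sum_(x \in S) f x = \sum_(x <- s | P x) f x.
Proof.
move=> us SP Ps; rewrite -[RHS]big_filter [RHS]fsbig_seq ?filter_uniq//.
have -> // : S = [set` [seq x <- s | P x]].
apply/seteqP; split=> x /=; rewrite mem_filter.
  by move=> /SP Px; rewrite Px Ps.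
by move=> /andP[/SP].
Qed.

Definition hyperbola (m : int) (M b n : nat) (e : int) : set (nat * nat) :=
  [set ts : nat * nat | (1 <= ts.1)%N /\
                    ts.1%:Z ^+ 2 - b%:Z * ts.2%:Z ^+ 2 = n%:Z /\
                    (ts.1%:Z = e * m %[mod M%:Z])%Z].

Definition lambda_term (l b : nat) (ts : nat * nat) : R :=
  (if ts.2 == 0%N then 2^-1 else 1 : R) * (ts.1%:R - Num.sqrt b%:R * ts.2%:R) ^+ l.+1.

Lemma sqrt_sqrn (beta : nat) : Num.sqrt (beta ^ 2)%:R = beta%:R :> R.
Proof. by rewrite natrX sqrtr_sqr ger0_norm. Qed.

(** With b = beta^2 the equation is (t - beta s)(t + beta s) = n in positive factors, so the
    solutions are finite in number. *)
Lemma hyperbola_bound beta n t s : (0 < beta)%N -> (0 < n)%N ->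
  t%:Z ^+ 2 - (beta ^ 2)%N%:Z * s%:Z ^+ 2 = n%:Z ->
  (beta * s < t)%N /\ (t + beta * s <= n)%N.
Proof.
move=> b0 n0 h.
have e : (t ^ 2 = (beta * s) ^ 2 + n)%N.
  by apply/eqP; rewrite -eqz_nat; apply/eqP; rewrite PoszD expnMn PoszM -!mulnn !PoszM; move: h; rewrite -mulnn PoszM; lia.
have lt : (beta * s < t)%N by rewrite -(ltn_exp2r _ _ (isT : 0 < 2)%N) e -[ltnLHS]addn0 ltn_add2l.
split=> //; move: (beta * s)%N e lt => u e lt.
have : ((t - u) * (t + u) = n)%N by rewrite -subn_sqr e addKn.
by move=> <-; rewrite leq_pmull// subn_gt0.
Qed.

Lemma hyperbola_sbox beta m M n e ts : (0 < beta)%N -> (0 < n)%N ->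
  hyperbola m M (beta ^ 2) n e ts -> ts \in sbox n.
Proof.
case: ts => t s b0 n0 [_ [/= h _]]; have [h1 h2] := hyperbola_bound b0 n0 h.
by rewrite mem_sbox; nia.
Qed.

Lemma lambda_inner_bound l beta m M n e : (0 < beta)%N -> (0 < n)%N ->
  `|\sum_(ts \in hyperbola m M (beta ^ 2) n e) lambda_term l (beta ^ 2) ts| <=
  n.+1%:R ^+ l.+3.
Proof.
move=> b0 n0.
rewrite (@seq_fsbig _ _ (sbox n) (fun ts => `[< hyperbola m M (beta ^ 2) n e ts >])) ?sbox_uniq//.
- apply: le_trans (ler_norm_sum _ _ _) _.
  apply: (@le_trans _ _ (\sum_(ts <- sbox n) n.+1%:R ^+ l.+1)).
    rewrite big_mkcond/=; apply: ler_sum => -[t s] _.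
    case: asboolP => [[_ [/= h _]]|_]; last by rewrite exprn_ge0.
    have [h1 h2] := hyperbola_bound b0 n0 h.
    rewrite /lambda_term sqrt_sqrn /= -natrM -natrB; last exact: ltnW.
    rewrite normrM -[leRHS]mul1r ler_pM//.
      by case: ifP => _; rewrite ger0_norm//; lra.
    rewrite ger0_norm ?exprn_ge0// lerXn2r ?nnegrE// ler_nat.
    by apply: leq_trans (leq_subr _ _) _; lia.
  rewrite big_const_seq iter_addr_0 count_predT size_sbox -[leLHS]mulr_natl natrX.
  by rewrite -exprD.
- by move=> ts; split=> /asboolP.
- by move=> ts /asboolP; exact: hyperbola_sbox.
Qed.

Definition lambda_inner (l : nat) (m : int) (M b n : nat) (e : int) : R :=
  \sum_(ts \in hyperbola m M b n e) lambda_term l b ts.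

Lemma lambdaE l m M b n : lambda R l m M b n =
  lambda_inner l m M b n 1 + (-1) ^+ l * lambda_inner l m M b n (-1).
Proof.
have -> : lambda R l m M b n =
    \sum_(e <- [:: 1; -1 : int]) e%:~R ^+ l * lambda_inner l m M b n e by [].
by rewrite !big_cons big_nil addr0 mulr1z expr1n mul1r mulrN1z.
Qed.

Lemma lambda_bound l beta m M n : (0 < beta)%N -> (0 < n)%N ->
  `|lambda R l m M (beta ^ 2) n| <= 2 * n.+1%:R ^+ l.+3.
Proof.
move=> b0 n0; rewrite lambdaE; apply: le_trans (ler_normD _ _) _.
rewrite normrM normrX normrN1 expr1n mul1r mulr_natl mulr2n.
by apply: lerD; exact: lambda_inner_bound.
Qed.

Definition Lambda_coef l m M b n : C := if n == 0%N then 0 else toC (lambda R l m M b n).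

Lemma qexp_Lambda l m M beta : (0 < beta)%N ->
  qexp (@Lambda R l m M (beta ^ 2)) (Lambda_coef l m M (beta ^ 2)).
Proof.
move=> b0; have hs : subexp (fun n => nrm (Lambda_coef l m M (beta ^ 2) n)).
  apply: subexp_le (subexp_poly 2 l.+3) => n; rewrite /Lambda_coef.
  case: eqP => [->|/eqP n0]; first by rewrite nrm0 normr0.
  rewrite nrm_toC normr_id; apply: le_trans (ler_norm _); apply: lambda_bound => //.
  by rewrite lt0n.
apply: (qexp_ext _ _ (qexp_lim hs)) => // tau _; rewrite /Lambda.
congr (limn (series _)); apply/funext => n; rewrite /Lambda_coef.
by case: eqP => // _; rewrite mul0r.
Qed.

End Expansions.

(** * Coefficients of the bracket and of [fform] *)

Section Coefficients.
Variable R : realType.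
Local Notation C := (cplx R).
Local Notation toC := (@toC R).
Local Notation twoipi := (twoipi R).
Local Notation nrm := (@ComplexField.Normc.normc R).

Definition hw (b n : nat) (t : int) : C := ratr (hurwitz ((n%:Z - t ^+ 2)%:~R / b%:R)).

(** The convolution is reindexed by t with t^2 = k: the j derivatives of theta give t^(2j), the i
    derivatives of H give (n - t^2)^i. The t in the window with t^2 > n contribute H of a negative
    number, which is 0. *)
Lemma convol_theta_hurwitz m M b n (i j : nat) : (0 < b)%N ->
  convol (fun n => (twoipi * n%:R) ^+ j * theta_coef R 1 m M n)
    (fun n => (twoipi * n%:R) ^+ i * ratr (hurwitz (n%:R / b%:R))) n =
  twoipi ^+ (j + i) * \sum_(t <- zball n | (t == m %[mod M%:Z])%Z)
     hw b n t * ((n%:R - t%:~R ^+ 2) ^+ i * t%:~R ^+ (2 * j).+1).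
Proof.
move=> b0; rewrite /convol.
have step (k : 'I_n.+1) : (twoipi * k%:R) ^+ j * theta_coef R 1 m M k *
    ((twoipi * (n - k)%:R) ^+ i * ratr (hurwitz ((n - k)%:R / b%:R))) =
  \sum_(t <- zball n | (t == m %[mod M%:Z])%Z) (if t ^+ 2 == k%:Z then
     twoipi ^+ (j + i) * (hw b n t * ((n%:R - t%:~R ^+ 2) ^+ i * t%:~R ^+ (2 * j).+1)) else 0).
  have kn : (k <= n)%N by rewrite -ltnS.
  rewrite -big_mkcondr /theta_coef (@zball_window _ k n).
  - rewrite big_distrr big_distrl/=; apply: eq_bigr => t /andP[_ /eqP tk].
    have tk' : t%:~R ^+ 2 = k%:R :> C by rewrite -rmorphXn/= tk.
    have -> : hw b n t = ratr (hurwitz ((n - k)%:R / b%:R)).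
      by rewrite /hw tk subzn.
    by rewrite [_ ^+ (2 * j).+1]exprS exprM tk' expr1 natrB// !(exprMn _ twoipi) (exprD twoipi); ring.
  - by move=> t /andP[_ /eqP ht]; nia.
  - by move=> t /andP[_ /eqP ht]; nia.
under eq_bigr do rewrite step.
rewrite exchange_big/= big_distrr/= big_seq_cond [RHS]big_seq_cond.
apply: eq_bigr => t /andP[_ _]; rewrite -big_mkcond/=.
have t2 : t ^+ 2 = (absz t ^ 2)%N%:Z by rewrite -mulnn PoszM !abszE -normrM -expr2 ger0_norm ?sqr_ge0.
rewrite t2; have [tn|nt] := ltnP (absz t ^ 2) n.+1.
  by rewrite (big_pred1 (Ordinal tn))// => k; rewrite /= eqz_nat eq_sym.
rewrite big_pred0; last by move=> k; rewrite eqz_nat gtn_eqF// (leq_trans (ltn_ord k)).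
rewrite /hw hurwitz_neg ?rmorph0 ?mul0r ?mulr0//.
by rewrite pmulr_llt0 ?invr_gt0 ?ltr0n// t2 ltrz0 subr_lt0 ltz_nat.
Qed.

Definition weight_sum (l : nat) (m : int) (M b n : nat) : C :=
  \sum_(t <- zball n | (t == m %[mod M%:Z])%Z) hw b n t * cheb t%:~R n%:R l.

(** By [gbinom_half_prod] the sum is, up to a constant, the odd part of (t + w)^(2k+2) with w^2 =
    t^2 - n; its terms with i > k vanish. *)
Lemma gbinom_cheb k (t n : C) :
  \sum_(0 <= i < k.+1) (-1) ^+ i * toC (gbinom (3 / 2 + k%:R - 1) (k - i))
     * toC (gbinom (3 / 2 + k%:R - 1) i) * ((n - t ^+ 2) ^+ i * t ^+ (2 * (k - i)).+1) =
  'C(k.*2.+1, k)%:R * cheb t n k.*2.+1.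
Proof.
have aE : 3 / 2 + k%:R - 1 = k%:R + 1 / 2 :> R by lra.
transitivity ('C(k.*2.+1, k)%:R / 2 ^+ k.*2.+1 * odd_part t (n - t ^+ 2) k.*2.+2); last first.
  rewrite -cheb_odd_part mulrA divfK// expf_neq0// pnatr_eq0//.
rewrite /odd_part big_distrr/= (@big_cat_nat _ _ _ k.+1 0 k.*2.+3)//=; last by lia.
rewrite [X in _ = _ + X]big_nat [X in _ = _ + X]big1 ?addr0; last first.
  move=> i /andP[ki _]; have -> : 'C(k.*2.+2, i.*2.+1) = 0%N by apply: bin_small; lia.
  by rewrite !mul0r mulr0.
apply: eq_big_nat => i /andP[_ ik]; rewrite aE.
have -> : (-1) ^+ i * toC (gbinom (k%:R + 1 / 2) (k - i)) * toC (gbinom (k%:R + 1 / 2) i)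
  = (-1) ^+ i * ('C(k.*2.+1, k)%:R / 2 ^+ k.*2.+1 * 'C(k.*2.+2, i.*2.+1)%:R).
  rewrite -mulrA -toCM gbinom_half_prod// 2!toCM toCV toCX !toC_nat.
  by [].
have -> : (2 * (k - i)).+1 = (k.*2.+2 - i.*2.+1)%N by lia.
by rewrite (exprNn (n - t ^+ 2)); ring.
Qed.

Definition gamma_formula (l : nat) (m : int) (M b n : nat) : C :=
  'C(l, l./2)%:R * weight_sum l m M b n +
  toC ((Num.sqrt b%:R)^-1 * 2 ^- l.+1 * 'C(l, l./2)%:R) * Lambda_coef R l m M b n.

Lemma qexp_rankin_cohen k m M b : (0 < b)%N ->
  qexp (rankin_cohen (3 / 2) (1 / 2 + 1%:R) k (Vop b (@hurwitz_gf R)) (theta 1 m M))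
    (fun n => 'C(k.*2.+1, k)%:R * weight_sum k.*2.+1 m M b n).
Proof.
move=> b0; have tw0 : twoipi != 0.
  by rewrite -nrm_eq0 nrm_twoipi gt_eqF// pi2_gt0.
have hH i := qexp_derive1n i (qexp_hurwitz R b0).
have hT i := qexp_derive1n i (qexp_theta R 1 m M).
pose a i : C := (-1) ^+ i * toC (gbinom (3 / 2 + k%:R - 1) (k - i))
     * toC (gbinom (1 / 2 + 1%:R + k%:R - 1) i).
have h := qexpZ (twoipi ^- k) (@qexp_sum R nat (index_iota 0 k.+1) xpredT _ _
  (fun i _ => qexpZ (a i) (qexpM (hT (k - i)%N) (hH i)))).
apply: qexp_ext h => [tau _|n].
  congr (_ * _); apply: eq_bigr => i _; rewrite /a -!mulrA; congr (_ * (_ * (_ * _))).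
  by rewrite mulrC.
rewrite /weight_sum; under eq_big_nat => i /andP[_ ik].
  rewrite convol_theta_hurwitz// subnK// mulrCA; over.
rewrite -big_distrr/= mulKf ?expf_neq0//.
under eq_bigr do rewrite big_distrr/=.
rewrite exchange_big/= big_distrr/=; apply: eq_bigr => t _.
rewrite [RHS]mulrCA -gbinom_cheb big_distrr/=; apply: eq_bigr => i _.
rewrite /a (_ : 1 / 2 + 1%:R + k%:R - 1 = 3 / 2 + k%:R - 1 :> R); first by ring.
by rewrite mulr1n; lra.
Qed.

Lemma qexp_fform l m M beta : odd l -> (0 < beta)%N ->
  qexp (@fform R l m M (beta ^ 2)) (gamma_formula l m M (beta ^ 2)).
Proof.
move=> ol b0; have b20 : (0 < beta ^ 2)%N by rewrite expn_gt0 b0.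
have lE : l = (l./2).*2.+1 by rewrite -{1}(odd_double_half l) ol.
have h1 := qexp_rankin_cohen l./2 m M b20.
rewrite -lE in h1.
have h2 := qexpZ (toC ((Num.sqrt (beta ^ 2)%:R)^-1 * 2 ^- l.+1 * 'C(l, l./2)%:R))
  (@qexp_Lambda R l m M beta b0).
by apply: qexp_ext (qexpD h1 h2) => // tau _; rewrite /fform ol.
Qed.

Lemma gammacoefE l m M beta : odd l -> (0 < beta)%N ->
  gammacoef R l m M (beta ^ 2) = gamma_formula l m M (beta ^ 2).
Proof.
(* The expansion [h] shows that the set from which [get] chooses is inhabited, and uniqueness
   identifies the choice. *)
move=> ol b0; have [_ h] := qexp_fform m M ol b0.
apply: (qexp_unique _ h) => tau t0.
have := @xgetPex _ point [set c : nat -> C | forall tau : C, 0 < complex.Im tau ->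
    series (fun n => c n * nome tau ^+ n) @ \oo --> fform l m M (beta ^ 2) tau]
    (ex_intro _ _ h).
exact.
Qed.

Lemma alphacoefE l m M beta n : odd l -> (0 < beta)%N -> (0 < n)%N ->
  alphacoef R l m M (beta ^ 2) n = weight_sum l m M (beta ^ 2) n +
   toC ((Num.sqrt (beta ^ 2)%:R)^-1 * 2 ^- l.+1 * lambda R l m M (beta ^ 2) n).
Proof.
move=> ol b0 n0; rewrite /alphacoef gammacoefE// /gamma_formula.
have c0 : 'C(l, l./2)%:R != 0 :> C by rewrite pnatr_eq0 -lt0n bin_gt0 leq_half_double -addnn leqW// leq_addr.
rewrite /Lambda_coef gtn_eqF// mulrDr mulKf//; congr (_ + _).
rewrite !toCM toC_nat; move: (toC _^-1) (toC (_^-1)) (toC (lambda _ _ _ _ _ _)) => x y z.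
by rewrite mulrA [_^-1 * _]mulrC mulfK.
Qed.

End Coefficients.

(** * Jacobi symbols and the correction term *)

Section Symbols.
Variable p : nat.
Hypotheses (pp : prime p) (p2 : (2 < p)%N).

Lemma Fp_int_eq (x y : int) : (x = y %[mod p%:Z])%Z <-> x%:~R = y%:~R :> 'F_p.
Proof.
have h (z : int) : (z%:~R == 0 :> 'F_p) = (p%:Z %| z)%Z.
  rewrite dvdzE; case: z => n; rewrite ?NegzE ?abszN ?rmorphN ?oppr_eq0/=.
    by rewrite (dvdn_pcharf (pchar_Fp pp)).
  by rewrite (dvdn_pcharf (pchar_Fp pp)).
split=> [/eqP|/eqP].
  by rewrite eqz_mod_dvd -h rmorphB /= subr_eq0 => /eqP.
by rewrite -subr_eq0 -rmorphB/= h -eqz_mod_dvd => /eqP.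
Qed.

Lemma Fp_int_surj (y : 'F_p) : exists x : int, x%:~R = y.
Proof. by exists (y : nat)%:Z; rewrite -[RHS]natr_Zp. Qed.

Lemma legendre_pm (a : int) : ~~ (p%:Z %| a)%Z ->
  legendre a p = if `[< exists y : 'F_p, y ^+ 2 = a%:~R >] then 1 else -1.
Proof.
move=> pa; rewrite /legendre (negbTE pa).
congr (if _ then _ else _); apply/asboolP/asboolP => -[x hx].
  by exists x%:~R; rewrite -rmorphXn/=; apply/Fp_int_eq.
have [z hz] := Fp_int_surj x; exists z; apply/Fp_int_eq.
by rewrite rmorphXn/= hz.
Qed.

Lemma Fp_fermat (x : 'F_p) : x ^+ p = x.
Proof. by have := expf_card x; rewrite card_Fp. Qed.

Lemma Fp_generator : exists g : 'F_p, p.-1.-primitive_root g.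
Proof.
have pn : (0 < p.-1)%N by lia.
have : has p.-1.-primitive_root [seq x <- enum 'F_p | x != 0].
  apply: has_prim_root => //.
  - apply/allP => x; rewrite mem_filter => /andP[x0 _].
    rewrite unity_rootE -(inj_eq (mulfI x0)) mulr1 -exprS prednK ?prime_gt0//.
    by rewrite Fp_fermat.
  - by rewrite filter_uniq// enum_uniq.
  - rewrite size_filter; have := count_predC (pred1 (0 : 'F_p)) (enum 'F_p).
    rewrite (count_uniq_mem _ (enum_uniq _)) mem_enum -cardE card_Fp// => h.
    rewrite -(leq_add2l (0 \in 'F_p)) [X in (_ <= X)%N]h.
    by rewrite add1n prednK// prime_gt0.
by case/hasP => g _ hg; exists g.
Qed.

Lemma Fp_two_neq0 : (2 : 'F_p) != 0.
Proof. by rewrite -(dvdn_pcharf (pchar_Fp pp)); apply/negP => /dvdn_leq; lia. Qed.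

(** Here p %/ 4 is (p - 1)/4; the square of this power of a generator squares to 1 and is not 1. *)
Lemma Fp_sqrtN1 : (p %% 4 = 1)%N -> exists g : 'F_p,
  p.-1.-primitive_root g /\ (g ^+ (p %/ 4)) ^+ 2 = -1.
Proof.
move=> p4; have [g hg] := Fp_generator; exists g; split=> //.
have h1 : (g ^+ (p %/ 4 * 2)) ^+ 2 = 1.
  by rewrite -exprM; apply/eqP; rewrite -(prim_order_dvd hg); apply/dvdnP; exists 1%N; lia.
rewrite -exprM; move/eqP: h1; rewrite sqrf_eq1 => /orP[|/eqP//].
by rewrite -(prim_order_dvd hg) => /dvdn_leq; lia.
Qed.

Lemma legendreN1 : legendre (-1) p = if (p %% 4 == 1)%N then 1 else -1.
Proof.
rewrite legendre_pm; last by rewrite dvdzE/= dvdn1; lia.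
congr (if _ then _ else _); apply/asboolP/idP => [[y hy]|/eqP p4].
  have y0 : y != 0.
    by apply/eqP => y0; move: hy; rewrite y0 expr0n/= => /esym/eqP; rewrite mulrN1z oppr_eq0 oner_eq0.
  have h : y ^+ p.-1 = 1.
    by apply: (mulfI y0); rewrite mulr1 -exprS prednK ?prime_gt0// Fp_fermat.
  have po : odd p by case/even_prime: pp => // p22; lia.
  (* For p = 3 mod 4 the number (p - 1)/2 is odd, so y^2 = -1 would give y^(p-1) = -1. *)
  apply/negPn/negP => p4; have pE : (p.-1 = 2 * (p %/ 4).*2.+1)%N by lia.
  move: h; rewrite pE exprM hy mulrN1z exprS -muln2 mulnC exprM sqrrN !expr1n mulr1 => /eqP.
  by rewrite eq_sym -subr_eq0 opprK (_ : 1 + 1 = 2)// (negbTE Fp_two_neq0).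
have [g [_ hg]] := Fp_sqrtN1 p4; exists (g ^+ (p %/ 4)).
by rewrite hg mulrN1z.
Qed.

(** With i^2 = -1 one has 2 = ((1 + i) i)^2 i, so 2 is a square exactly when i is. As i =
    g^((p-1)/4) for a generator g, this means that (p - 1)/4 is even. *)
Lemma legendre2 : (p %% 4 = 1)%N -> legendre 2 p = if (p %% 8 == 1)%N then 1 else -1.
Proof.
move=> p4; rewrite legendre_pm; last first.
  by rewrite dvdzE/=; apply/negP => /dvdn_leq; lia.
have [g [hg hi]] := Fp_sqrtN1 p4; set i := g ^+ (p %/ 4) in hi.
have i0 : i != 0.
  by apply/eqP => i0; move: hi; rewrite i0 expr0n/= => /esym/eqP; rewrite oppr_eq0 oner_eq0.
have i1 : 1 + i != 0.
  apply/eqP => i1; have {}i1 : i = -1 by apply/eqP; rewrite -subr_eq0 opprK addrC i1.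
  move: hi; rewrite i1 sqrrN expr1n => /eqP.
  by rewrite -subr_eq0 opprK (_ : 1 + 1 = 2)// (negbTE Fp_two_neq0).
have key : (2 : 'F_p) = ((1 + i) * i) ^+ 2 * i.
  transitivity (i ^+ 2 * ((1 + i ^+ 2) * i + 2 * i ^+ 2)); last by ring.
  by rewrite hi; ring.
congr (if _ then _ else _); apply/asboolP/idP => [[y hy]|/eqP p8].
  have y0 : y != 0.
    by apply/eqP => y0; move: hy; rewrite y0 expr0n/= => /esym/eqP; rewrite (negbTE Fp_two_neq0).
  set z := y / ((1 + i) * i).
  have hz : z ^+ 2 = i.
    by rewrite expr_div_n hy -[2%:~R]/(2 : 'F_p) {1}key mulrAC divff ?mul1r// expf_neq0// mulf_neq0.
  have z1 : z ^+ p.-1 = 1.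
    have z0 : z != 0 by rewrite mulf_neq0 ?invr_eq0 ?mulf_neq0.
    by apply: (mulfI z0); rewrite mulr1 -exprS prednK ?prime_gt0// Fp_fermat.
  have [j zj] := prim_rootP hg z1.
  have : g ^+ (2 * j) == g ^+ (p %/ 4) by rewrite mulnC exprM -zj hz.
  rewrite (eq_prim_root_expr hg) => /eqP h.
  have : (2 * j = p %/ 4 %[mod 2])%N.
    have d2 : (2 %| p.-1)%N by apply/dvdnP; exists (p %/ 4 * 2)%N; lia.
    by rewrite -(modn_dvdm _ d2) h (modn_dvdm _ d2).
  lia.
exists ((1 + i) * i * g ^+ (p %/ 8)).
rewrite exprMn -exprM -[2%:~R]/(2 : 'F_p) [RHS]key; congr (_ * _).
by rewrite /i; congr (g ^+ _); lia.
Qed.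

Lemma jacobi_prime_power (a : int) j : jacobi a (p ^ j) = legendre a p ^+ j.
Proof.
case: j => [|j]; first by rewrite /jacobi expn0 big_nil.
by rewrite /jacobi primesX// primes_prime// big_seq1 lognX logn_prime// eqxx muln1.
Qed.

Lemma jacobiN1_prime_power j :
  jacobi (-1) (p ^ j) = if (p ^ j %% 4 == 1)%N then 1 else -1.
Proof.
rewrite jacobi_prime_power legendreN1.
have po : odd p by case/even_prime: pp => // p22; lia.
have [p1|p3] : (p %% 4 = 1)%N \/ (p %% 4 = 3)%N by lia.
  by rewrite p1 eqxx expr1n -modnXm p1 exp1n.
rewrite p3 /= -signr_odd -modnXm p3.
have -> : (3 ^ j %% 4 = if odd j then 3 else 1)%N.
  elim: j => // j IH; rewrite expnS -modnMmr IH /=; by case: odd.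
by case: odd.
Qed.

(** For even r the symbol is a square and p^r = 1 mod 8; for odd r one has p^r = p mod 8, so p = 1
    mod 4 and [legendre2] applies. *)
Lemma jacobi2_prime_power r : (p ^ r %% 4 = 1)%N ->
  jacobi 2 (p ^ r) = if (p ^ r %% 8 == 1)%N then 1 else -1.
Proof.
rewrite jacobi_prime_power => h.
have po : odd p by case/even_prime: pp => // p22; lia.
have sq : (p ^ 2 %% 8 = 1)%N.
  have : (p %% 8 = 1 \/ p %% 8 = 3 \/ p %% 8 = 5 \/ p %% 8 = 7)%N by lia.
  by rewrite -modnXm => -[->|[->|[->|->]]].
have hr : (p ^ r %% 8 = if odd r then p %% 8 else 1)%N.
  rewrite -{1}(odd_double_half r) expnD -mul2n expnM -modnMmr -modnXm sq exp1n.
  by case: odd; rewrite ?expn1 ?expn0 muln1.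
have lsq : legendre 2 p ^+ 2 = 1.
  rewrite legendre_pm; first by case: ifP => _; rewrite ?sqrrN expr1n.
  by rewrite dvdzE/=; apply/negP => /dvdn_leq; lia.
have -> : legendre 2 p ^+ r = legendre 2 p ^+ odd r.
  by rewrite -{1}(odd_double_half r) exprD -mul2n exprM lsq expr1n mulr1.
rewrite hr; case: (boolP (odd r)) => or /=; last by rewrite expr0.
rewrite or in hr; rewrite expr1 legendre2//.
lia.
Qed.

End Symbols.

Lemma jacobiN1_1 : jacobi (-1) 1 = 1.
Proof. by rewrite /jacobi big_nil. Qed.

Lemma jacobiN1_3 : jacobi (-1) 3 = -1.
Proof. exact: (@jacobiN1_prime_power 3 isT isT 1). Qed.

Lemma eqz_mod4_scale (p : nat) (m pbar t e : int) : (p%:Z * pbar = 1 %[mod 4])%Z ->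
  (p%:Z * t = e * m %[mod 4])%Z <-> (t = e * (m * pbar) %[mod 4])%Z.
Proof.
move=> hp; have e1 : (4 %| p%:Z * pbar - 1)%Z by rewrite -eqz_mod_dvd; apply/eqP.
split=> /eqP; rewrite eqz_mod_dvd => h; apply/eqP; rewrite eqz_mod_dvd.
  have -> : t - e * (m * pbar) = pbar * (p%:Z * t - e * m) - t * (p%:Z * pbar - 1) by ring.
  by rewrite rpredB// dvdz_mull.
have -> : p%:Z * t - e * m = p%:Z * (t - e * (m * pbar)) + e * m * (p%:Z * pbar - 1) by ring.
by rewrite rpredD// dvdz_mull.
Qed.

(** * The correction terms at p^r and p^(r-2) *)

Section LambdaDifference.
Variable R : realType.
Variables (l p beta r : nat) (m pbar : int).
Hypotheses (pp : prime p) (p2 : (2 < p)%N) (hbeta : beta = 1%N \/ beta = 2%N)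
  (hr : (0 < r)%N) (hpr : (p ^ r %% 4 = 1)%N) (hpbar : (p%:Z * pbar = 1 %[mod 4])%Z).

Let p0 : (0 < p)%N. Proof. exact: prime_gt0. Qed.
Let b0 : (0 < beta)%N. Proof. by case: hbeta => ->. Qed.
Let pr0 : (0 < p ^ r)%N. Proof. by rewrite expn_gt0 p0. Qed.
Let pr1 : (1 < p ^ r)%N.
Proof. by rewrite -(expn0 p) ltn_exp2l// prime_gt1. Qed.

(** (t0, s0) solves t - beta s = 1, t + beta s = p^r. For beta = 2, s0 is exact because p^r = 1 mod
    4. *)
Let t0 : nat := (p ^ r).+1./2.
Let s0 : nat := ((p ^ r)./2 %/ beta)%N.

Let betas0 : (beta * s0 = (p ^ r)./2)%N.
Proof. by rewrite /s0; case: hbeta => ->; lia. Qed.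

Let hyperbolaE e ts : hyperbola m 4 (beta ^ 2) (p ^ r) e ts <->
  [/\ (0 < ts.1)%N, (ts.1 ^ 2 = (beta * ts.2) ^ 2 + p ^ r)%N &
   (ts.1%:Z = e * m %[mod 4])%Z].
Proof.
rewrite /hyperbola /=; split=> [[h1 [h2 h3]]|[h1 h2 h3]]; split=> //.
  apply/eqP; rewrite -eqz_nat; apply/eqP; move: h2.
  by rewrite PoszD expnMn PoszM -!mulnn !PoszM; lia.
split=> //; move/(congr1 Posz): h2.
by rewrite PoszD expnMn PoszM -!mulnn !PoszM; lia.
Qed.

(** Both factors t - u and t + u are powers of p. If the smaller one is not 1, p divides both, hence
    2t. *)
Let coprime_solution t s : (t ^ 2 = (beta * s) ^ 2 + p ^ r)%N -> ~~ (p %| t)%N ->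
  (t = t0 /\ s = s0).
Proof.
move=> h pt; set u := (beta * s)%N in h.
have ut : (u < t)%N.
  by rewrite -(ltn_exp2r _ _ (isT : 0 < 2)%N) h -[ltnLHS]addn0 ltn_add2l.
have hm : ((t - u) * (t + u) = p ^ r)%N by rewrite -subn_sqr h addKn.
have /(dvdn_pfactor _ _ pp)[i ir hi] : (t - u %| p ^ r)%N by rewrite -hm dvdn_mulr.
have /(dvdn_pfactor _ _ pp)[j jr hj] : (t + u %| p ^ r)%N by rewrite -hm dvdn_mull.
have i0 : i = 0%N.
  case: i ir hi => // i ir hi; exfalso; case/negP: pt.
  have pd1 : (p %| t - u)%N by rewrite hi expnS dvdn_mulr.
  have pd2 : (p %| t + u)%N.
    rewrite hj; apply: dvdn_exp => //; rewrite lt0n; apply/eqP => j0.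
    by move: hj; rewrite j0 expn0; lia.
  have : (p %| 2 * t)%N.
    have -> : (2 * t = (t - u) + (t + u))%N by lia.
    by rewrite dvdn_add.
  by rewrite Euclid_dvdM// (gtnNdvd _ p2).
rewrite i0 expn0 in hi; rewrite hi mul1n in hm.
have tE : t = t0 by rewrite /t0; lia.
have uE : u = (p ^ r)./2 by lia.
split=> //; apply/eqP; rewrite -(eqn_pmul2l b0) betas0 -uE.
by [].
Qed.

Let base_solution : (t0 ^ 2 = (beta * s0) ^ 2 + p ^ r)%N /\ ~~ (p %| t0)%N.
Proof.
rewrite betas0 /t0; move: hpr pr1 (dvdn_exp hr (dvdnn p)); move: (p ^ r)%N => q q4 q1 pq.
have qo : q = (q./2).*2.+1 by lia.
have -> : q.+1./2 = q./2.+1 by lia.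
split; first by rewrite {3}qo -!mulnn -muln2; lia.
apply/negP => h.
have : (p %| 1)%N.
  have -> : 1%N = (2 * q./2.+1 - q)%N by lia.
  by rewrite dvdn_sub// dvdn_mull.
by rewrite dvdn1 => /eqP p1; move: p2; rewrite p1.
Qed.

Let s0_neq0 : s0 != 0%N.
Proof. by apply/eqP => h; move: betas0 pr1; rewrite h muln0; lia. Qed.

Let base_term : lambda_term R l (beta ^ 2) (t0, s0) = 1.
Proof.
rewrite /lambda_term /= (negbTE s0_neq0) mul1r sqrt_sqrn -natrM betas0 /t0 -natrB; last by lia.
by rewrite (_ : _ - _ = 1)%N ?expr1n//; lia.
Qed.

Lemma finite_hyperbola m' n e : (0 < n)%N -> finite_set (hyperbola m' 4 (beta ^ 2) n e).
Proof.
move=> n0; apply: (@sub_finite_set _ _ [set` sbox n]); last exact: finite_seq.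
by move=> ts /(hyperbola_sbox b0 n0).
Qed.

(** If p | t then p | s, and dividing by p is a bijection with the solutions for p^(r-2) in the
    class m pbar; it keeps the weight 1/2 at s = 0 and costs p^(l+1). For r = 1 there are none, as
    p^2 would divide p. The remaining solution (t0, s0) contributes 1^(l+1). *)
Lemma lambda_inner_split (e : int) :
  lambda_inner R l m 4 (beta ^ 2) (p ^ r) e =
  p%:R ^+ l.+1 * (if r == 1%N then 0 else
    lambda_inner R l (m * pbar) 4 (beta ^ 2) (p ^ (r - 2)) e) +
  (if `[< (t0%:Z = e * m %[mod 4])%Z >] then 1 else 0).
Proof.
have fH := finite_hyperbola m e pr0.
rewrite /lambda_inner (fsbigID [set ts | (p %| ts.1)%N])//; congr (_ + _); last first.
  case: asboolP => ht.
    rewrite (_ : _ `&` _ = [set (t0, s0)]) ?fsbig_set1//.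
    apply/seteqP; split=> [[t s] [/hyperbolaE[/= _ h1 _] /= /negP h2]|_ ->].
      by have [-> ->] := coprime_solution h1 h2.
    have [h1 h2] := base_solution; split; last exact/negP.
    by apply/hyperbolaE; split=> //=; rewrite /t0; lia.
  rewrite (_ : _ `&` _ = set0) ?fsbig_set0//.
  apply/seteqP; split=> // -[t s] [/hyperbolaE[/= _ h1 h3] /= /negP h2]; apply: ht.
  by have [<- _] := coprime_solution h1 h2.
have descent t s : (t ^ 2 = (beta * s) ^ 2 + p ^ r)%N -> (p %| t)%N ->
    exists s', s = (p * s')%N.
  move=> h pt; have : (p %| (beta * s) ^ 2)%N.
    by rewrite -(dvdn_addl _ (dvdn_exp hr (dvdnn p))) -h dvdn_exp.
  rewrite Euclid_dvdX// Euclid_dvdM// andbT => /orP[/dvdn_leq|/dvdnP[s' ->]].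
    by move=> /(_ b0); case: hbeta => ->; lia.
  by exists s'; rewrite mulnC.
have [r1|r1] := eqVneq r 1%N.
  rewrite mulr0 (_ : _ `&` _ = set0) ?fsbig_set0//.
  apply/seteqP; split=> // -[t s] [/hyperbolaE[/= _ h _] /= pt].
  have [s' hs'] := descent _ _ h pt; move/dvdnP: pt h => [t' ->]; rewrite hs' r1.
  rewrite mulnCA !expnMn expn1 => h.
  have : (p ^ 2 %| p)%N.
    rewrite -(dvdn_addr _ (dvdn_mulr (beta ^ 2 * s' ^ 2) (dvdnn (p ^ 2)))) -h.
    by rewrite dvdn_mull.
  by move=> /(dvdn_leq p0); rewrite leqNgt -mulnn ltn_Pmulr ?prime_gt1.
have r2 : (r = (r - 2).+2)%N by lia.
have prE : (p ^ r = p ^ 2 * p ^ (r - 2))%N by rewrite -expnD {1}r2.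
rewrite mulr_fsumr//.
rewrite (@reindex_fsbig _ _ _ _ _ (fun ts => ((p * ts.1)%N, (p * ts.2)%N))
  (hyperbola (m * pbar) 4 (beta ^ 2) (p ^ (r - 2)) e)).
  apply: eq_fsbigr => -[t s] _; rewrite /lambda_term /= muln_eq0 (gtn_eqF p0)/=.
  rewrite sqrt_sqrn mulrCA -exprMn !natrM mulrBr; congr (_ * (_ - _) ^+ _).
  by rewrite mulrCA.
have smallE t s : hyperbola (m * pbar) 4 (beta ^ 2) (p ^ (r - 2)) e (t, s) <->
    hyperbola m 4 (beta ^ 2) (p ^ r) e ((p * t)%N, (p * s)%N).
  rewrite /hyperbola /= muln_gt0 p0/= !PoszM prE (PoszM (p ^ 2)%N).
  split=> -[h1 [h2 h3]]; split=> //; split.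
  - have -> : (p%:Z * t%:Z) ^+ 2 - (beta ^ 2)%N%:Z * (p%:Z * s%:Z) ^+ 2 =
      p%:Z ^+ 2 * (t%:Z ^+ 2 - (beta ^ 2)%N%:Z * s%:Z ^+ 2) by ring.
    by rewrite h2 -mulnn PoszM expr2.
  - exact/(@eqz_mod4_scale p m pbar t%:Z e hpbar).
  - have P0 : p%:Z ^+ 2 != 0 by rewrite expf_neq0// eqz_nat -lt0n.
    apply: (mulfI P0); transitivity ((p%:Z * t%:Z) ^+ 2 - (beta ^ 2)%N%:Z * (p%:Z * s%:Z) ^+ 2).
      by ring.
    by rewrite h2 -mulnn PoszM expr2.
  - exact/(@eqz_mod4_scale p m pbar t%:Z e hpbar).
split.
- by move=> [t s] /smallE h; split=> //=; rewrite dvdn_mulr.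
- by move=> [t s] [t' s'] _ _ [/eqP + /eqP]; rewrite !eqn_pmul2l// => /eqP -> /eqP ->.
- move=> [t s] [/= h pt]; have /hyperbolaE[/= _ h2 _] := h.
  have [s' hs'] := descent _ _ h2 pt; move/dvdnP: pt h => [t' ->]; rewrite hs' mulnC => h.
  by exists (t', s') => //; apply/smallE.
Qed.

(** For odd l the two values of epsilon enter with opposite signs. Since t0 = (p^r + 1)/2 is 1 or 3
    mod 4 according as p^r is 1 or 5 mod 8, exactly one of t0 = m, t0 = -m holds mod 4. *)
Lemma lambda_difference : odd l -> (m = 1 \/ m = 3) ->
  lambda R l m 4 (beta ^ 2) (p ^ r) - p%:R ^+ l.+1 * (if r == 1%N then 0 else
    lambda R l (m * pbar) 4 (beta ^ 2) (p ^ (r - 2))) =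
  (jacobi (-1) (absz m))%:~R * (jacobi 2 (p ^ r))%:~R.
Proof.
move=> ol hm; rewrite jacobi2_prime_power//.
have lambda_odd m' n : lambda R l m' 4 (beta ^ 2) n =
    lambda_inner R l m' 4 (beta ^ 2) n 1 - lambda_inner R l m' 4 (beta ^ 2) n (-1).
  by rewrite lambdaE -signr_odd ol expr1 mulN1r.
have -> : (if r == 1%N then 0 else lambda R l (m * pbar) 4 (beta ^ 2) (p ^ (r - 2))) =
  (if r == 1%N then 0 else lambda_inner R l (m * pbar) 4 (beta ^ 2) (p ^ (r - 2)) 1) -
  (if r == 1%N then 0 else lambda_inner R l (m * pbar) 4 (beta ^ 2) (p ^ (r - 2)) (-1)).
  by case: (r == 1%N); [rewrite subr0|exact: lambda_odd].
rewrite lambda_odd !lambda_inner_split.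
set x1 := if r == 1%N then 0 else _; set x2 := if r == 1%N then 0 else _.
set y1 := if _ then 1 else 0; set y2 := if _ then 1 else 0.
transitivity (y1 - y2); first by ring.
rewrite /y1 /y2.
have t0E : t0%:Z = (if (p ^ r %% 8 == 1)%N then 1 else 3) %[mod 4] %Z.
  by move: hpr; rewrite /t0; move: (p ^ r)%N => q; clear; case: ifP; lia.
case: hm => ->; rewrite /= ?jacobiN1_1 ?jacobiN1_3.
  case: ifP t0E => _ ht; rewrite !ht.
    by rewrite asboolT// asboolF// subr0 mulr1.
  by rewrite asboolF// asboolT// sub0r mulrN1z mulr1z mul1r.
case: ifP t0E => _ ht; rewrite !ht.
  by rewrite asboolF// asboolT// sub0r mulrN1z mulr1z mulr1.
by rewrite asboolT// asboolF// subr0 mulrN1z mulrNN mulr1.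
Qed.

End LambdaDifference.

(** * The moment formula *)

Lemma Posz_expn (m n : nat) : (m ^ n)%N%:Z = m%:Z ^+ n.
Proof. by elim: n => // n IH; rewrite expnS PoszM exprS IH. Qed.

Lemma hurwitz_div_int (X : int) (n : nat) : (0 < n)%N -> ~~ (n%:Z %| X)%Z ->
  hurwitz (X%:~R / n%:R) = 0.
Proof.
move=> n0 nX; apply: hurwitz_nonint; apply: contra nX => /intrP[z hz].
apply/dvdzP; exists z; apply: (@intr_inj rat).
by rewrite rmorphM/= -hz divfK// pnatr_eq0 -lt0n.
Qed.

(** * Descent from p^(s+2) to p^s for class numbers *)

Section HurwitzDescent.
Variables (p beta : nat).
Hypotheses (pp : prime p) (p2 : (2 < p)%N) (hbeta : beta = 1%N \/ beta = 2%N).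

Let b0 : (0 < beta)%N. Proof. by case: hbeta => ->. Qed.
Let cpb : coprime beta p.
Proof. by rewrite coprime_sym prime_coprime//; case: hbeta => ->; rewrite gtnNdvd//; lia. Qed.

(** Write |t| = p^a k with k prime to p; the strict inequality gives 2a < s, so p^s - t^2 = p^(2a) Y
    with -Y = k^2 mod p. Dividing by beta^2 keeps this a nonzero square, and [mass_p2] applies. *)
Lemma hurwitz_descent (s : nat) (t : int) : t != 0 -> t ^+ 2 < (p ^ s)%N%:Z ->
  hurwitz (((p ^ s.+2)%N%:Z - (p%:Z * t) ^+ 2)%:~R / (beta ^ 2)%:R) =
  p%:R * hurwitz (((p ^ s)%N%:Z - t ^+ 2)%:~R / (beta ^ 2)%:R).
Proof.
move=> t0 tps; have p0 : (0 < p)%N by exact: prime_gt0.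
have b20 : (0 < beta ^ 2)%N by rewrite expn_gt0 b0.
set X := (p ^ s)%N%:Z - t ^+ 2; have X0 : 0 < X by rewrite subr_gt0.
have -> : (p ^ s.+2)%N%:Z - (p%:Z * t) ^+ 2 = p%:Z ^+ 2 * X.
  by rewrite /X !expnS !PoszM; ring.
have cop k : coprimez (beta ^ 2)%N%:Z (p%:Z ^+ k).
  by rewrite coprimezE abszX coprimeXl// coprimeXr.
have [/dvdzP[N hN]|nX] := boolP ((beta ^ 2)%N%:Z %| X)%Z; last first.
  rewrite !hurwitz_div_int ?mulr0// Gauss_dvdzr//.
have b2n0 : (beta ^ 2)%:R != 0 :> rat by rewrite pnatr_eq0 -lt0n.
have b2z : 0 < (beta ^ 2)%N%:Z by rewrite ltz_nat.
have N0 : 0 < N by rewrite -(pmulr_lgt0 _ b2z) -hN.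
have hwN (Y : int) : 0 < Y -> hurwitz ((Y * (beta ^ 2)%N%:Z)%:~R / (beta ^ 2)%:R) = mass (- Y).
  move=> Y0; rewrite rmorphM/= mulfK// -[Y in LHS]gtz0_abs// hurwitz_nat_pos ?gtz0_abs//.
  by rewrite absz_gt0 gt_eqF.
rewrite hN mulrA !hwN//; last by rewrite mulr_gt0// exprn_gt0// ltz_nat.
have [a [k [pk tE]]] : exists a k : nat, ~~ (p %| k)%N /\ t ^+ 2 = p%:Z ^+ (2 * a) * k%:Z ^+ 2.
  have at0 : (0 < absz t)%N by rewrite absz_gt0.
  have [k pk hk] := pfactor_coprime pp at0.
  exists (logn p (absz t)), k; split; first by rewrite -prime_coprime.
  rewrite -[t ^+ 2]ger0_norm ?sqr_ge0// normrX -abszE {1}hk PoszM exprMn mulrC.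
  by rewrite Posz_expn mulnC exprM.
have as2 : (2 * a < s)%N.
  rewrite -(ltn_exp2l _ _ (prime_gt1 pp)) -ltz_nat; apply: le_lt_trans tps.
  rewrite tE Posz_expn -[X in X <= _]mulr1 ler_wpM2l ?exprn_ge0//.
  have : (0 < k)%N by rewrite lt0n; apply: contraNneq pk => ->; rewrite dvdn0.
  by move=> k0; rewrite exprn_ege1.
set Y := p%:Z ^+ (s - 2 * a) - k%:Z ^+ 2.
have XY : X = p%:Z ^+ (2 * a) * Y.
  rewrite /X /Y mulrBr -exprD subnKC; last exact: ltnW.
  by rewrite tE Posz_expn.
have P2a : p%:Z ^+ (2 * a) != 0 by rewrite expf_neq0// eqz_nat -lt0n.
have /dvdzP[D hD] : ((beta ^ 2)%N%:Z %| Y)%Z.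
  by rewrite -(Gauss_dvdzr _ (cop (2 * a)%N)) -XY hN dvdz_mull.
have ND : N = p%:Z ^+ (2 * a) * D.
  by apply: (mulIf (lt0r_neq0 b2z)); rewrite -hN XY hD mulrA.
have D0 : - D < 0.
  rewrite oppr_lt0; have P2a' : 0 < p%:Z ^+ (2 * a) :> int by rewrite exprn_gt0// ltz_nat.
  by rewrite -(pmulr_rgt0 _ P2a') -ND.
have pb : ~~ (p%:Z %| beta%:Z)%Z by rewrite dvdzE/= -prime_coprime// coprime_sym.
(* d = k / beta mod p is the square root of -D. *)
have [d dp hd] := linear_congruence pp k%:Z pb.
have {hd} hd : (p%:Z %| k%:Z - beta%:Z * d%:Z)%Z by rewrite hd.
have pd : ~~ (p%:Z %| d%:Z)%Z.
  apply: contra pk => pd; have : (p%:Z %| k%:Z)%Z.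
    by rewrite -[k%:Z](subrK (beta%:Z * d%:Z)) rpredD// dvdz_mull.
  by rewrite dvdzE.
have pD : (p%:Z %| - D - d%:Z ^+ 2)%Z.
  have : (p%:Z %| beta%:Z * (beta%:Z * (- D - d%:Z ^+ 2)))%Z.
    have -> : beta%:Z * (beta%:Z * (- D - d%:Z ^+ 2)) =
       (k%:Z - beta%:Z * d%:Z) * (k%:Z + beta%:Z * d%:Z) - p%:Z ^+ (s - 2 * a).
      have hY : D * beta%:Z ^+ 2 = p%:Z ^+ (s - 2 * a) - k%:Z ^+ 2.
        by rewrite -/Y hD -mulnn PoszM expr2.
      transitivity (- (D * beta%:Z ^+ 2) - beta%:Z ^+ 2 * d%:Z ^+ 2); first by ring.
      by rewrite hY; ring.
    rewrite rpredB ?dvdz_mulr//.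
    have : (0 < s - 2 * a)%N by rewrite subn_gt0.
    by case: (s - 2 * a)%N => // e _; rewrite exprS dvdz_mulr.
  by rewrite !(prime_dvdzM pp) (negbTE pb).
by rewrite ND -!mulrN (mass_p2 pp p2 _ D0 pd pD).
Qed.

End HurwitzDescent.

Lemma sqrz_ge_norm (t : int) : `|t| <= t ^+ 2.
Proof.
have [->|t0] := eqVneq t 0; first by rewrite normr0 expr0n.
by rewrite -real_normK ?num_real// expr2 ler_peMl//; lia.
Qed.

(** * Terms of the moment divisible by p *)

Section Moments.
Variable R : realType.
Local Notation C := (cplx R).
Variables (k p beta r : nat) (m pbar : int).
Hypotheses (ok : odd k) (pp : prime p) (p2 : (2 < p)%N)
  (hbeta : beta = 1%N \/ beta = 2%N) (hm : m = 1 \/ m = 3)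
  (hpbar : (p%:Z * pbar = 1 %[mod 4])%Z).

Local Notation hwb := (hw R (beta ^ 2)).

Let p0 : (0 < p)%N. Proof. exact: prime_gt0. Qed.
Let b20 : (0 < beta ^ 2)%N. Proof. by rewrite expn_gt0; case: hbeta => ->. Qed.
Let P0 : (p%:Z : int) != 0. Proof. by rewrite eqz_nat -lt0n. Qed.
Let b2q : 0 < (beta ^ 2)%:R :> rat. Proof. by rewrite ltr0n. Qed.

Lemma hurwitz_out (n : nat) (t : int) : n%:Z < t ^+ 2 ->
  hurwitz ((n%:Z - t ^+ 2)%:~R / (beta ^ 2)%:R) = 0.
Proof.
by move=> nt; rewrite hurwitz_neg// pmulr_llt0 ?invr_gt0// ltrz0 subr_lt0.
Qed.

Lemma hw_out (n : nat) (t : int) : n%:Z < `|t| -> hwb n t = 0.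
Proof.
by move=> nt; rewrite /hw hurwitz_out ?rmorph0// (lt_le_trans nt)// sqrz_ge_norm.
Qed.

Lemma hurwitz_momentE : ratr (hurwitz_moment k m 4 (beta ^ 2) p r) =
  \sum_(t <- zball (p ^ r) | (t == m %[mod 4])%Z && ~~ (p%:Z %| t)%Z)
    hwb (p ^ r) t * t%:~R ^+ k :> C.
Proof.
rewrite /hurwitz_moment.
have -> : [set t : int | ~~ (p%:Z %| t)%Z /\ (t = m %[mod 4])%Z] =
    [set t : int | (t == m %[mod 4])%Z && ~~ (p%:Z %| t)%Z].
  by apply/seteqP; split=> t /= => [[-> ->]|/andP[/eqP]]; rewrite ?eqxx.
rewrite -(@zball_fsbig _ (p ^ r)) => [|t _ tp].
  rewrite rmorph_sum/=; apply: eq_bigr => t _.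
  by rewrite rmorphM /= [ratr (_ ^+ _)]rmorphXn /= ratr_int.
by rewrite hurwitz_out ?mul0r// (lt_le_trans tp)// sqrz_ge_norm.
Qed.

Lemma mod4_scale (t : int) : (p%:Z * t == m %[mod 4])%Z = (t == m * pbar %[mod 4])%Z.
Proof.
have h := @eqz_mod4_scale p m pbar t 1 hpbar; rewrite !mul1r in h.
by apply/eqP/eqP => /h.
Qed.

Lemma sum_multiples : (2 <= r)%N ->
  \sum_(t <- zball (p ^ r) | (t == m %[mod 4])%Z && (p%:Z %| t)%Z) hwb (p ^ r) t * t%:~R ^+ k =
  \sum_(t <- zball (p ^ (r - 2)) | (t == m * pbar %[mod 4])%Z)
     hwb (p ^ r) (p%:Z * t) * (p%:Z * t)%:~R ^+ k.
Proof.
move=> r2; rewrite !zball_fsbig; last first.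
- by move=> t _ tp; rewrite hw_out ?mul0r.
- move=> t _ tp; rewrite /hw hurwitz_out ?rmorph0 ?mul0r//.
  have -> : (p ^ r = p ^ 2 * p ^ (r - 2))%N by rewrite -expnD subnKC.
  rewrite exprMn PoszM Posz_expn ltr_pM2l ?exprn_gt0 ?ltz_nat//.
  exact: lt_le_trans tp (sqrz_ge_norm t).
apply: reindex_fsbig; split.
- by move=> t /= ht; rewrite mod4_scale ht dvdz_mulr.
- by move=> t u _ _ /(mulfI P0).
- move=> t /= /andP[ht /dvdzP[u hu]]; exists u; last by rewrite mulrC.
  by rewrite -mod4_scale mulrC -hu.
Qed.

(** m is odd, so the case t = 0, excluded from the descent, never occurs. *)
Let residue_neq0 (t : int) : (t == m * pbar %[mod 4])%Z -> t != 0.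
Proof.
rewrite -mod4_scale; apply: contraTneq => ->; rewrite mulr0.
by case: hm => ->.
Qed.

(** At t^2 = p^s both class numbers are H(0) = -1/12, and -1/12 = p (-1/12) + (p - 1)/12. *)
Lemma hw_scale (s : nat) (t : int) : t != 0 ->
  hwb (p ^ s.+2) (p%:Z * t) = p%:R * hwb (p ^ s) t +
    (if t ^+ 2 == (p ^ s)%N%:Z then 12^-1 * (p%:R - 1) else 0).
Proof.
move=> t0; rewrite /hw; have [ts|ts|ts] := ltgtP (t ^+ 2) (p ^ s)%N%:Z.
- by rewrite hurwitz_descent// rmorphM /= ratr_nat addr0.
- rewrite !hurwitz_out ?rmorph0 ?mulr0 ?addr0//.
  by rewrite exprMn !expnS !PoszM mulrA ltr_pM2l// ltz_nat muln_gt0 p0.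
- have -> : (p ^ s.+2)%N%:Z - (p%:Z * t) ^+ 2 = 0.
    by rewrite exprMn ts !expnS !PoszM; ring.
  rewrite -ts subrr mulr0z mul0r hurwitz0 rmorphN fmorphV /= ratr_nat; ring.
Qed.

Lemma sum_multiples_difference : (2 <= r)%N ->
  \sum_(t <- zball (p ^ r) | (t == m %[mod 4])%Z && (p%:Z %| t)%Z) hwb (p ^ r) t * t%:~R ^+ k
  - p%:R ^+ k.+1 * \sum_(t <- zball (p ^ (r - 2)) | (t == m * pbar %[mod 4])%Z)
     hwb (p ^ (r - 2)) t * t%:~R ^+ k =
  \sum_(t <- zball (p ^ (r - 2)) | (t == m * pbar %[mod 4])%Z && (t ^+ 2 == (p ^ (r - 2))%N%:Z))
     12^-1 * (p%:R - 1) * (p%:R * t%:~R) ^+ k.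
Proof.
move=> r2; rewrite sum_multiples// big_distrr/= -sumrB big_mkcondr/=.
apply: eq_bigr => t ht.
have e : hwb (p ^ r) = hwb (p ^ (r - 2).+2) by congr (hwb (p ^ _)); lia.
rewrite e hw_scale ?residue_neq0// rmorphM /= pmulrn.
move: (hwb _ _) => H; case: ifP => _; rewrite exprS !exprMn; ring.
Qed.

(** t^2 = p^(r-2) forces r = 2(h + 1) and t = e p^h with e = 1 or -1. The condition p t = m mod 4
    selects e = (-1/m)(-1/p^(h+1)), and e^k = e since k is odd. *)
Lemma boundary_sum : (2 <= r)%N ->
  \sum_(t <- zball (p ^ (r - 2)) | (t == m * pbar %[mod 4])%Z && (t ^+ 2 == (p ^ (r - 2))%N%:Z))
     12^-1 * (p%:R - 1) * (p%:R * t%:~R) ^+ k =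
  (if (2 %| r)%N then
     12^-1 * p%:R ^+ ((r * k)./2) * (p%:R - 1)
       * (jacobi (-1) (absz m))%:~R * (jacobi (-1) (p ^ (r./2)))%:~R
   else 0) :> C.
Proof.
move=> r2; case: ifPn => [r_even|r_odd]; last first.
  rewrite big1// => t /andP[_ /eqP h]; exfalso; move/negP: r_odd; apply.
  have ht : (absz t ^ 2 = p ^ (r - 2))%N.
    by apply/eqP; rewrite -eqz_nat Posz_expn abszE real_normK ?num_real// h.
  have := congr1 (logn p) ht; rewrite !lognX (logn_prime p pp) eqxx muln1 => e.
  by rewrite -(subnK r2) -e dvdn_add// dvdn_mulr.
have [h hE] : exists h, r = h.+1.*2.
  by exists (r./2.-1); move: r_even r2; rewrite dvdn2; lia.
have qE : (p ^ (r - 2))%N%:Z = (p ^ h)%N%:Z ^+ 2.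
  by rewrite hE doubleS -addn2 addnK -muln2 expnM Posz_expn.
have pho : odd (p ^ h.+1) by rewrite oddX; case/even_prime: pp => [p22|->//]; move: p2; rewrite p22.
pose e : int := jacobi (-1) (absz m) * jacobi (-1) (p ^ h.+1).
have eE : (e = 1 \/ e = -1) /\ (forall e' : int, e' = 1 \/ e' = -1 ->
    (e' * (p ^ h.+1)%N%:Z == m %[mod 4])%Z = (e' == e)).
  rewrite /e jacobiN1_prime_power//; move: (p ^ h.+1)%N pho => q qo.
  case: hm => ->; rewrite /= ?jacobiN1_1 ?jacobiN1_3.
    case: ifP => hq; split; [by left| |by right|]; move=> e' [->|->]; lia.
  case: ifP => hq; split; [by right| |by left|]; move=> e' [->|->]; lia.
have [epm he] := eE.
rewrite (eq_bigl (fun t => t == e * (p ^ h)%N%:Z)); last first.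
  move=> t; rewrite -mod4_scale qE eqf_sqr; apply/andP/eqP.
    move=> [ht /orP[] /eqP tE].
      have : (1 * (p ^ h.+1)%N%:Z == m %[mod 4])%Z by rewrite mul1r expnS PoszM -tE.
      by rewrite he; [move=> /eqP <-; rewrite mul1r|left].
    have : ((-1) * (p ^ h.+1)%N%:Z == m %[mod 4])%Z.
      by rewrite mulN1r expnS PoszM -mulrN -tE.
    by rewrite he; [move=> /eqP <-; rewrite mulN1r|right].
  move=> ->; split.
    by rewrite mulrCA -PoszM -expnS he// eqxx.
  by case: epm => ->; rewrite ?mul1r ?mulN1r eqxx ?orbT.
rewrite -big_filter filter_pred1_uniq ?zball_uniq//; last first.
  rewrite mem_zball hE doubleS -addn2 addnK.
  have -> : `|e * (p ^ h)%N%:Z| = (p ^ h)%N%:Z.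
    by case: epm => ->; rewrite ?mul1r ?mulN1r ?normrN.
  by rewrite lez_nat leq_exp2l ?prime_gt1// -addnn leq_addr.
rewrite big_seq1 rmorphM /= -mulrA.
have ek : e%:~R ^+ k = e%:~R :> C.
  by case: epm => ->; rewrite ?mulr1z ?expr1n// mulrN1z -signr_odd ok expr1.
have -> : ((r * k)./2 = h.+1 * k)%N by rewrite hE -doubleMl doubleK.
have -> : (r./2 = h.+1)%N by rewrite hE doubleK.
rewrite !exprMn ek -[(p ^ h)%N%:~R]/((p ^ h)%:R) natrX (exprM _ h.+1) (exprS _ h) (exprMn _ p%:R).
by rewrite /e rmorphM /=; ring.
Qed.

End Moments.

(** * Assembling the formula *)

Section MainFormula.
Variable R : realType.
Local Notation C := (cplx R).
Local Notation toC := (@toC R).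

(** [cheb_expansion] under the sum over t, with 2^(-2 mu) n^mu = (n/4)^mu. *)
Lemma weight_sum_cheb k m b n : odd k ->
  \sum_(0 <= mu < k.-1./2.+1) 2 ^- (2 * mu) * Tcoef C k mu *
     weight_sum R (k - 2 * mu) m 4 b n * n%:R ^+ mu =
  \sum_(t <- zball n | (t == m %[mod 4])%Z) hw R b n t * t%:~R ^+ k.
Proof.
move=> ok; have -> : (k.-1./2 = k./2)%N by lia.
rewrite /weight_sum.
under eq_bigr do rewrite big_distrr big_distrl/=.
rewrite exchange_big/=; apply: eq_bigr => t _.
rewrite -(cheb_expansion t%:~R n%:R k) big_distrr/=; apply: eq_big_nat => mu /andP[_ hmu].
rewrite Tcoef_ballot; last by lia.
rewrite -mul2n expr_div_n (exprM 2) (_ : 2 ^+ 2 = 4); last by ring.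
by ring.
Qed.

Lemma main_formula k p beta r (m : nat) (pbar : int) :
  odd k -> prime p -> (2 < p)%N -> beta = 1%N \/ beta = 2%N -> m = 1%N \/ m = 3%N ->
  (0 < r)%N -> (p ^ r %% 4 = 1)%N -> (p%:Z * pbar = 1 %[mod 4])%Z ->
  ratr (hurwitz_moment k m%:Z 4 (beta ^ 2) p r) =
      \sum_(0 <= mu < (k.-1)./2.+1)
         2 ^- (2 * mu) * Tcoef C k mu
         * (alphacoef R (k - 2 * mu) m%:Z 4 (beta ^ 2) (p ^ r)
            - p%:R ^+ (k - 2 * mu + 1)
              * (if r == 1%N then 0
                 else alphacoef R (k - 2 * mu) (m%:Z * pbar) 4 (beta ^ 2) (p ^ (r - 2))))
         * p%:R ^+ (r * mu)
      - toC (Num.sqrt ((beta ^ 2)%:R : R))^-1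
        * (jacobi (-1) m)%:~R * (jacobi 2 (p ^ r))%:~R * 2 ^- (k + 1)
        * \sum_(0 <= mu < (k.-1)./2.+1) Tcoef C k mu * p%:R ^+ (r * mu)
      - (if (2 %| r)%N then
           12^-1 * p%:R ^+ ((r * k)./2) * (p%:R - 1)
           * (jacobi (-1) m)%:~R * (jacobi (-1) (p ^ (r./2)))%:~R
         else 0).
Proof.
move=> ok pp p2 hbeta hm hr hpr hpbar.
have p0 : (0 < p)%N by exact: prime_gt0.
have b0 : (0 < beta)%N by case: hbeta => ->.
have hm' : m%:Z = 1 \/ m%:Z = 3 by case: hm => ->; [left|right].
have pn0 : p%:R != 0 :> C by rewrite pnatr_eq0 -lt0n.
set c := toC (Num.sqrt _)^-1.
set J := (jacobi (-1) m)%:~R * (jacobi 2 (p ^ r))%:~R : C.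
pose W mu := weight_sum R (k - 2 * mu) m%:Z 4 (beta ^ 2) (p ^ r).
pose W' mu : C := if r == 1%N then 0 else
  weight_sum R (k - 2 * mu) (m%:Z * pbar) 4 (beta ^ 2) (p ^ (r - 2)).
have term mu : (mu < k.-1./2.+1)%N ->
  2 ^- (2 * mu) * Tcoef C k mu
         * (alphacoef R (k - 2 * mu) m%:Z 4 (beta ^ 2) (p ^ r)
            - p%:R ^+ (k - 2 * mu + 1)
              * (if r == 1%N then 0
                 else alphacoef R (k - 2 * mu) (m%:Z * pbar) 4 (beta ^ 2) (p ^ (r - 2))))
         * p%:R ^+ (r * mu) =
  2 ^- (2 * mu) * Tcoef C k mu * W mu * (p ^ r)%:R ^+ mu
  - p%:R ^+ k.+1 * (2 ^- (2 * mu) * Tcoef C k mu * W' mu * (p ^ (r - 2))%:R ^+ mu)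
  + c * J * 2 ^- (k + 1) * (Tcoef C k mu * p%:R ^+ (r * mu)).
  move=> hmu; set l := (k - 2 * mu)%N; have ol : odd l by rewrite /l; lia.
  have kE : (k + 1 = 2 * mu + l.+1)%N by rewrite /l; lia.
  have lE : (l + 1 = l.+1)%N by rewrite addn1.
  have toCd x : toC ((Num.sqrt (beta ^ 2)%:R)^-1 * 2 ^- l.+1 * x) = c * 2 ^- l.+1 * toC x.
    by rewrite !toCM (toCV (2 ^+ l.+1)) toCX toC_nat.
  have prE : p%:R ^+ (r * mu) = (p ^ r)%:R ^+ mu :> C by rewrite exprM natrX.
  pose L1 := toC (lambda R l m%:Z 4 (beta ^ 2) (p ^ r)).
  pose L2 := toC (if r == 1%N then 0 else lambda R l (m%:Z * pbar) 4 (beta ^ 2) (p ^ (r - 2))).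
  have hl : L1 - p%:R ^+ l.+1 * L2 = J.
    have := congr1 toC (lambda_difference R pp p2 hbeta hr hpr hpbar ol hm').
    by rewrite toCD toCN !toCM toCX toC_nat !toC_int.
  have -> : (if r == 1%N then 0 else alphacoef R l (m%:Z * pbar) 4 (beta ^ 2) (p ^ (r - 2)))
      = W' mu + c * 2 ^- l.+1 * L2.
    rewrite /W' /L2; case: (r == 1%N); first by rewrite add0r mulr0.
    by rewrite alphacoefE ?expn_gt0 ?p0// toCd.
  rewrite alphacoefE ?expn_gt0 ?p0// toCd -/(W mu) -/L1 lE prE.
  (* The exponents agree: l + 1 + r mu = k + 1 + (r - 2) mu for l = k - 2 mu. *)
  have hW' : p%:R ^+ l.+1 * W' mu * (p ^ r)%:R ^+ mu =
      p%:R ^+ k.+1 * W' mu * (p ^ (r - 2))%:R ^+ mu.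
    rewrite /W'; case: eqP => [_|/eqP r1]; first by rewrite !mulr0 !mul0r.
    rewrite mulrAC [RHS]mulrAC; congr (_ * _); rewrite !natrX -!exprM -!exprD.
    congr (_ ^+ _); rewrite -{1}(subnK (_ : 2 <= r)%N); last by lia.
    by rewrite mulnDl /l; lia.
  have h2 : 2 ^- (k + 1) = 2 ^- (2 * mu) * 2 ^- l.+1 :> C.
    by rewrite kE exprD invfM.
  rewrite h2 -hl.
  transitivity (2 ^- (2 * mu) * Tcoef C k mu * W mu * (p ^ r)%:R ^+ mu
     - 2 ^- (2 * mu) * Tcoef C k mu * (p%:R ^+ l.+1 * W' mu * (p ^ r)%:R ^+ mu)
     + 2 ^- (2 * mu) * Tcoef C k mu * (p ^ r)%:R ^+ mu * c * 2 ^- l.+1 * (L1 - p%:R ^+ l.+1 * L2)).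
    by ring.
  by rewrite hW'; ring.
rewrite (eq_big_nat _ _ (fun mu h => term mu (andP h).2)).
rewrite !big_split/= -big_distrr/= sumrN -big_distrr/=.
rewrite weight_sum_cheb// (hurwitz_momentE _ _ _ _ _ hbeta).
have -> : c * (jacobi (-1) m)%:~R * (jacobi 2 (p ^ r))%:~R = c * J by rewrite mulrA.
rewrite [X in _ = X - _]addrK.
(* The terms prime to p are the moment itself; what remains is that the multiples of p account for
   the sum at p^(r-2) and the boundary term. *)
rewrite [X in _ = X - _ - _](bigID (fun t => (p%:Z %| t)%Z))/=.
(* For r = 1 a multiple t of p in the class of m is nonzero, so t^2 >= p^2 > p and its class number
   vanishes. *)
have [r1|r1] := eqVneq r 1%N.
  have -> : (2 %| r)%N = false by rewrite r1.
  rewrite [X in p%:R ^+ k.+1 * X]big1; last first.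
    by move=> mu _; rewrite /W' r1 eqxx mulr0 mul0r.
  rewrite [X in _ = X + _ - _ - _]big1 ?add0r ?mulr0 ?subr0// => t /andP[ht /dvdzP[u hu]].
  rewrite /hw hurwitz_out ?rmorph0 ?mul0r// hu exprMn r1 expn1.
  have u0 : u != 0.
    apply: contraTneq ht => u0; rewrite hu u0 mul0r.
    by case: hm' => ->.
  have u2 : 1 <= u ^+ 2.
    by rewrite -real_normK ?num_real// exprn_ege1//; lia.
  rewrite -[ltLHS]mul1r; apply: lt_le_trans (_ : 1 * p%:Z ^+ 2 <= _).
    by rewrite !mul1r expr2 ltr_pMr ?ltz_nat// (leq_trans _ p2).
  by rewrite ler_wpM2r// exprn_ge0.
have r2 : (2 <= r)%N by lia.
rewrite (eq_bigr (fun mu => 2 ^- (2 * mu) * Tcoef C k mu *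
   weight_sum R (k - 2 * mu) (m%:Z * pbar) 4 (beta ^ 2) (p ^ (r - 2)) * (p ^ (r - 2))%:R ^+ mu)); last first.
  by move=> mu _; rewrite /W' (negbTE r1).
rewrite weight_sum_cheb//.
have h1 := sum_multiples_difference R ok pp p2 hbeta hm' hpbar r2.
have h2 := boundary_sum R ok pp p2 hbeta hm' hpbar r2.
rewrite -[absz _]/m in h2.
rewrite h2 in h1.
move/eqP: h1; rewrite subr_eq => /eqP ->.
have cancel (A B N : C) : N = A + B + N - B - A.
  by ring.
exact: cancel.
Qed.

End MainFormula.

(** * The case p^r = 3 mod 4, and the conclusion *)

Lemma hurwitz_int_mod4 (X : int) : (X %% 4)%Z = 2 -> hurwitz X%:~R = 0.
Proof.
move=> hX; rewrite /hurwitz intr_eq0; case: eqP => [X0|_]; first by move: hX; rewrite X0.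
rewrite numq_int ifF//; apply/negbTE; rewrite !negb_and; apply/orP; right; apply/orP; right.
by rewrite !inE; apply/negP => /orP[]/eqP; lia.
Qed.

Lemma hurwitz_moment_eq0 k (m : int) b p r :
  m = 1 \/ m = 3 -> b = 1%N \/ b = 4%N -> (p ^ r %% 4 = 3)%N ->
  hurwitz_moment k m 4 b p r = 0.
Proof.
move=> hm hb h3; apply: fsbig1 => t [_ ht].
suff -> : hurwitz (((p ^ r)%N%:Z - t ^+ 2)%:~R / b%:R) = 0 by rewrite mul0r.
have X2 : (((p ^ r)%N%:Z - t ^+ 2) %% 4)%Z = 2.
  have -> : ((p ^ r)%N%:Z - t ^+ 2 = (p ^ r)%N%:Z - 1 %[mod 4])%Z.
    apply/eqP; rewrite eqz_mod_dvd (_ : _ - _ = 1 - t ^+ 2); last by ring.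
    have [u ->] : exists u : int, t = 2 * u + 1.
      exists ((t %/ 2)%Z); move: ht; case: hm => ->; lia.
    have -> : 1 - (2 * u + 1) ^+ 2 = 4 * (- u * (u + 1)) by ring.
    exact: dvdz_mulr.
  by move: h3; move: (p ^ r)%N => q; lia.
(* For b = 1 no discriminant is 2 mod 4; for b = 4 the quotient is not an integer. *)
case: hb => ->; first by rewrite divr1 hurwitz_int_mod4.
by apply: hurwitz_div_int => //; apply/negP => /dvdz_mod0P; rewrite X2.
Qed.

Theorem theorem5p8 (R : realType) (k m b p r : nat) (pbar : int)
    (hk : odd k) (hm : m = 1%N \/ m = 3%N) (hb : b = 1%N \/ b = 4%N)
    (hp3 : (3 <= p)%N) (hp : prime p) (hr : (1 <= r)%N)
    (hpbar : (p%:Z * pbar = 1 %[mod 4])%Z) :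
  (((p ^ r) %% 4)%N = 1%N ->
    ratr (hurwitz_moment k m%:Z 4 b p r) =
      \sum_(0 <= mu < (k.-1)./2.+1)
         2 ^- (2 * mu) * Tcoef (cplx R) k mu
         * (alphacoef R (k - 2 * mu) m%:Z 4 b (p ^ r)
            - p%:R ^+ (k - 2 * mu + 1)
              * (if r == 1%N then 0
                 else alphacoef R (k - 2 * mu) (m%:Z * pbar) 4 b (p ^ (r - 2))))
         * p%:R ^+ (r * mu)
      - toC (Num.sqrt (b%:R : R))^-1
        * (jacobi (-1) m)%:~R * (jacobi 2 (p ^ r))%:~R * 2 ^- (k + 1)
        * \sum_(0 <= mu < (k.-1)./2.+1) Tcoef (cplx R) k mu * p%:R ^+ (r * mu)
      - (if (2 %| r)%N then
           12^-1 * p%:R ^+ ((r * k)./2) * (p%:R - 1)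
           * (jacobi (-1) m)%:~R * (jacobi (-1) (p ^ (r./2)))%:~R
         else 0))
  /\ (((p ^ r) %% 4)%N = 3%N -> hurwitz_moment k m%:Z 4 b p r = 0).
Proof.
split=> [hpr|].
  have [beta [hbeta ->]] : exists beta, (beta = 1%N \/ beta = 2%N) /\ b = (beta ^ 2)%N.
    by case: hb => ->; [exists 1%N|exists 2%N]; split; auto.
  exact: main_formula.
by apply: hurwitz_moment_eq0 hb; case: hm => ->; [left|right].
Qed.
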